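(* Each of the ten knot types $m(7_2)$, $m(7_6)$, $9_{44}$, $9_{48}$, $m(10_{132})$, $10_{136}$, $m(10_{140})$, $m(10_{145})$, $m(10_{161})$, and $12n_{591}$ is transversely nonsimple.
   Context: Knot names are those of the standard knot tables, with $m(\cdot)$ denoting the mirror image. A transverse knot in $\mathbb{R}^3$ is an equivalence class of braids (with closure a knot) modulo conjugation and positive stabilization/destabilization ($B\in B_n\leftrightarrow B\sigma_n\in B_{n+1}$); equivalently, a transverse isotopy class of knots everywhere transverse to the standard contact structure $\ker(dz-y\,dx)$. Its topological type is the knot type of the closure of $B$, and its self-linking number is $\mathrm{sl}(B)=w(B)-n(B)$, where $w(B)$ is the writhe (algebraic crossing number) and $n(B)$ the number of strands. A knot type is transversely nonsimple if there exist two transverse knots of that topological type with the same self-linking number that are not the same transverse knot (i.e., not transversely isotopic). To fix chirality conventions, the knot types are represented by the closures of the following braids (an integer $k$ denotes $\sigma_k$ and $\overline{k}$ denotes $\sigma_k^{-1}$): $m(7_2)$: $3\,3\,\overline{2}\,3\,2\,1\,1\,2\,\overline{1}\in B_4$; $m(7_6)$: $1\,\overline{2}\,1\,\overline{2}\,\overline{3}\,2\,3\,3\,3\in B_4$; $9_{44}$: $\overline{3}\,1\,2\,\overline{3}\,\overline{2}\,3\,1\,\overline{2}\,\overline{3}\in B_4$; $9_{48}$: $\overline{2}\,3\,3\,2\,\overline{1}\,2\,\overline{3}\,2\,1\,1\,\overline{2}\in B_4$; $m(10_{132})$: $3\,\overline{2}\,\overline{2}\,3\,3\,2\,\overline{3}\,\overline{1}\,2\,1\,1\in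 B_4$; $10_{136}$: $\overline{1}\,2\,\overline{1}\,2\,3\,3\,\overline{2}\,1\,\overline{2}\,\overline{3}\,2\in B_4$; $m(10_{140})$: $1\,1\,\overline{2}\,1\,2\,\overline{1}\,\overline{1}\,\overline{3}\,2\,3\,3\in B_4$; $m(10_{145})$: $\overline{2}\,3\,3\,2\,\overline{1}\,2\,1\,3\,2\,2\,1\,\overline{4}\in B_5$; $m(10_{161})$: $\overline{1}\,2\,1\,1\,1\,2\,2\,1\,1\,2\,\overline{3}\in B_4$; $12n_{591}$: $3\,2\,3\,2\,\overline{1}\,3\,2\,1\,3\,2\,1\,2\,1\,\overline{4}\in B_5$. *)

(* Defs.v *)
From Stdlib Require Import Relation_Operators.
From mathcomp Require Import all_boot all_order all_algebra.
From mathcomp Require Import reals.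

Set Implicit Arguments.
Unset Strict Implicit.
Unset Printing Implicit Defensive.

Import Order.TTheory GRing.Theory Num.Theory.
Local Open Scope ring_scope.

(* Braid words: the integer k > 0 stands for sigma_k and - k for its inverse. *)

Definition braid_word (n : nat) (w : seq int) : bool :=
  all (fun k : int => (0 < `|k| < n)%N) w.

Definition inv_word (w : seq int) : seq int := rev [seq - k | k <- w].

(* Equality in the braid group B_n, presented by generators and relations. *)
Inductive braid_eq (n : nat) : seq int -> seq int -> Prop :=
| braid_eq_refl w : braid_eq n w w
| braid_eq_sym w1 w2 : braid_eq n w1 w2 -> braid_eq n w2 w1
| braid_eq_trans w1 w2 w3 :
    braid_eq n w1 w2 -> braid_eq n w2 w3 -> braid_eq n w1 w3
| braid_eq_cat u1 u2 v1 v2 :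
    braid_eq n u1 u2 -> braid_eq n v1 v2 -> braid_eq n (u1 ++ v1) (u2 ++ v2)
| braid_eq_inv (k : int) :
    (0 < `|k| < n)%N -> braid_eq n [:: k; - k] [::]
| braid_eq_far (i j : nat) :
    (0 < i)%N -> (i.+1 < j)%N -> (j < n)%N ->
    braid_eq n [:: i%:Z; j%:Z] [:: j%:Z; i%:Z]
| braid_eq_braid (i : nat) :
    (0 < i)%N -> (i.+1 < n)%N ->
    braid_eq n [:: i%:Z; i.+1%:Z; i%:Z] [:: i.+1%:Z; i%:Z; i.+1%:Z].

(* Strand positions are numbered from 1 to n.  A strand that is at position p
   before the letter k is at position [cross k p] after it. *)
Definition cross (k : int) (p : nat) : nat :=
  if p == `|k|%N then p.+1 else if p == `|k|.+1%N then p.-1 else p.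

Definition end_pos (w : seq int) (p : nat) : nat :=
  foldl (fun q k => cross k q) p w.

(* The closure has one component: its permutation is an n-cycle. *)
Definition closes_to_knot (n : nat) (w : seq int) : bool :=
  all (fun p => p \in traject (end_pos w) 1%N n) (iota 1 n).

Record knot_braid := KnotBraid {
  strands : nat;
  word : seq int;
  knot_braidP :
    [&& (0 < strands)%N, braid_word strands word & closes_to_knot strands word]
}.

Inductive transverse_move (B B' : knot_braid) : Prop :=
| move_eq of strands B' = strands B
    & braid_eq (strands B) (word B) (word B')
| move_conj g of strands B' = strands B & braid_word (strands B) g
    & word B' = g ++ word B ++ inv_word g
| move_stab of strands B' = (strands B).+1
    & word B' = rcons (word B) (strands B)%:Z.

(* Two braids represent the same transverse knot. *)
Definition transversely_isotopic : knot_braid -> knot_braid -> Prop :=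
  clos_refl_sym_trans knot_braid transverse_move.

Definition writhe (B : knot_braid) : int := \sum_(k <- word B) sgz k.

Definition self_linking (B : knot_braid) : int := writhe B - (strands B)%:Z.

(* Oriented polygonal knots in R^3, given by the cyclic sequence of their
   vertices, up to elementary triangle moves. *)
Section PolygonalKnots.
Variable R : realType.
Implicit Types (P Q s : seq 'rV[R]_3) (a b c x : 'rV[R]_3).

Definition edge_point P (i : nat) (t : R) : 'rV[R]_3 :=
  (1 - t) *: nth 0 P i + t *: nth 0 P (i.+1 %% size P).

(* The polygon is an embedded closed curve. *)
Definition simple_polygon P : Prop :=
  (2 < size P)%N /\
  forall (i j : nat) (t u : R), (i < size P)%N -> (j < size P)%N ->
    0 <= t < 1 -> 0 <= u < 1 ->
    edge_point P i t = edge_point P j u -> i = j /\ t = u.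

Definition on_polygon P x : Prop :=
  exists (i : nat) (t : R),
    [/\ (i < size P)%N, 0 <= t <= 1 & x = edge_point P i t].

Definition on_segment a b x : Prop :=
  exists2 t : R, 0 <= t <= 1 & x = (1 - t) *: a + t *: b.

Definition on_triangle a b c x : Prop :=
  exists r t u : R, [/\ 0 <= r, 0 <= t & 0 <= u] /\
    r + t + u = 1 /\ x = r *: a + t *: b + u *: c.

(* In the triangle move the edge [a, b] is replaced by [a, c] and [c, b], the
   triangle a b c meeting the polygon in [a, b] only.  The triangle may be
   degenerate; simplicity of the new polygon then puts c between a and b. *)
Inductive knot_move P : seq 'rV[R]_3 -> Prop :=
| move_rot k : knot_move P (rot k P)
| move_triangle a b c s of P = [:: a, b & s]
    & simple_polygon P & simple_polygon [:: a, c, b & s]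
    & (forall x, on_polygon P x -> on_triangle a b c x -> on_segment a b x) :
    knot_move P [:: a, c, b & s].

Definition same_knot_type : seq 'rV[R]_3 -> seq 'rV[R]_3 -> Prop :=
  clos_refl_sym_trans (seq 'rV[R]_3) knot_move.

Definition point (x y z : int) : 'rV[R]_3 :=
  \row_(j < 3) (nth 0 [:: x; y; z] j)%:~R.

(* The braid runs in the direction of increasing y, the strand at position p
   before the letter number i being at (2 p, 2 i, 0).  At a letter sigma_k the
   strand going from position k to k + 1 passes above (z = 1) the one going
   from k + 1 to k, a right-handed crossing seen from z = +oo, and at the
   inverse of sigma_k it passes below (z = -1).  The end of the braid at
   position p is joined to its beginning at p inside the plane x = 2 p, passing
   below the braid at z = -2. *)
Fixpoint strand_path (i p : nat) (w : seq int) : seq 'rV[R]_3 :=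
  point (2 * p)%N (2 * i)%N 0 ::
  match w with
  | [::] => [:: point (2 * p)%N (2 * i + 2)%N (- 2);
                point (2 * p)%N (- 2) (- 2)]
  | k :: w' =>
      (if p == `|k|%N then [:: point (2 * p + 1)%N (2 * i + 1)%N (sgz k)]
       else [::]) ++ strand_path i.+1 (cross k p) w'
  end.

Definition braid_closure (B : knot_braid) : seq 'rV[R]_3 :=
  flatten [seq strand_path 0 p (word B)
          | p <- traject (end_pos (word B)) 1%N (strands B)].

Definition transversely_nonsimple (K : seq 'rV[R]_3) : Prop :=
  exists B1 B2 : knot_braid,
    [/\ same_knot_type (braid_closure B1) K,
        same_knot_type (braid_closure B2) K,
        self_linking B1 = self_linking B2
      & ~ transversely_isotopic B1 B2].

End PolygonalKnots.

Definition m7_2 : knot_braid :=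
  @KnotBraid 4 [:: 3; 3; -2; 3; 2; 1; 1; 2; -1]%Z isT.
Definition m7_6 : knot_braid :=
  @KnotBraid 4 [:: 1; -2; 1; -2; -3; 2; 3; 3; 3]%Z isT.
Definition k9_44 : knot_braid :=
  @KnotBraid 4 [:: -3; 1; 2; -3; -2; 3; 1; -2; -3]%Z isT.
Definition k9_48 : knot_braid :=
  @KnotBraid 4 [:: -2; 3; 3; 2; -1; 2; -3; 2; 1; 1; -2]%Z isT.
Definition m10_132 : knot_braid :=
  @KnotBraid 4 [:: 3; -2; -2; 3; 3; 2; -3; -1; 2; 1; 1]%Z isT.
Definition k10_136 : knot_braid :=
  @KnotBraid 4 [:: -1; 2; -1; 2; 3; 3; -2; 1; -2; -3; 2]%Z isT.
Definition m10_140 : knot_braid :=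
  @KnotBraid 4 [:: 1; 1; -2; 1; 2; -1; -1; -3; 2; 3; 3]%Z isT.
Definition m10_145 : knot_braid :=
  @KnotBraid 5 [:: -2; 3; 3; 2; -1; 2; 1; 3; 2; 2; 1; -4]%Z isT.
Definition m10_161 : knot_braid :=
  @KnotBraid 4 [:: -1; 2; 1; 1; 1; 2; 2; 1; 1; 2; -3]%Z isT.
Definition k12n_591 : knot_braid :=
  @KnotBraid 5 [:: 3; 2; 3; 2; -1; 3; 2; 1; 3; 2; 1; 2; 1; -4]%Z isT.

(* Main.v *)
(* A braid on n strands acts on n x n matrices over a field by polynomial
   substitutions.  Modelled on the augmentations of transverse knot contact
   homology, an augmentation of the braid, for given values mu and ell of the
   meridian and the longitude, is a solution of a system of polynomial equations
   formed from this action, and the existence of one depends only on the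
   transverse knot.  Each of the ten knot types contains two braids of equal
   self-linking number of which one has an augmentation over F_3 or F_5, which is
   exhibited, while the other has none, which a pruned tree search shows.

   That the closures of both braids have the same knot type is shown by a list of
   triangle moves between polygons with integer vertices.  Each move is certified
   by linear functionals: one that increases along the three vertices a, c, b of
   the triangle, and for every other edge one that separates it from the triangle.
   These also imply that the polygon remains simple. *)

Require Import Defs.
From Stdlib Require Import Relation_Operators ZArith.
From mathcomp Require Import all_boot all_order all_algebra.
From mathcomp Require Import reals boolp zify ssrZ ring lra.

Set Implicit Arguments.
Unset Strict Implicit.
Unset Printing Implicit Defensive.

Import Order.TTheory GRing.Theory Num.Theory.
Local Open Scope ring_scope.

(** * Augmentations of braids *)

(** By Markov's theorem, closed braids of one topological type are related by conjugation and
    stabilizations of both signs. An invariant that separates transverse knots of the same type must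
    therefore fail under negative stabilization. Here the triangular shape of Q is responsible. Let
    a braid on n + 1 strands be a word in B_n followed by the letter [- n]. Row n of Q vanishes at
    position n + 1, the word in B_n keeps this zero there, and the last letter moves it to position
    n, where the equation becomes (1 - mu) lam_n = 0. So there is no augmentation unless mu = 1; all
    certificates take mu = 2. Three of the given braids, the two on five strands and that of
    m(10_161), are excluded at once in this way. The other seven pairs need a search. It is made
    finite and small by a diagonal change of basis, which for a knot concentrates Lambda in a single
    entry ell, so that only the n (n - 1) off-diagonal entries remain unknown, and by an arithmetic
    with unknowns, in which partial assignments can already be contradictory. *)

Ltac decide_eqs := repeat match goal with
  | h : is_true (?x != ?y) |- context [?x == ?y] => rewrite (negPf h)
  | |- context [?x == ?x] => rewrite eqxx
  | |- context [@eq_op _ ?x ?y] =>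
      first [ have -> : (x == y) = false by lia | have -> : (x == y) = true by lia ]
  end; rewrite /=.

Ltac cases_at j x := case: (eqVneq j x) => [?|?]; [subst j|].

Section Augmentations.
Variable F : fieldType.
Implicit Types (mu ell : F) (a : nat -> nat -> F) (q lam : nat -> F).
Implicit Types (k : int) (w : seq int).

(* Matrices and row vectors are functions on nat, of which only the entries with
   indices 1, ..., n matter for braids on n strands. *)
Definition row_step a k q (j : nat) : F :=
  let s := `|k|%N in
  if j == s then (if 0 < k then q s * a s s.+1 - q s.+1 else q s.+1)
  else if j == s.+1 then (if 0 < k then q s else q s.+1 * a s.+1 s - q s)
  else q j.

Definition transpose a i j := a j i.

(* The braid action on matrices that underlies knot contact homology. *)
Definition step a k i j : F :=
  let s := `|k|%N in
  let t p := if p == s then s.+1 else s in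
  if (i == s) || (i == s.+1) then
    if (j == s) || (j == s.+1) then a (t i) (t j)
    else row_step (transpose a) k (transpose a j) i
  else row_step a k (a i) j.

Definition run a w := foldl step a w.

(** Each letter acts through the matrix already transformed by the letters before it, so this is a
    product of one-letter matrices as in the chain rule for composed substitutions. *)
Fixpoint row_run a w q :=
  if w is k :: w' then row_run (step a k) w' (row_step a k q) else q.

Lemma row_run_cat a w1 w2 q :
  row_run a (w1 ++ w2) q = row_run (run a w1) w2 (row_run a w1 q).
Proof. by elim: w1 a q => //= k w1 IH a q; rewrite IH. Qed.

(** [step] breaks the symmetry of the two indices only where neither is moved, and there [row_step]
    is the identity. *)
Lemma step_transpose a k : step (transpose a) k = transpose (step a k).
Proof.
apply/funext => i; apply/funext => j; rewrite /transpose /step.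
case: ifP => hj; case: ifP => // hi.
rewrite /row_step; move: hi hj.
by do 2!move=> /negbT /norP[/negPf-> /negPf->].
Qed.

Lemma run_transpose a w : run (transpose a) w = transpose (run a w).
Proof. by elim: w a => //= k w IH a; rewrite step_transpose IH. Qed.

(** * The braid relations *)

Definition same_action w1 w2 := forall a,
  run a w1 = run a w2 /\ forall q, row_run a w1 q = row_run a w2 q.

Lemma same_action_inv k : (0 < `|k|)%N -> same_action [:: k; - k] [::].
Proof.
move=> k0 a; rewrite /run /=.
have pN : (0 < - k) = ~~ (0 < k) by lia.
split=> [|q]; apply/funext => i; [apply/funext => j|];
  rewrite /step /row_step /transpose !abszN pN; move: `|k|%N => s.
- by case: (0 < k) => /=; cases_at i s; [|cases_at i s.+1| |cases_at i s.+1];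
    (cases_at j s; [|cases_at j s.+1]); decide_eqs; ring.
- by case: (0 < k) => /=; cases_at i s; [|cases_at i s.+1| |cases_at i s.+1];
    decide_eqs; ring.
Qed.

Lemma same_action_braid s : (0 < s)%N ->
  same_action [:: s%:Z; s.+1%:Z; s%:Z] [:: s.+1%:Z; s%:Z; s.+1%:Z].
Proof.
move=> s0 a; rewrite /run /=; split=> [|q]; apply/funext => i; [apply/funext => j|];
  rewrite /step /row_step /transpose !absz_nat ltz_nat s0 /=.
- cases_at i s; [|cases_at i s.+1; [|cases_at i s.+2]];
  (cases_at j s; [|cases_at j s.+1; [|cases_at j s.+2]]); decide_eqs; ring.
- cases_at i s; [|cases_at i s.+1; [|cases_at i s.+2]]; decide_eqs; ring.
Qed.

Lemma same_action_far s t : (0 < s)%N -> (s.+1 < t)%N ->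
  same_action [:: s%:Z; t%:Z] [:: t%:Z; s%:Z].
Proof.
move=> s0 st a; rewrite /run /=; have t0 : (0 < t)%N by lia.
split=> [|q]; apply/funext => i; [apply/funext => j|];
  rewrite /step /row_step /transpose !absz_nat !ltz_nat s0 t0 /=.
- cases_at i s; [|cases_at i s.+1; [|cases_at i t; [|cases_at i t.+1]]];
  (cases_at j s; [|cases_at j s.+1; [|cases_at j t; [|cases_at j t.+1]]]);
  decide_eqs; ring.
- cases_at i s; [|cases_at i s.+1; [|cases_at i t; [|cases_at i t.+1]]];
  decide_eqs; ring.
Qed.

Lemma braid_eq_same_action n w1 w2 : braid_eq n w1 w2 -> same_action w1 w2.
Proof.
elim=> {w1 w2}.
- by [].
- by move=> w1 w2 _ IH a; case: (IH a) => -> h; split=> // q; rewrite h.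
- move=> w1 w2 w3 _ IH1 _ IH2 a.
  by case: (IH1 a) (IH2 a) => -> h1 [-> h2]; split=> // q; rewrite h1 h2.
- move=> u1 u2 v1 v2 _ IHu _ IHv a; rewrite /run !foldl_cat -!/(run _ _).
  case: (IHu a) => e h; rewrite e; case: (IHv (run a u2)) => e' h'.
  by split=> // q; rewrite !row_run_cat h e h'.
- by move=> k /andP[k0 _]; apply: same_action_inv.
- by move=> i j i0 ij _; apply: same_action_far.
- by move=> i i0 _; apply: same_action_braid.
Qed.

Lemma run_cat a w1 w2 : run a (w1 ++ w2) = run (run a w1) w2.
Proof. by rewrite /run foldl_cat. Qed.

(** * Triangular parts under the braid action *)

Lemma row_step_linear a k x y q1 q2 j :
  row_step a k (fun j => x * q1 j + y * q2 j) j =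
  x * row_step a k q1 j + y * row_step a k q2 j.
Proof.
by rewrite /row_step; case: ifP => _; [|case: ifP => _ //]; case: ifP => _; ring.
Qed.

Lemma row_run_linear a w x y q1 q2 j :
  row_run a w (fun j => x * q1 j + y * q2 j) j =
  x * row_run a w q1 j + y * row_run a w q2 j.
Proof.
elim: w a q1 q2 j => [//|k w IH] a q1 q2 j /=; rewrite -IH.
by congr (row_run _ _ _ j); apply/funext => i; rewrite row_step_linear.
Qed.

(** Row and column operations commute: they act on different indices, and each is linear with
    coefficients that do not depend on the vector. *)
Lemma row_run_row_step a b w k (f : nat -> nat -> F) i j :
  row_run a w (fun j => row_step b k (f^~ j) i) j =
  row_step b k (fun i => row_run a w (f i) j) i.
Proof.
rewrite /row_step; set s := `|k|%N.
have comb x y u v : row_run a w (fun j => f u j * x + y * f v j) j =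
    x * row_run a w (f u) j + y * row_run a w (f v) j.
  by rewrite -row_run_linear; congr (row_run _ _ _ j); apply/funext => l; ring.
case: ifP => _; [|case: ifP => _ //]; case: ifP => _ //.
- rewrite [RHS](_ : _ = b s s.+1 * row_run a w (f s) j
    + (-1) * row_run a w (f s.+1) j); last by ring.
  by rewrite -comb; congr (row_run _ _ _ j); apply/funext => l; ring.
- rewrite [RHS](_ : _ = b s.+1 s * row_run a w (f s.+1) j
    + (-1) * row_run a w (f s) j); last by ring.
  by rewrite -comb; congr (row_run _ _ _ j); apply/funext => l; ring.
Qed.

Definition lower a i j : F := if (j <= i)%N then a i j else 0.
Definition upper a i j : F := if (i <= j)%N then a i j else 0.
Definition unit_diag a := forall i, a i i = 1.

Lemma step_unit_diag a k : unit_diag a -> unit_diag (step a k).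
Proof.
move=> a1 i; rewrite /step.
case: ifP => [h|/negbT/norP[/negPf h1 /negPf h2]]; first by rewrite ?h.
by rewrite /row_step h1 h2.
Qed.

Lemma run_unit_diag a w : unit_diag a -> unit_diag (run a w).
Proof. by elim: w a => //= k w IH a a1; apply/IH/step_unit_diag. Qed.

(** Away from the 2 x 2 block at s, s + 1 both moved indices lie on the same side of the diagonal,
    so truncation commutes with the operations. Inside the block all terms but the swapped entry
    cancel because the diagonal entries are 1, and the block is again unit triangular. *)
Lemma lower_step a k i j : (0 < `|k|)%N -> unit_diag a ->
  row_step (transpose a) k (fun i => row_step a k (lower a i) j) i =
  lower (step a k) i j.
Proof.
move=> k0 a1; rewrite /lower /step /row_step /transpose; move: `|k|%N => s.
by case: (0 < k) => /=; cases_at i s; [|cases_at i s.+1| |cases_at i s.+1];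
  (cases_at j s; [|cases_at j s.+1]); decide_eqs; rewrite ?a1;
  repeat (match goal with |- context [(?x <= ?y)%N] =>
    first [have -> : (x <= y)%N = true by lia | have -> : (x <= y)%N = false by lia
      | case: (leqP x y) => ?] end; rewrite /=); ring.
Qed.

(** Transposition exchanges the two triangular parts and the two kinds of operations, which
    commute. *)
Lemma upper_step a k i j : (0 < `|k|)%N -> unit_diag a ->
  row_step (transpose a) k (fun i => row_step a k (upper a i) j) i =
  upper (step a k) i j.
Proof.
move=> k0 a1; rewrite -[LHS](row_run_row_step a (transpose a) [:: k] k (upper a)) /=.
have -> : upper (step a k) i j = lower (step (transpose a) k) j i.
  by rewrite step_transpose.
by rewrite -lower_step.
Qed.

(** Row operations of the whole word and column operations of the whole word can be regrouped letter
    by letter, since they commute; then [lower_step] applies to each letter. *)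
Lemma lower_run a w i j : all (fun k => 0 < `|k|)%N w -> unit_diag a ->
  row_run (transpose a) w (fun i => row_run a w (lower a i) j) i =
  lower (run a w) i j.
Proof.
elim: w a i j => [//|k w IH] a i j /= /andP[k0 w0] a1.
rewrite step_transpose -[RHS]IH //; last exact: step_unit_diag.
congr (row_run _ _ _ i); apply/funext => i'.
rewrite -(row_run_row_step (step a k) (transpose a) w k
  (fun i => row_step a k (lower a i))).
by congr (row_run _ _ _ j); apply/funext => j'; rewrite lower_step.
Qed.

Definition target mu a i j : F := upper a i j - mu * lower a i j.

Lemma target_step mu a k i j : (0 < `|k|)%N -> unit_diag a ->
  row_step (transpose a) k (fun i => row_step a k (target mu a i) j) i =
  target mu (step a k) i j.
Proof.
move=> k0 a1; rewrite /target -upper_step // -lower_step //.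
transitivity (1 * row_step (transpose a) k (fun i => row_step a k (upper a i) j) i
  + (- mu) * row_step (transpose a) k (fun i => row_step a k (lower a i) j) i);
  last by ring.
rewrite -row_step_linear; congr (row_step _ _ _ i); apply/funext => i'.
by rewrite -row_step_linear; congr (row_step _ _ _ j); apply/funext => j'; ring.
Qed.

(* The equations saying that a defines an augmentation, with the values mu
   and ell on the meridian and longitude, of the closure of w: on indices
   1, ..., n, the row operations of w turn Q into (P - mu Q) Lambda, and w sends
   a to Lambda^-1 a Lambda, where P and Q are the upper and the lower triangular
   part of a. *)
Definition is_augmentation mu ell n w a (lam : nat -> F) :=
  [/\ unit_diag a, (forall i, lam i != 0), \prod_(1 <= i < n.+1) lam i = ell,
    (forall i j, (0 < i <= n)%N -> (0 < j <= n)%N ->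
      lam i * run a w i j = a i j * lam j)
  & (forall i j, (0 < i <= n)%N -> (0 < j <= n)%N ->
      row_run a w (lower a i) j = target mu a i j * lam j)].

Definition augmented mu ell n w := exists a lam, is_augmentation mu ell n w a lam.

(** * Restriction to the indices 1, ..., n *)

Definition eq_upto n (q1 q2 : nat -> F) := forall j, (0 < j <= n)%N -> q1 j = q2 j.
Definition eq2_upto n (a b : nat -> nat -> F) :=
  forall i, (0 < i <= n)%N -> eq_upto n (a i) (b i).

Lemma row_step_eq_upto n a b k q1 q2 : (0 < `|k| < n)%N -> eq2_upto n a b ->
  eq_upto n q1 q2 -> eq_upto n (row_step a k q1) (row_step b k q2).
Proof.
move=> hk eab eq j hj; rewrite /row_step.
have hs : (0 < `|k| <= n)%N by lia.
have hs1 : (0 < `|k|.+1 <= n)%N by lia.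
by rewrite !(eq `|k|%N) // !(eq `|k|.+1%N) // (eq j) // !(eab `|k|%N) ?(eab `|k|.+1%N).
Qed.

Lemma eq2_upto_transpose n a b :
  eq2_upto n a b -> eq2_upto n (transpose a) (transpose b).
Proof. by move=> e i hi j hj; apply: e. Qed.

Lemma step_eq_upto n a b k : (0 < `|k| < n)%N -> eq2_upto n a b ->
  eq2_upto n (step a k) (step b k).
Proof.
move=> hk eab i hi j hj; rewrite /step.
case: ifP => ib; last by apply: row_step_eq_upto (eab i hi) _ hj.
case: ifP => jb; last first.
  have eT := eq2_upto_transpose eab.
  exact: row_step_eq_upto eT (eT j hj) _ hi.
by apply: eab; case: ifP => _; lia.
Qed.

Lemma run_eq_upto n w a b : braid_word n w -> eq2_upto n a b ->
  eq2_upto n (run a w) (run b w).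
Proof.
elim: w a b => [//|k w IH] a b /= /andP[hk hw] e.
exact/IH/step_eq_upto.
Qed.

Lemma row_run_eq_upto n w a b q1 q2 : braid_word n w -> eq2_upto n a b ->
  eq_upto n q1 q2 -> eq_upto n (row_run a w q1) (row_run b w q2).
Proof.
elim: w a b q1 q2 => [//|k w IH] a b q1 q2 /= /andP[hk hw] e eq.
by apply: IH => //; [exact: step_eq_upto|exact: row_step_eq_upto].
Qed.

Lemma braid_word_neq0 n w : braid_word n w -> all (fun k => 0 < `|k|)%N w.
Proof. by apply: sub_all => k /andP[]. Qed.

(** * Diagonal changes of basis, and invariance under conjugation *)

Definition gauge (lam : nat -> F) a i j := (lam i)^-1 * a i j * lam j.

Lemma crossN k : cross (- k) = cross k.
Proof. by apply/funext => p; rewrite /cross abszN. Qed.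

Lemma step_gauge lam a k : (forall i, lam i != 0) -> (0 < `|k|)%N ->
  step (gauge lam a) k = gauge (lam \o cross k) (step a k).
Proof.
move=> lam0 k0; apply/funext => i; apply/funext => j.
rewrite /gauge /step /row_step /transpose /cross /=; move: `|k|%N k0 => s s0.
by case: (0 < k) => /=; cases_at i s; [|cases_at i s.+1| |cases_at i s.+1];
  (cases_at j s; [|cases_at j s.+1]); decide_eqs; field; rewrite ?lam0.
Qed.

Lemma row_step_gauge lam a k q j : (forall i, lam i != 0) -> (0 < `|k|)%N ->
  row_step (gauge lam a) k (fun j => q j * lam j) j =
  row_step a k q j * lam (cross k j).
Proof.
move=> lam0 k0; rewrite /gauge /row_step /cross; move: `|k|%N k0 => s s0.
by case: (0 < k) => /=; cases_at j s; [|cases_at j s.+1| |cases_at j s.+1];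
  decide_eqs; field; rewrite ?lam0.
Qed.

Lemma prod_cross n k (lam : nat -> F) : (0 < `|k| < n)%N ->
  \prod_(1 <= i < n.+1) lam (cross k i) = \prod_(1 <= i < n.+1) lam i.
Proof.
move=> hk; rewrite -(big_map (cross k) predT lam); apply: perm_big.
have crossK : involutive (cross k).
  by move=> p; rewrite /cross; cases_at p `|k|%N; [|cases_at p `|k|.+1%N]; decide_eqs.
apply: uniq_perm; rewrite ?(map_inj_uniq (inv_inj crossK)) ?iota_uniq // => p.
rewrite -{1}[p]crossK (mem_map (inv_inj crossK)) !mem_index_iota /cross.
by case: ifP => [|_]; [|case: ifP]; lia.
Qed.

Lemma run_gauge n w a lam : (forall i, lam i != 0) ->
  (forall i j, (0 < i <= n)%N -> (0 < j <= n)%N ->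
      lam i * run a w i j = a i j * lam j) ->
  eq2_upto n (run a w) (gauge lam a).
Proof.
move=> lam0 h i hi j hj; apply: (mulfI (lam0 i)).
by rewrite h // /gauge !mulrA mulfV // mul1r.
Qed.

(** The new matrix b is the one from which the letter k leads to a. After k and w it has become
    Lambda^-1 a Lambda, and the last letter [- k] turns this into the diagonal conjugate of b by the
    permuted values of lam. *)
Lemma augmented_conj1 mu ell n w k : (0 < `|k| < n)%N ->
  augmented mu ell n w -> augmented mu ell n (k :: rcons w (- k)).
Proof.
move=> hk [a [lam [a1 lam0 prodlam cond2 cond1]]].
have k0 : (0 < `|k|)%N by lia.
have kN0 : (0 < `|- k|)%N by rewrite abszN.
have hkN : (0 < `|- k| < n)%N by rewrite abszN.
set b := step a (- k).
have bk : step b k = a.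
  by case: (same_action_inv kN0 a) => + _; rewrite /run /= opprK.
have bT : transpose a = step (transpose b) k by rewrite step_transpose bk.
have awE := run_gauge lam0 cond2.
have b1 : unit_diag b by apply: step_unit_diag.
exists b, (lam \o cross k); split => //.
- by move=> i; apply: lam0.
- by rewrite prod_cross.
- move=> i j hi hj; rewrite -cats1 /run /= bk foldl_cat /= -/(run a w).
  have -> : step (run a w) (- k) i j = gauge (lam \o cross k) b i j.
    rewrite -[in RHS](crossN k) -(step_gauge _ lam0) //.
    exact: (step_eq_upto hkN awE).
  by rewrite /gauge /= !mulrA mulfV ?mul1r.
- move=> i j hi hj; rewrite -cats1 /= row_run_cat /= bk.
  pose Y i j := row_step (transpose a) (- k) (fun i' => target mu a i' j) i.
  (* By [lower_step] the row operation k turns the triangular part of b into that of a, up to the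
     inverse column operation. The latter commutes with the row operations of w, so that the
     equations for a can be used under it. *)
  have rowE : eq_upto n (row_run a w (row_step b k (lower b i)))
                        (fun j => Y i j * lam j).
    move=> l hl.
    have -> : row_step b k (lower b i) =
        (fun l => row_step (transpose a) (- k) (fun i' => lower a i' l) i).
      apply/funext => m.
      have -> : (fun i' => lower a i' m) =
          row_step (transpose b) k (fun i' => row_step b k (lower b i') m).
        by apply/funext => i'; rewrite lower_step ?bk.
      rewrite {1}bT; case: (same_action_inv k0 (transpose b)) => _ /(_ _)/= -> //.
    rewrite row_run_row_step.
    (* The summand [0 * 0] gives the two-term shape of [row_step_linear]. *)
    rewrite (row_step_eq_upto hkN (q2 := fun i' => lam l * target mu a i' l + 0 * 0)
      (_ : eq2_upto n (transpose a) (transpose a))) //.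
      by rewrite (row_step_linear _ _ _ _ (fun i' => target mu a i' l) (fun=> 0))
        mul0r addr0 mulrC.
    by move=> i' hi'; rewrite cond1 // mul0r addr0 mulrC.
  rewrite (row_step_eq_upto hkN awE rowE hj) row_step_gauge // crossN; congr (_ * _).
  rewrite -(target_step _ _ _ kN0 a1) /Y.
  exact: (row_run_row_step a (transpose a) [:: - k] (- k) (target mu a)).
Qed.

Lemma augmented_conj mu ell n w g : braid_word n g ->
  augmented mu ell n w -> augmented mu ell n (g ++ w ++ inv_word g).
Proof.
elim: g => [|k g IH] /=; first by rewrite cats0.
case/andP=> hk hg /(IH hg)/(augmented_conj1 hk).
by rewrite /inv_word /= rev_cons !rcons_cat.
Qed.

Lemma inv_word_cons k g : inv_word (k :: g) = inv_word g ++ [:: - k].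
Proof. by rewrite /inv_word /= rev_cons cats1. Qed.

Lemma inv_wordV n g : braid_word n g -> braid_eq n (inv_word g ++ g) [::].
Proof.
elim: g => [_|k g IH /= /andP[hk hg]]; first exact: braid_eq_refl.
rewrite inv_word_cons -catA; apply: braid_eq_trans (IH hg).
apply: braid_eq_cat; first exact: braid_eq_refl.
apply: (@braid_eq_cat _ [:: - k; k] [::] g g); last exact: braid_eq_refl.
by rewrite -{2}[k]opprK; apply: braid_eq_inv; rewrite abszN.
Qed.

Lemma inv_wordK g : inv_word (inv_word g) = g.
Proof.
by rewrite /inv_word map_rev revK -map_comp map_id_in // => k _ /=; rewrite opprK.
Qed.

Lemma braid_word_inv n g : braid_word n g -> braid_word n (inv_word g).
Proof.
move=> hg; rewrite /braid_word /inv_word all_rev all_map.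
by apply: sub_all hg => k /=; rewrite abszN.
Qed.

Lemma augmented_braid_eq mu ell n w1 w2 :
  braid_eq n w1 w2 -> augmented mu ell n w1 -> augmented mu ell n w2.
Proof.
move/braid_eq_same_action => e [a [lam [a1 l0 pl c2 c1]]].
exists a, lam; have [er eq] := e a.
by split=> // i j hi hj; [rewrite -er c2|rewrite -eq c1].
Qed.

(** For the converse, conjugate by the inverse of g and cancel in the braid group. *)
Lemma augmented_conj_iff mu ell n w g : braid_word n g ->
  augmented mu ell n w <-> augmented mu ell n (g ++ w ++ inv_word g).
Proof.
move=> hg; split; first exact: augmented_conj.
move/(augmented_conj (braid_word_inv hg)); rewrite inv_wordK.
apply: augmented_braid_eq; rewrite -!catA.
have e := inv_wordV hg; rewrite catA.
apply: braid_eq_trans (_ : braid_eq n ([::] ++ w ++ [::]) w); last first.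
  by rewrite cats0; apply: braid_eq_refl.
by do 2?[apply: braid_eq_cat; rewrite // ?inv_wordV //]; apply: braid_eq_refl.
Qed.

(** * Invariance under positive stabilization *)

(* A strand of index m > n is not acted on by the braids on n strands, so its
   row (and its column) is acted on linearly. *)
Lemma run_passive_row n w a m j : braid_word n w -> (n < m)%N -> (0 < j <= n)%N ->
  run a w m j = row_run a w (a m) j.
Proof.
elim: w a => [//|k w IH] a /= /andP[hk hw] nm hj.
rewrite /run /= -/(run _ _) IH //.
apply: (row_run_eq_upto hw (n := n)) => // l hl; rewrite /step.
by have -> : (m == `|k|%N) || (m == `|k|.+1%N) = false by lia.
Qed.

Lemma run_passive_col n w a m i : braid_word n w -> (n < m)%N -> (0 < i <= n)%N ->
  run a w i m = row_run (transpose a) w (a^~ m) i.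
Proof.
move=> hw nm hi; rewrite -[LHS]/(transpose (run a w) m i) -run_transpose.
exact: run_passive_row hw nm hi.
Qed.

Lemma row_run_passive n w a q m : braid_word n w -> (n < m)%N ->
  row_run a w q m = q m.
Proof.
elim: w a q => [//|k w IH] a q /= /andP[hk hw] nm.
rewrite IH // /row_step.
have -> : (m == `|k|%N) = false by lia.
by have -> : (m == `|k|.+1%N) = false by lia.
Qed.

Lemma row_step_pos a (s : nat) q j : (0 < s)%N -> row_step a s%:Z q j =
  if j == s then q s * a s s.+1 - q s.+1 else if j == s.+1 then q s else q j.
Proof. by move=> s0; rewrite /row_step absz_nat ltz_nat s0. Qed.

(** The matrix is restricted to the first n indices, and the value of lam at the removed strand is
    absorbed into the value at n. *)
Lemma augmented_destab mu ell n w : (0 < n)%N -> braid_word n w ->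
  augmented mu ell n.+1 (rcons w n%:Z) -> augmented mu ell n w.
Proof.
move=> n0 hw [a [lam [a1 lam0 prodlam cond2 cond1]]].
have nn : (0 < n <= n.+1)%N by lia.
have mm : (0 < n.+1 <= n.+1)%N by lia.
have up i : (0 < i <= n)%N -> (0 < i <= n.+1)%N by lia.
have np : (0 < n <= n)%N by lia.
set m := n.+1 in mm *.
set st := run a w; set al := st n m.
have run1 i j : run a (rcons w n%:Z) i j = step st n%:Z i j.
  by rewrite -cats1 run_cat.
have row1 q j : row_run a (rcons w n%:Z) q j = 
   if j == n then row_run a w q n * al - q m
   else if j == m then row_run a w q n else row_run a w q j.
  rewrite -cats1 row_run_cat /= row_step_pos // -/st.
  by rewrite (row_run_passive a q hw (ltnSn n)).
have mn : (m == n) = false by rewrite /m; lia.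
have nm : (n == m) = false by rewrite /m; lia.
pose rho j := row_run a w (lower a m) j.
have stm j : (0 < j <= n)%N -> st m j = rho j.
  move=> hj; rewrite /st (run_passive_row a hw (ltnSn n) hj).
  apply: (row_run_eq_upto hw (n := n)) => // l hl; rewrite /lower.
  by have -> : (l <= m)%N by lia.
have rho_n : rho n = (1 - mu) * lam m.
  have := cond1 m m mm mm; rewrite row1 mn eqxx -/(rho n) => ->.
  by rewrite /target /lower /upper leqnn a1; ring.
have al_eq : lam m * al = a m n * lam n.
  have := cond2 m n mm nn; rewrite run1 /step absz_nat.
  by rewrite mn !eqxx.
(* With x = lam m * al, [al_eq] turns the row equation at (m, n) into (1 - mu) x - 1 = - mu x, in
   which mu cancels. *)
have al1 : lam m * al = 1.
  have := cond1 m n mm nn; rewrite row1 eqxx -/(rho n) rho_n /target /lower /upper.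
  have -> : (m <= n)%N = false by rewrite /m; lia.
  have -> : (n <= m)%N by rewrite /m; lia.
  rewrite leqnn a1 sub0r => e.
  have {e} : (1 - mu) * (lam m * al) - 1 = - mu * (lam m * al).
    rewrite -[RHS](_ : - (mu * a m n) * lam n = _); first by rewrite -e; ring.
    by rewrite al_eq; ring.
  by move/eqP; rewrite -subr_eq0 => /eqP e; apply/eqP; rewrite -subr_eq0 -e;
    apply/eqP; ring.
(* The row equation at n carries the factor al, the inverse of lam m. This is the origin of the new
   value lam n * lam m. *)
have row_n i : (0 < i <= n)%N ->
    row_run a w (lower a i) n = target mu a i n * lam n * lam m.
  move=> hi; have := cond1 i n (up _ hi) nn; rewrite row1 eqxx {2}/lower.
  have -> : (m <= i)%N = false by rewrite /m; lia.
  by rewrite subr0 => <-; rewrite -mulrA [al * _]mulrC al1 mulr1.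
have col_m i : (0 < i < n)%N -> a i m = a i n * lam n.
  move=> hi; have hi' : (0 < i <= n)%N by lia.
  apply: (mulIf (lam0 m)).
  have := cond1 i m (up _ hi') mm; rewrite row1 mn eqxx row_n // /target /lower /upper.
  have -> : (i <= n)%N by lia.
  have -> : (i <= m)%N by lia.
  have -> : (n <= i)%N = false by lia.
  have -> : (m <= i)%N = false by lia.
  by rewrite mulr0 !subr0 => ->.
exists a, (fun i => if i == n then lam n * lam m else lam i); split=> //.
- by move=> i; case: ifP; rewrite ?mulf_neq0.
- rewrite -prodlam big_nat_recr //= eqxx [in RHS]big_nat_recr //.
  rewrite [in RHS]big_nat_recr //= -mulrA.
  by congr (_ * _); apply: eq_big_nat => i hi; case: ifP => //; lia.
- move=> i j hi hj; have [ein|ni] := eqVneq i n; have [ejn|nj] := eqVneq j n.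
  + by rewrite ein ejn run_unit_diag // a1; ring.
  (* The last letter produces the entry (1 - mu) lam m * st n j - rho j. The equations at (m, j)
     give rho j = - mu * a m j * lam j = - mu * lam m * st n j, so mu cancels again. *)
  + rewrite ein -/st; have jm : (j == m) = false by lia.
    have := cond2 m j mm (up _ hj); have := cond2 n j nn (up _ hj).
    rewrite !run1 /step absz_nat mn !eqxx nm (negPf nj) jm /= -/m.
    rewrite !row_step_pos // !eqxx mn /transpose stm // stm // rho_n /=.
    have := cond1 m j mm (up _ hj); rewrite row1 (negPf nj) jm -/(rho j) => ->.
    rewrite /target /lower /upper; have -> : (m <= j)%N = false by lia.
    have -> : (j <= m)%N by lia.
    rewrite sub0r => <- e; apply/eqP; rewrite -subr_eq0.
    rewrite -[X in _ == X](mulr0 (lam n * mu)).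
    have -> : 0 = lam m * st n j - a m j * lam j by rewrite e subrr.
    by apply/eqP; ring.
  + rewrite ejn -/st; have im : (i == m) = false by lia.
    have := cond2 i m (up _ hi) mm; rewrite run1 /step absz_nat (negPf ni) im /=.
    by rewrite row_step_pos // mn eqxx => ->; rewrite col_m ?mulrA //; lia.
  + have im : (i == m) = false by lia.
    have jm : (j == m) = false by lia.
    have := cond2 i j (up _ hi) (up _ hj); rewrite run1 /step absz_nat (negPf ni) im /=.
    by rewrite row_step_pos // (negPf nj) jm.
- move=> i j hi hj; have [->|nj] := eqVneq j n; first by rewrite row_n // mulrA.
  have jm : (j == m) = false by lia.
  by have := cond1 i j (up _ hi) (up _ hj); rewrite row1 (negPf nj) jm.
Qed.

Lemma augmented_stab mu ell n w : (0 < n)%N -> braid_word n w ->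
  augmented mu ell n w -> augmented mu ell n.+1 (rcons w n%:Z).
Proof.
move=> n0 hw [a [lam [a1 lam0 prodlam cond2 cond1]]].
set m := n.+1.
have mn : (m == n) = false by rewrite /m; lia.
have nm : (n == m) = false by rewrite /m; lia.
have np : (0 < n <= n)%N by lia.
(* Once the new value of lam is set to 1, the equations of the stabilized braid force these entries:
   the matrix equation at (m, j) gives the new row, the row equation at (i, m) the new column. *)
pose b i j := if i == m then if j == m then 1 else (lam n)^-1 * a n j
  else if j == m then target mu a i n * lam n else a i j.
pose lam' i := if i == m then 1 else lam i.
have ab : eq2_upto n a b.
  move=> i hi j hj; rewrite /b.
  by have [-> ->] : (i == m) = false /\ (j == m) = false by lia.
set st := run b w.
have st_ab i j : (0 < i <= n)%N -> (0 < j <= n)%N -> st i j = run a w i j.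
  by move=> hi hj; rewrite /st (run_eq_upto hw ab).
have b1 : unit_diag b by move=> i; rewrite /b; case: (i == m).
have rho j : (0 < j <= n)%N -> st m j = (lam n)^-1 * (target mu a n j * lam j).
  move=> hj; rewrite /st (run_passive_row b hw (ltnSn n) hj) -cond1 //.
  rewrite -[RHS]addr0 -[X in _ + X](mul0r (row_run a w (fun=> 0) j)) -row_run_linear.
  apply: (row_run_eq_upto hw (n := n)) => // [i hi l hl|l hl]; first by rewrite ab.
  have lm : (l == m) = false by lia.
  by rewrite /b eqxx lm /lower mulr0 addr0; have -> : (l <= n)%N by lia.
(* By the row equations for a, the new column consists of the entries at n of the transformed rows
   of Q. The column operations of w complete the double action of [lower_run], so the result is
   column n of a unit lower triangular matrix. *)
have sigma i : (0 < i <= n)%N -> st i m = if i == n then 1 else 0.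
  move=> hi; rewrite /st (run_passive_col b hw (ltnSn n) hi).
  transitivity (row_run (transpose a) w (fun i => row_run a w (lower a i) n) i).
    apply: (row_run_eq_upto hw (n := n)) => // [l hl j hj|l hl].
      by rewrite /transpose ab.
    by rewrite cond1 // /b eqxx; have -> : (l == m) = false by lia.
  rewrite lower_run ?(braid_word_neq0 hw) // /lower.
  case: eqP => [->|ne]; first by rewrite leqnn run_unit_diag.
  by have -> : (n <= i)%N = false by lia.
have run1 i j : run b (rcons w n%:Z) i j = step st n%:Z i j.
  by rewrite -cats1 run_cat.
have row1 q j : row_run b (rcons w n%:Z) q j =
   if j == n then row_run b w q n - q m
   else if j == m then row_run b w q n else row_run b w q j.
  rewrite -cats1 row_run_cat /= row_step_pos // -/st sigma // eqxx mulr1.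
  by rewrite (row_run_passive b q hw (ltnSn n)).
have rowE i j : (0 < i <= n)%N -> (0 < j <= n)%N ->
    row_run b w (lower b i) j = target mu a i j * lam j.
  move=> hi hj; rewrite -cond1 //.
  apply: (row_run_eq_upto hw (n := n)) => // [l hl l' hl'|l hl]; first by rewrite ab.
  by rewrite /lower ab.
have targetE i j : (0 < i <= n)%N -> (0 < j <= n)%N ->
    target mu b i j = target mu a i j.
  by move=> hi hj; rewrite /target /lower /upper !ab.
have rowm j : (0 < j <= n)%N ->
    row_run b w (lower b m) j = (lam n)^-1 * (target mu a n j * lam j).
  move=> hj; rewrite -rho // /st (run_passive_row b hw (ltnSn n) hj).
  apply: (row_run_eq_upto hw (n := n)) => // l hl; rewrite /lower.
  by have -> : (l <= m)%N by lia.
have inP i : (0 < i <= m)%N -> i = m \/ (i == m) = false /\ (0 < i <= n)%N by lia.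
have target_nn : target mu a n n = 1 - mu.
  by rewrite /target /lower /upper leqnn a1 mulr1.
have a1n := a1 n.
exists b, lam'; split=> //.
- by move=> i; rewrite /lam'; case: ifP; rewrite ?oner_neq0.
- rewrite big_nat_recr //= {2}/lam' eqxx mulr1 -prodlam; apply: eq_big_nat => i hi.
  by rewrite /lam'; have -> : (i == m) = false by lia.
- have unl : (lam n)^-1 * lam n = 1 by rewrite mulVf.
  have unr : lam n * (lam n)^-1 = 1 by rewrite mulfV.
  have stnn p : st p p = 1 by apply: run_unit_diag.
  have c2 i j hi hj :=
    etrans (congr1 (fun x => lam i * x) (st_ab i j hi hj)) (cond2 i j hi hj).
  have target_n j : (0 < j < n)%N -> target mu a n j = - (mu * a n j).
    move=> hj; rewrite /target /lower /upper; have -> : (n <= j)%N = false by lia.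
    have -> : (j <= n)%N by lia.
    by rewrite sub0r.
  move=> i j /inP hi /inP hj; rewrite run1 /step absz_nat -/m.
  case: hi => [->|[im hi]]; case: hj => [->|[jm hj]]; rewrite /lam' /b.
  + by rewrite !eqxx !orbT mn stnn.
  + rewrite eqxx orbT mn jm orbF.
    case: (eqVneq j n) => [->|jn]; first by rewrite /= sigma // eqxx a1 !mulr1 unl.
    by rewrite row_step_pos // mn eqxx /transpose mul1r -mulrA -c2 // mulrA unl mul1r.
  + rewrite eqxx im orbT orbF.
    case: (eqVneq i n) => [->|ni].
      by rewrite /= mn rho // target_nn mulr1 mulrA unr mul1r.
    rewrite row_step_pos // mn eqxx c2 // mulr1; congr (_ * _).
    rewrite /target /upper /lower; have -> : (n <= i)%N = false by lia.
    have -> : (i <= n)%N by lia.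
    by rewrite mulr0 subr0.
  + rewrite im jm !orbF; case: (eqVneq i n) => [->|ni]; case: (eqVneq j n) => [->|nj].
    * by rewrite !stnn a1 mulr1 mul1r.
    * rewrite row_step_pos // eqxx /transpose !rho // target_nn target_n; last by lia.
      rewrite -c2 //; have := c2 n j np hj => e.
      transitivity (lam n * (lam n)^-1 *
        ((1 - mu) * lam n * st n j + mu * (a n j * lam j))); first by ring.
      by rewrite unr -e; ring.
    * by rewrite row_step_pos // eqxx !sigma // eqxx (negPf ni) mulr1 subr0 c2.
    * by rewrite row_step_pos // (negPf nj) jm c2.
- move=> i j /inP hi /inP hj; rewrite row1 /lam'.
  case: hj => [->|[jm hj]]; rewrite ?eqxx ?mn ?jm.
  + case: hi => [->|[im hi]].
      by rewrite rowm // target_nn mulrCA mulVf // /target /lower /upper leqnn b1; ring.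
    rewrite rowE // /target /lower /upper /b eqxx im.
    have -> : (i <= m)%N by lia.
    have -> : (m <= i)%N = false by lia.
    by rewrite mulr0 subr0 mulr1.
  + case: (eqVneq j n) => [->|nj]; case: hi => [->|[im hi]].
    * rewrite rowm // target_nn mulrCA mulVf // /target /lower /upper leqnn b1.
      have -> : (m <= n)%N = false by lia.
      have -> : (n <= m)%N by lia.
      by rewrite /b eqxx nm a1; field; rewrite lam0.
    * rewrite rowE // /lower; have -> : (m <= i)%N = false by lia.
      by rewrite subr0 targetE.
    * rewrite rowm // /target /lower /upper.
      have -> : (m <= j)%N = false by lia.
      have -> : (j <= m)%N by lia.
      have -> : (n <= j)%N = false by lia.
      have -> : (j <= n)%N by lia.
      by rewrite /b eqxx jm; ring.
    * by rewrite rowE // targetE.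
Qed.

Lemma augmented_move mu ell B B' : transverse_move B B' ->
  augmented mu ell (strands B) (word B) <-> augmented mu ell (strands B') (word B').
Proof.
have /and3P[n0 hw _] := knot_braidP B.
case=> [-> e|g -> hg ->|-> ->].
- by split; apply: augmented_braid_eq => //; apply: braid_eq_sym.
- exact: augmented_conj_iff.
- by split; [apply: augmented_stab|apply: augmented_destab].
Qed.

Lemma augmented_isotopic mu ell B B' : transversely_isotopic B B' ->
  augmented mu ell (strands B) (word B) <-> augmented mu ell (strands B') (word B').
Proof.
elim=> [C C' /augmented_move|C|C C' _ [IH1 IH2]|C C' C'' _ [IH1 IH1'] _ [IH2 IH2']].
- exact.
- by [].
- by split.
- by split=> [/IH1/IH2|/IH2'/IH1'].
Qed.

(** * Normalization of the diagonal matrix *)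

Definition start_pos w (p : nat) : nat := foldr cross p w.

Lemma crossK k : (0 < `|k|)%N -> involutive (cross k).
Proof.
move=> k0 p; rewrite /cross; cases_at p `|k|%N; [|cases_at p `|k|.+1%N];
  by decide_eqs.
Qed.

Lemma end_posK w : all (fun k => 0 < `|k|)%N w -> cancel (end_pos w) (start_pos w).
Proof.
elim: w => [//|k w IH] /= /andP[k0 hw] p.
by rewrite /end_pos /= -/(end_pos _ _) IH // crossK.
Qed.

Lemma run_gauge_comp (d : nat -> F) a w : (forall i, d i != 0) ->
  all (fun k => 0 < `|k|)%N w ->
  run (gauge d a) w = gauge (d \o start_pos w) (run a w).
Proof.
elim: w d a => [//|k w IH] d a d0 /= /andP[k0 hw].
by rewrite /run /= step_gauge // -/(run _ w) IH // => i; apply: d0.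
Qed.

Lemma row_run_gauge (d : nat -> F) a w q j : (forall i, d i != 0) ->
  all (fun k => 0 < `|k|)%N w ->
  row_run (gauge d a) w (fun j => q j * d j) j = row_run a w q j * d (start_pos w j).
Proof.
elim: w d a q j => [//|k w IH] d a q j d0 /= /andP[k0 hw].
rewrite step_gauge //.
rewrite (_ : row_step _ _ _ = fun j => row_step a k q j * (d \o cross k) j).
  by rewrite IH // => i; apply: d0.
by apply/funext => i; rewrite row_step_gauge.
Qed.

Lemma prod_start_pos n w (lam : nat -> F) : braid_word n w ->
  \prod_(1 <= i < n.+1) lam (start_pos w i) = \prod_(1 <= i < n.+1) lam i.
Proof.
elim: w lam => [//|k w IH] lam /= /andP[hk hw].
by rewrite -(prod_cross lam hk) -(IH (lam \o cross k)).
Qed.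

Lemma prod_neq0 (s : seq nat) (lam : nat -> F) : (forall i, lam i != 0) ->
  \prod_(i <- s) lam i != 0.
Proof.
by move=> h; elim/big_ind: _ => // [|x y]; [apply: oner_neq0|apply: mulf_neq0].
Qed.

(** Lambda is multiplied by the ratio of d permuted along the strands and d itself. Over all indices
    these ratios multiply to 1, so ell is kept. *)
Lemma is_augmentation_gauge mu ell n w a lam (d : nat -> F) : braid_word n w ->
  (forall i, d i != 0) -> is_augmentation mu ell n w a lam ->
  is_augmentation mu ell n w (gauge d a) (fun i => lam i * d (start_pos w i) / d i).
Proof.
move=> hw d0 [a1 lam0 prodlam cond2 cond1].
have hw0 := braid_word_neq0 hw.
have targetE i j : target mu (gauge d a) i j = (d i)^-1 * target mu a i j * d j.
  by rewrite /target /upper /lower /gauge; case: ifP; case: ifP => _ _; ring.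
split.
- by move=> i; rewrite /gauge a1 mulr1 mulVf.
- by move=> i; rewrite !mulf_neq0 ?invr_eq0.
- rewrite !big_split /= prod_start_pos // prodfV prodlam mulfK //.
  exact: prod_neq0.
- move=> i j hi hj; rewrite run_gauge_comp // /gauge /=.
  have -> : run a w i j = a i j * lam j / lam i.
    by rewrite -cond2 // mulrAC mulfV ?mul1r.
  by field; rewrite !d0 lam0.
- move=> i j hi hj; rewrite targetE.
  rewrite (_ : lower _ i = fun j => ((d i)^-1 * lower a i j + 0 * 0) * d j).
    rewrite row_run_gauge // (row_run_linear _ _ _ _ _ (fun=> 0)) mul0r addr0 cond1 //.
    by field; rewrite !d0.
  by apply/funext => l; rewrite /lower /gauge; case: ifP => _; ring.
Qed.

(** Since the permutation of the strands is one n-cycle, d can be chosen successively along it so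
    that lam becomes 1 at every position but the first; the product then leaves ell there. *)
Lemma augmented_normalized mu ell n w : (0 < n)%N -> braid_word n w ->
  closes_to_knot n w -> augmented mu ell n w ->
  exists a, is_augmentation mu ell n w a (fun i => if i == 1%N then ell else 1).
Proof.
move=> n0 hw hk [a [lam aug]]; have [a1 lam0 prodlam _ _] := aug.
set orb := traject (end_pos w) 1%N n in hk.
have size_orb : size orb = n by rewrite size_traject.
have sub : {subset iota 1 n <= orb} by apply/allP.
have [_ orb_iota] : (size orb = size (iota 1 n)) * (orb =i iota 1 n).
  have [] := uniq_min_size (iota_uniq 1 n) sub; first by rewrite size_orb size_iota.
  by move=> -> e; split=> // x; rewrite e.
have orb_uniq : uniq orb.
  by rewrite (eq_uniq _ orb_iota) ?iota_uniq // size_orb size_iota.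
(* The orbit starts with 1 at place 0. The product begins at place 1, so d is 1 at the strand 1 and
   acquires the factor lam i on arrival at each further strand i. *)
pose d p := \prod_(1 <= s < (index p orb).+1) lam (nth 1%N orb s).
have d0 i : d i != 0 by apply: prod_neq0 => s.
have := is_augmentation_gauge hw d0 aug.
set lam' := fun i => _ => aug'; have [_ _ prodlam' _ _] := aug'.
have lam'1 i : (1 < i <= n)%N -> lam' i = 1.
  move=> hi; have iorb : i \in orb by rewrite orb_iota mem_iota; lia.
  have hu : (index i orb < n)%N by rewrite -size_orb index_mem.
  have := nth_index 1%N iorb; case eu: (index i orb) hu => [|u] hu.
    by rewrite /orb nth_traject // /=; lia.
  rewrite /orb nth_traject // iterS; set j := iter u _ _ => ij.
  have ju : j = nth 1%N orb u by rewrite /orb nth_traject // ltnW.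
  rewrite /lam' -ij (end_posK (braid_word_neq0 hw)) ij /d eu ju.
  rewrite index_uniq // ?size_orb 1?ltnW //.
  have iE : nth 1%N orb u.+1 = i by rewrite -eu nth_index.
  rewrite [in X in _ / X]big_nat_recr //= iE.
  have dj : \prod_(1 <= s < u.+1) lam (nth 1%N orb s) != 0 by apply: prod_neq0 => s.
  by field; rewrite dj lam0.
have lam'1E : lam' 1%N = ell.
  rewrite -prodlam' big_nat_recl //= big_nat_cond big1 ?mulr1 // => i.
  by rewrite andbT => hi; rewrite lam'1 //; lia.
exists (gauge d a); case: aug' => b1 l0 _ c2 c1.
have lamE i : (0 < i <= n)%N -> (if i == 1%N then ell else 1) = lam' i.
  by move=> hi; case: eqP => [->//|ne]; rewrite lam'1 //; lia.
have ell0 : ell != 0 by rewrite -lam'1E.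
split=> //.
- by move=> i; case: ifP; rewrite ?oner_neq0.
- by rewrite -[RHS]prodlam'; apply: eq_big_nat => i hi; exact: lamE.
- by move=> i j hi hj; move: (c2 i j hi hj); rewrite -!lamE.
- by move=> i j hi hj; rewrite c1 // -lamE.
Qed.

(** Applying the column operations to the row equations and using [lower_run] gives equations in the
    opposite direction. With partially known entries these can show a contradiction that the row
    equations do not show yet. *)
Lemma is_augmentation_col mu ell n w a lam i j : braid_word n w ->
  is_augmentation mu ell n w a lam -> (0 < i <= n)%N -> (0 < j <= n)%N ->
  lam i * row_run (transpose a) w (fun i => target mu a i j) i = lower a i j.
Proof.
move=> hw [a1 lam0 _ cond2 cond1] hi hj; apply: (mulIf (lam0 j)).
have -> : lower a i j * lam j = lam i * lower (run a w) i j.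
  by rewrite /lower; case: ifP => _; rewrite ?cond2 // mul0r mulr0.
rewrite -lower_run ?(braid_word_neq0 hw) // -mulrA; congr (_ * _).
rewrite mulrC -[LHS]addr0 -[X in _ + X](mul0r (row_run (transpose a) w (fun=> 0) i)).
rewrite -row_run_linear; apply: (row_run_eq_upto hw (n := n)) => // l hl.
by rewrite cond1 // mulr0 addr0 mulrC.
Qed.

End Augmentations.

(** Conjugation by the suffix v turns the word u v into v u. *)
Lemma augmented_rot (F : fieldType) (mu ell : F) n w k : braid_word n w ->
  augmented mu ell n w -> augmented mu ell n (rot k w).
Proof.
rewrite -{1 2}(cat_take_drop k w) /rot; set u := take k w; set v := drop k w.
rewrite /braid_word all_cat => /andP[_ hv] /(augmented_conj hv).
apply: augmented_braid_eq; rewrite -!catA.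
apply: braid_eq_cat; first exact: braid_eq_refl.
rewrite -[X in braid_eq _ _ X]cats0; apply: braid_eq_cat; first exact: braid_eq_refl.
by have := inv_wordV (braid_word_inv hv); rewrite inv_wordK.
Qed.

(** * Deciding the existence of augmentations over F_p *)

(* Partially known elements of F_p: None stands for an unknown element. *)
Section Search.
Variables (p : nat) (mu ell : nat) (n : nat).
Implicit Types (u v : option nat) (A : seq (seq (option nat))) (w : seq int).

(** A known zero absorbs an unknown factor; this lets the zeros of the triangular part decide
    equations while other entries are still open. *)
Definition vmul u v :=
  match u, v with
  | Some 0, _ | _, Some 0 => Some 0%N
  | Some x, Some y => Some (x * y %% p)%N
  | _, _ => None
  end.

(** Adding p - y %% p keeps the truncated subtraction of [nat] from losing information. *)
Definition vsub u v :=
  match u, v with Some x, Some y => Some ((x + (p - y %% p)) %% p)%N | _, _ => None end.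

Definition entry A i j := nth None (nth [::] A i) j.

Definition vrow_step A (k : int) (q : seq (option nat)) :=
  let s := `|k|%N in let pos := 0 < k in
  mkseq (fun j =>
    if j == s then
      if pos then vsub (vmul (nth None q s) (entry A s s.+1)) (nth None q s.+1)
      else nth None q s.+1
    else if j == s.+1 then
      if pos then nth None q s
      else vsub (vmul (nth None q s.+1) (entry A s.+1 s)) (nth None q s)
    else nth None q j) n.+1.

Definition vtranspose A := mkseq (fun i => mkseq (entry A ^~ i) n.+1) n.+1.

(** All rows and columns are transformed before the entries are read off, so each vector is computed
    once and not once per entry. The first index of [cols] is the column. *)
Definition vstep A k :=
  let s := `|k|%N in
  let t i := if i == s then s.+1 else s in
  let T := vtranspose A in
  let rows := [seq vrow_step A k q | q <- A] in
  let cols := [seq vrow_step T k q | q <- T] in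
  mkseq (fun i => mkseq (fun j =>
    if (i == s) || (i == s.+1) then
      if (j == s) || (j == s.+1) then entry A (t i) (t j) else entry cols j i
    else entry rows i j) n.+1) n.+1.

Fixpoint vrow_run A w q :=
  if w is k :: w' then vrow_run (vstep A k) w' (vrow_step A k q) else q.

Fixpoint vrun A w := if w is k :: w' then vrun (vstep A k) w' else A.

Definition vlower A i j := if (j <= i)%N then entry A i j else Some 0%N.
Definition vupper A i j := if (i <= j)%N then entry A i j else Some 0%N.
Definition vtarget A i j := vsub (vupper A i j) (vmul (Some mu) (vlower A i j)).
Definition vlam i := Some (if i == 1%N then ell else 1%N).

Definition differ u v :=
  match u, v with Some x, Some y => (x %% p != y %% p)%N | _, _ => false end.

Definition agree u v :=
  match u, v with Some x, Some y => (x %% p == y %% p)%N | _, _ => false end.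

Definition indices := iota 1 n.

Definition refuted w A :=
  let R := vrun A w in
  let T := vtranspose A in
  has (fun i =>
    let row := vrow_run A w (mkseq (vlower A i) n.+1) in
    (* Here i is a column index: below, [col] is compared according to [is_augmentation_col] at (j,
       i). *)
    let col := vrow_run T w (mkseq (vtarget A ^~ i) n.+1) in
    has (fun j =>
      [|| differ (nth None row j) (vmul (vtarget A i j) (vlam j)),
          differ (vmul (vlam j) (nth None col j)) (vlower A j i)
        | differ (vmul (vlam i) (entry R i j)) (vmul (entry A i j) (vlam j))])
    indices) indices.

Definition verified w A :=
  let R := vrun A w in
  all (fun i =>
    let row := vrow_run A w (mkseq (vlower A i) n.+1) in
    all (fun j =>
      agree (nth None row j) (vmul (vtarget A i j) (vlam j)) &&
      agree (vmul (vlam i) (entry R i j)) (vmul (entry A i j) (vlam j)))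
    indices) indices.

Definition update A i j v :=
  mkseq (fun i' => mkseq (fun j' =>
    if (i' == i) && (j' == j) then v else entry A i' j') n.+1) n.+1.

(** The conditional keeps the virtual machine from expanding a node that is already refuted. A
    branch that exhausts the order without a contradiction yields [false], so only the answer [true]
    carries information. *)
Fixpoint no_solution w A (order : seq (nat * nat)) :=
  if refuted w A then true
  else if order is (i, j) :: order' then
    all (fun x => no_solution w (update A i j (Some x)) order') (iota 0 p)
  else false.

Definition blank :=
  mkseq (fun i => mkseq (fun j => if i == j then Some 1%N else None) n.+1) n.+1.

(** * Soundness of the search *)

Hypothesis p_prime : prime p.
Let F := 'F_p.

Definition known (x : F) u := if u is Some m then x = m%:R else True.
Definition known_row (q : nat -> F) Q :=
  forall j, (0 < j <= n)%N -> known (q j) (nth None Q j).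
Definition known_mx (a : nat -> nat -> F) A :=
  forall i j, (0 < i <= n)%N -> (0 < j <= n)%N -> known (a i j) (entry A i j).

Let vlam_F i : F := if i == 1%N then ell%:R else 1.

Lemma known_lam i : known (vlam_F i) (vlam i).
Proof. by rewrite /vlam_F /=; case: ifP. Qed.

Lemma known_mul x y u v : known x u -> known y v -> known (x * y) (vmul u v).
Proof.
case: u => [[|x']|]; case: v => [[|y']|] //= hx hy;
  try rewrite hx; try rewrite hy; rewrite ?mul0r ?mulr0 //.
by rewrite Fp_nat_mod // natrM.
Qed.

Lemma known_sub x y u v : known x u -> known y v -> known (x - y) (vsub u v).
Proof.
case: u => [x'|]; case: v => [y'|] //= -> ->.
rewrite Fp_nat_mod // natrD natrB ?(ltnW (ltn_pmod _ (prime_gt0 p_prime))) //.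
by rewrite pchar_Fp_0 // sub0r Fp_nat_mod.
Qed.

Lemma nth_mkseq_n (T : Type) (x0 : T) f j : (0 < j <= n)%N ->
  nth x0 (mkseq f n.+1) j = f j.
Proof. by move=> hj; rewrite nth_mkseq //; lia. Qed.

Lemma entry_mkseq f i j : (0 < i <= n)%N -> (0 < j <= n)%N ->
  entry (mkseq (fun i => mkseq (f i) n.+1) n.+1) i j = f i j.
Proof. by move=> hi hj; rewrite /entry !nth_mkseq_n. Qed.

Lemma known_row_step a A q Q k : (0 < `|k| < n)%N -> known_mx a A ->
  known_row q Q -> known_row (row_step a k q) (vrow_step A k Q).
Proof.
move=> hk ha hq j hj; rewrite nth_mkseq_n // /row_step.
have hs : (0 < `|k|%N <= n)%N by lia.
have hs1 : (0 < `|k|%N.+1 <= n)%N by lia.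
by do 2?[case: ifP => _]; try case: ifP => _; do ?[apply: known_sub|apply: known_mul];
  try exact: hq; exact: ha.
Qed.

Lemma known_transpose a A : known_mx a A -> known_mx (transpose a) (vtranspose A).
Proof. by move=> h i j hi hj; rewrite entry_mkseq //; apply: h. Qed.

Lemma known_step a A k : size A = n.+1 -> (0 < `|k| < n)%N -> known_mx a A ->
  known_mx (step a k) (vstep A k).
Proof.
move=> sA hk ha i j hi hj; rewrite entry_mkseq // /step.
have hT := known_transpose ha.
case: ifP => hib; last first.
  rewrite /entry (nth_map [::]) ?sA; last by lia.
  by apply: known_row_step => // l hl; apply: ha.
case: ifP => hjb.
  by apply: ha; case: ifP => _; lia.
rewrite /entry (nth_map [::]) ?size_mkseq; last by lia.
by apply: known_row_step => // l hl; apply: hT.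
Qed.

Lemma size_vstep A k : size (vstep A k) = n.+1. Proof. exact: size_mkseq. Qed.

Lemma known_run a A w : size A = n.+1 -> braid_word n w -> known_mx a A ->
  known_mx (run a w) (vrun A w).
Proof.
elim: w a A => [//|k w IH] a A sA /= /andP[hk hw] ha.
by apply: IH => //; [apply: size_vstep|apply: known_step].
Qed.

Lemma known_row_run a A w q Q : size A = n.+1 -> braid_word n w -> known_mx a A ->
  known_row q Q -> known_row (row_run a w q) (vrow_run A w Q).
Proof.
elim: w a A q Q => [//|k w IH] a A q Q sA /= /andP[hk hw] ha hq.
by apply: IH => //; [apply: size_vstep|apply: known_step|apply: known_row_step].
Qed.

Lemma known_lower a A i j : known_mx a A -> (0 < i <= n)%N -> (0 < j <= n)%N ->
  known (lower a i j) (vlower A i j).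
Proof. by move=> ha hi hj; rewrite /lower /vlower; case: ifP => // _; apply: ha. Qed.

Lemma known_target a A i j : known_mx a A -> (0 < i <= n)%N -> (0 < j <= n)%N ->
  known (target mu%:R a i j) (vtarget A i j).
Proof.
move=> ha hi hj; apply: known_sub; last by apply: known_mul => //; apply: known_lower.
by rewrite /upper /vupper; case: ifP => // _; apply: ha.
Qed.

Lemma differP x y u v : known x u -> known y v -> differ u v -> x <> y.
Proof.
case: u => [x'|] //; case: v => [y'|] //= -> -> /eqP ne e; apply: ne.
by rewrite -!(val_Fp_nat p_prime) e.
Qed.

Lemma agreeP x y u v : known x u -> known y v -> agree u v -> x = y.
Proof.
case: u => [x'|] //; case: v => [y'|] //= -> -> /eqP e.
by apply/val_inj; rewrite /= !(val_Fp_nat p_prime).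
Qed.

Lemma indicesP i : (i \in indices) = (0 < i <= n)%N.
Proof. by rewrite mem_iota add1n. Qed.

Lemma refutedP w a A : braid_word n w -> size A = n.+1 -> known_mx a A ->
  refuted w A -> ~ is_augmentation mu%:R ell%:R n w a vlam_F.
Proof.
move=> hw sA ha /hasP[i]; rewrite indicesP => hi /hasP[j]; rewrite indicesP => hj h aug.
have [_ _ _ c2 c1] := aug.
have hR := known_run sA hw ha; have hT := known_transpose ha.
have hrow : known_row (lower a i) (mkseq (vlower A i) n.+1).
  by move=> l hl; rewrite nth_mkseq_n //; apply: known_lower.
have hcol : known_row (target mu%:R a ^~ i) (mkseq (vtarget A ^~ i) n.+1).
  by move=> l hl; rewrite nth_mkseq_n //; apply: known_target.
case/or3P: h => h.
- apply: (differP _ _ h (c1 i j hi hj)); first exact: known_row_run.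
  by apply: known_mul (known_lam j); apply: known_target.
- apply: (differP _ _ h (is_augmentation_col hw aug hj hi)); last exact: known_lower.
  apply: known_mul (known_lam j) _.
  by apply: known_row_run => //; rewrite size_mkseq.
- apply: (differP _ _ h (c2 i j hi hj)).
    by apply: known_mul (known_lam i) _; apply: hR.
  by apply: known_mul (known_lam j); apply: ha.
Qed.

(** Among the p branches, the one labelled by the actual value of a i j leaves the table compatible
    with a, and the induction follows this branch. *)
Lemma no_solutionP w a A order : braid_word n w -> size A = n.+1 -> known_mx a A ->
  no_solution w A order -> ~ is_augmentation mu%:R ell%:R n w a vlam_F.
Proof.
move=> hw; elim: order A => [|[i j] order IH] A sA ha /=;
  case: ifP => [/(refutedP hw sA ha)//|_] //.
move/allP => h; set x := (a i j : nat).
have hx : x \in iota 0 p.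
  by rewrite mem_iota /= -[p in (_ < p)%N](Fp_cast p_prime) ltn_ord.
apply: IH (h _ hx); first exact: size_mkseq.
move=> i' j' hi hj; rewrite entry_mkseq //.
by case: ifP => [/andP[/eqP-> /eqP->]|_]; [rewrite /= natr_Zp|apply: ha].
Qed.

Lemma not_augmented w order : (0 < n)%N -> braid_word n w -> closes_to_knot n w ->
  no_solution w blank order -> ~ augmented (mu%:R : F) ell%:R n w.
Proof.
move=> n0 hw hk h aug; have [a ha] := augmented_normalized n0 hw hk aug.
apply: (no_solutionP hw _ _ h ha); first exact: size_mkseq.
move=> i j hi hj; rewrite entry_mkseq //; case: eqP => // ->.
by case: ha => + _ _ _ _; apply.
Qed.

(** The diagonal is set to 1 separately because [unit_diag] ranges over all natural numbers, hence
    also over indices outside the table. *)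
Definition value A i j : F :=
  if i == j then 1 else if entry A i j is Some m then m%:R else 0.

Lemma augmented_verified w A : (0 < n)%N -> braid_word n w -> size A = n.+1 ->
  (0 < ell < p)%N -> all (fun i => entry A i i == Some 1%N) indices ->
  verified w A -> augmented (mu%:R : F) ell%:R n w.
Proof.
move=> n0 hw sA hell diag h; exists (value A), vlam_F.
have ha : known_mx (value A) A.
  move=> i j hi hj; rewrite /value; case: eqP => [<-|_].
    by move/allP: diag => /(_ i); rewrite indicesP => /(_ hi)/eqP->.
  by case: (entry A i j).
split.
- by move=> i; rewrite /value eqxx.
- move=> i; rewrite /vlam_F; case: ifP => _; rewrite ?oner_neq0 //.
  apply/eqP => /(congr1 val); rewrite /= (val_Fp_nat p_prime) modn_small; lia.
- rewrite big_nat_recl //= big_nat_cond big1 ?mulr1 // => i; rewrite andbT => hi.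
  by rewrite /vlam_F; have -> : (i.+1 == 1%N) = false by lia.
- move=> i j hi hj; have := allP h i; rewrite indicesP => /(_ hi)/allP/(_ j).
  rewrite indicesP => /(_ hj)/andP[_]; apply: agreeP.
    by apply: known_mul (known_lam i) _; apply: known_run.
  by apply: known_mul (known_lam j); apply: ha.
- move=> i j hi hj; have := allP h i; rewrite indicesP => /(_ hi)/allP/(_ j).
  rewrite indicesP => /(_ hj)/andP[+ _]; apply: agreeP.
    apply: known_row_run => // l hl; rewrite nth_mkseq_n //; exact: known_lower.
  by apply: known_mul (known_lam j); apply: known_target.
Qed.

End Search.

(** * A computable criterion for transverse non-isotopy *)

Definition augmentation_check p mu ell B A :=
  let n := strands B in
  [&& size A == n.+1, (0 < ell < p)%N,
      all (fun i => entry A i i == Some 1%N) (indices n)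
    & verified p mu ell n (word B) A].

(** The word may be cut at another place, which is a conjugation. The place of the cut determines
    which equations are decided by few entries, and so the size of the tree. *)
Definition obstruction_check p mu ell B k order :=
  closes_to_knot (strands B) (rot k (word B)) &&
  no_solution p mu ell (strands B) (rot k (word B)) (blank (strands B)) order.

Lemma not_isotopic p mu ell B B' A k order : prime p ->
  augmentation_check p mu ell B A -> obstruction_check p mu ell B' k order ->
  ~ transversely_isotopic B B'.
Proof.
move=> p_prime /and4P[/eqP sA hell diag ver] /andP[knot none].
case/and3P: (knot_braidP B) => n0 hw _; case/and3P: (knot_braidP B') => n0' hw' _.
move=> /(augmented_isotopic (mu%:R : 'F_p) ell%:R)[+ _].
move=> /(_ (augmented_verified p_prime n0 hw sA hell diag ver)).
move/(augmented_rot k hw'); apply: (not_augmented p_prime n0' _ knot none).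
by rewrite /braid_word (eq_all_r (mem_rot k _)).
Qed.

Lemma not_isotopic_sym B B' :
  ~ transversely_isotopic B B' -> ~ transversely_isotopic B' B.
Proof. by move=> h iso; apply: h; apply: rst_sym. Qed.

(* Indices start at 1, so row 0 and column 0 are dummies. *)
Definition of_rows (s : seq (seq nat)) : seq (seq (option nat)) :=
  [::] :: [seq None :: [seq Some x | x <- r] | r <- s].

(** * Triangle moves *)

Section TriangleMoves.
Variable R : realType.
Implicit Types (P s : seq 'rV[R]_3) (a b c p q x f h : 'rV[R]_3) (t u m : R).

Definition dot f x : R := \sum_j f 0 j * x 0 j.

Lemma dot_lin f t u p q : dot f (t *: p + u *: q) = t * dot f p + u * dot f q.
Proof.
rewrite /dot !mulr_sumr -big_split; apply: eq_bigr => j _ /=.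
by rewrite !mxE; ring.
Qed.

(* The hyperplane f = m weakly separates the triangle a b c from the segment
   p q, which it leaves strictly on its other side, except maybe for p if first
   holds and for q if last holds. *)
Definition separated (first last : bool) a b c p q := exists f m,
  [/\ [/\ dot f a <= m, dot f b <= m & dot f c <= m],
      (if first then m <= dot f p else m < dot f p)
    & (if last then m <= dot f q else m < dot f q)].

Definition next_vertex P i := nth 0 P (i.+1 %% size P).

Definition clear_of_chain a b c s := forall i, (0 < i < (size s).+2)%N ->
  let P := [:: a, b & s] in
  separated (i == 1%N) (i == (size s).+1) a b c (nth 0 P i) (next_vertex P i).

(** A common point has value at most m on the triangle and at least m on the edge, so it has value
    m. This can only happen at an endpoint where the inequality is weak, that is, at the shared
    vertex b or a. At least one end must be strict, which excludes an edge leading from b straight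
    to a. *)
Lemma triangle_edge (first last : bool) a b c p q x t :
  ~~ (first && last) -> separated first last a b c p q ->
  (first -> p = b) -> (last -> q = a) -> on_triangle a b c x ->
  0 <= t <= 1 -> x = (1 - t) *: p + t *: q ->
  (first /\ t = 0) \/ (last /\ t = 1).
Proof.
move=> nfl [f [m [[fa fb fc] fp fq]]] pb qa [r [v [w [[r0 v0 w0] [rvw ex]]]]] t01 ex'.
have fx : dot f x <= m.
  rewrite ex -[r *: a + v *: b]scale1r.
  rewrite !dot_lin mul1r.
  have -> : m = r * m + v * m + w * m by rewrite -!mulrDl rvw mul1r.
  by rewrite !lerD // ler_wpM2l.
move: fx; rewrite ex' dot_lin; case/andP: t01 => t0 t1.
case: first nfl fp pb => /= [|] nfl fp pb; case: last nfl fq qa => //= nfl fq qa.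
- have fpm : dot f p = m by apply/eqP; rewrite eq_le fp pb // fb.
  rewrite fpm => h; left; split=> //; apply/eqP; rewrite eq_le t0 andbT.
  rewrite -(pmulr_lle0 (x := dot f q - m)) ?subr_gt0 //; lra.
- have fqm : dot f q = m by apply/eqP; rewrite eq_le fq qa // fa.
  rewrite fqm => h; right; split=> //; apply/eqP; rewrite eq_le t1 /= -subr_le0.
  rewrite -(pmulr_lle0 (x := dot f p - m)) ?subr_gt0 //; lra.
- move=> h; exfalso; have [t_le|t_gt] := leP t 0.
    have e0 : t = 0 by apply/eqP; rewrite eq_le t_le.
    by move: h; rewrite e0; lra.
  have : 0 < t * (dot f q - m) by rewrite mulr_gt0 ?subr_gt0.
  have : 0 <= (1 - t) * (dot f p - m) by rewrite mulr_ge0 ?subr_ge0 // ltW.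
  lra.
Qed.

Lemma edge_point_lt (P : seq 'rV[R]_3) i t : (i.+1 < size P)%N ->
  edge_point P i t = (1 - t) *: nth 0 P i + t *: nth 0 P i.+1.
Proof. by move=> hi; rewrite /edge_point modn_small. Qed.

Lemma edge_point_insert a b c s i t : (0 < i < (size s).+2)%N ->
  edge_point [:: a, c, b & s] i.+1 t = edge_point [:: a, b & s] i t.
Proof.
case: i => [//|i] /= hi; rewrite /edge_point /=; congr (_ + _ *: _).
case: (ltngtP i.+2 (size s).+2) => [h|h|h]; last by rewrite h !modnn.
  by rewrite !modn_small // ltnS.
by move: hi h; rewrite -ltnS; lia.
Qed.

Lemma on_triangle_edge a b c t : 0 <= t <= 1 ->
  [/\ on_triangle a b c ((1 - t) *: a + t *: b),
      on_triangle a b c ((1 - t) *: a + t *: c)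
    & on_triangle a b c ((1 - t) *: c + t *: b)].
Proof.
case/andP=> t0 t1; have t1' : 0 <= 1 - t by rewrite subr_ge0.
split.
- by exists (1 - t), t, 0; rewrite scale0r !addr0 subrK.
- by exists (1 - t), 0, t; rewrite scale0r !addr0 subrK.
- exists 0, t, (1 - t); split=> //; split; first by rewrite add0r addrC subrK.
  by rewrite scale0r add0r addrC.
Qed.

Lemma conv_inj (x y t u : R) : x < y ->
  (1 - t) * x + t * y = (1 - u) * x + u * y -> t = u.
Proof.
move=> xy e; have /eqP : (t - u) * (y - x) = 0 by lra.
by rewrite mulf_eq0 !subr_eq0 (gt_eqF xy) orbF => /eqP.
Qed.

Lemma conv_lt (x y t : R) : x < y -> t < 1 -> (1 - t) * x + t * y < y.
Proof.
move=> xy t1; have : 0 < (1 - t) * (y - x) by rewrite mulr_gt0 ?subr_gt0.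
lra.
Qed.

Lemma conv_ge (x y t : R) : x < y -> 0 <= t -> x <= (1 - t) * x + t * y.
Proof.
move=> xy t0; have : 0 <= t * (y - x) by rewrite mulr_ge0 ?subr_ge0 // ltW.
lra.
Qed.

Section Move.
Variables (a b c h : 'rV[R]_3) (s : seq 'rV[R]_3).
Hypothesis s_neq0 : (0 < size s)%N.
Hypothesis h_mono : dot h a < dot h c < dot h b.
Hypothesis clear : clear_of_chain a b c s.

Let P := [:: a, b & s].
Let P' := [:: a, c, b & s].

(** The chain arrives at a with parameter 1, which the half-open parametrization excludes; so b is
    the only remaining contact. *)
Lemma chain_meets_triangle i t x : (0 < i < size P)%N -> 0 <= t < 1 ->
  on_triangle a b c x -> x = edge_point P i t -> x = b.
Proof.
move=> hi t01 tri ex; have hi' : (0 < i < (size s).+2)%N by [].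
have t01' : 0 <= t <= 1 by lra.
have [|||[/eqP i1 t0]|[_ t1]] := triangle_edge _ (clear hi') _ _ tri t01' ex.
- by lia.
- by move/eqP=> ->.
- by move/eqP=> ->; rewrite /next_vertex /= modnn.
- by rewrite ex /edge_point i1 t0 subr0 scale1r scale0r addr0.
- by move: t01; rewrite t1 ltxx andbF.
Qed.

Lemma triangle_condition x : on_polygon P x -> on_triangle a b c x ->
  on_segment a b x.
Proof.
move=> [[|i] [t [hi t01 ex]]] tri.
  by exists t => //; rewrite ex edge_point_lt.
have hi' : (0 < i.+1 < (size s).+2)%N by [].
have [|||[/eqP i1 t0]|[/eqP il t1]] := triangle_edge _ (clear hi') _ _ tri t01 ex.
- by lia.
- by move/eqP=> ->.
- by move/eqP=> ->; rewrite /next_vertex /= modnn.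
- exists 1; rewrite ?lexx ?ler01 // ex /edge_point i1 t0 /=.
  by rewrite subr0 subrr !scale1r !scale0r addr0 add0r.
- exists 0; rewrite ?lexx ?ler01 // ex /edge_point il t1 /= modnn /=.
  by rewrite subr0 subrr !scale1r !scale0r addr0 add0r.
Qed.

Lemma edge0 t : edge_point P 0 t = (1 - t) *: a + t *: b.
Proof. by rewrite edge_point_lt. Qed.
Lemma edge0' t : edge_point P' 0 t = (1 - t) *: a + t *: c.
Proof. by rewrite edge_point_lt. Qed.
Lemma edge1' t : edge_point P' 1 t = (1 - t) *: c + t *: b.
Proof. by rewrite edge_point_lt. Qed.

(* Two points of distinct edges of P' (or P) are told apart by h, unless both
   edges belong to the chain. *)
Lemma simple_insert : simple_polygon P -> simple_polygon P'.
Proof.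
move=> [_ simple]; split=> //.
have wlog_ij : forall (i j : nat) t u, (i <= j < size P')%N ->
    0 <= t < 1 -> 0 <= u < 1 -> edge_point P' i t = edge_point P' j u -> i = j /\ t = u.
  move=> i j t u /andP[ij hj] ht hu e.
  have [i2|i1] := leqP 2 i.
    have [i' ei] : exists i', i = i'.+1 by exists i.-1; lia.
    have [j' ej] : exists j', j = j'.+1 by exists j.-1; lia.
    subst i j; have hj' : (j' < size P)%N by move: hj => /=; lia.
    have hi' : (i' < size P)%N by apply: leq_ltn_trans hj'; lia.
    have hj2 : (0 < j' < (size s).+2)%N by move: hj' => /=; lia.
    have hi2 : (0 < i' < (size s).+2)%N by move: hi' => /=; lia.
    rewrite !edge_point_insert // in e.
    by have [-> ->] := simple i' j' t u hi' hj' ht hu e.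
  (* Such an edge of P' is an edge of the chain, with index one less in P. It can meet the triangle
     only in b, where h exceeds its values on the two half-open new edges. *)
  have far (k : nat) v x : (2 <= k)%N -> (k < size P')%N -> 0 <= v < 1 ->
      on_triangle a b c x ->
      x = edge_point P' k v -> x = b.
    case: k => [//|k] k2 hk hv.
    rewrite edge_point_insert; last by move: hk => /=; lia.
    by apply: chain_meets_triangle => //; move: hk => /=; lia.
  have /andP[hac hcb] := h_mono.
  have /andP[t0 t1] := ht; have /andP[u0 u1] := hu.
  have t01 : 0 <= t <= 1 by rewrite t0 ltW.
  have [_ tri0 tri1] := on_triangle_edge a b c t01.
  case: i i1 ij e => [|[|//]] _ ij; rewrite ?edge0' ?edge1' => e.
  - have lt_c : dot h ((1 - t) *: a + t *: c) < dot h c by rewrite dot_lin conv_lt.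
    case: j ij hj e => [|[|j]] ij hj.
    + by rewrite edge0' => /(congr1 (dot h)); rewrite !dot_lin => /(conv_inj hac).
    + rewrite edge1' => /(congr1 (dot h)) e; exfalso; move: lt_c; rewrite ltNge e.
      by rewrite dot_lin conv_ge.
    + move=> e; have := far j.+2 _ _ isT hj hu tri0 e => /(congr1 (dot h)) e'.
      by move: (lt_trans lt_c hcb); rewrite e' ltxx.
  - case: j ij hj e => [//|[|j]] ij hj.
    + by rewrite edge1' => /(congr1 (dot h)); rewrite !dot_lin => /(conv_inj hcb).
    + move=> e; have := far j.+2 _ _ isT hj hu tri1 e => /(congr1 (dot h)).
      by rewrite dot_lin => /eqP; rewrite lt_eqF // conv_lt.
move=> i j t u hi hj ht hu e; have [ij|ji] := leqP i j.
  by apply: wlog_ij => //; rewrite ij.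
by have [|-> ->] := wlog_ij j i u t _ hu ht (esym e); rewrite ?(ltnW ji).
Qed.

(** Deletions are triangle moves read backwards, and a move asks for simplicity on both sides; this
    carries simplicity to the shorter polygon. *)
Lemma simple_delete : simple_polygon P' -> simple_polygon P.
Proof.
move=> [_ simple]; split; first by rewrite /=; lia.
have /andP[hac hcb] := h_mono; have hab := lt_trans hac hcb.
have chain : forall (i j : nat) t u, (0 < i < size P)%N -> (0 < j < size P)%N ->
    0 <= t < 1 -> 0 <= u < 1 -> edge_point P i t = edge_point P j u -> i = j /\ t = u.
  move=> i j t u hi hj ht hu; rewrite -!(@edge_point_insert a b c s) // => e.
  have hi' : (i.+1 < size P')%N by move: hi => /=; lia.
  have hj' : (j.+1 < size P')%N by move: hj => /=; lia.
  by have [[->] ->] := simple _ _ t u hi' hj' ht hu e.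
have first : forall (j : nat) t u, (0 < j < size P)%N ->
    0 <= t < 1 -> 0 <= u < 1 -> edge_point P 0 t = edge_point P j u -> False.
  move=> j t u hj /andP[t0 t1] hu e; have t01 : 0 <= t <= 1 by rewrite t0 ltW.
  have [tri _ _] := on_triangle_edge a b c t01.
  rewrite edge0 in e; have := chain_meets_triangle hj hu tri e.
  by move/(congr1 (dot h)) => /eqP; rewrite dot_lin lt_eqF // conv_lt.
move=> [|i] [|j] t u hi hj ht hu e.
- move: e; rewrite !edge0 => /(congr1 (dot h)); rewrite !dot_lin.
  by move/(conv_inj hab).
- by case: (first j.+1 t u).
- by case: (first i.+1 u t).
- exact: chain e.
Qed.

End Move.
End TriangleMoves.

(** * Checking triangle moves with integer coordinates *)

Definition pt : Type := Z * Z * Z.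

Section Checker.
Local Open Scope Z_scope.
Implicit Types (a b c p q f : pt) (s P : seq pt).

Definition zdot f p :=
  let: (f1, f2, f3) := f in let: (x, y, z) := p in f1 * x + f2 * y + f3 * z.
Definition zsub p q : pt :=
  let: (x, y, z) := p in let: (x', y', z') := q in (x - x', y - y', z - z').
Definition zopp p : pt := let: (x, y, z) := p in (- x, - y, - z).
Definition zcross p q : pt :=
  let: (x, y, z) := p in let: (x', y', z') := q in
  (y * z' - z * y', z * x' - x * z', x * y' - y * x').

Definition zmax3 u v w := Z.max u (Z.max v w).

Definition above (first last : bool) m u v :=
  if (if first then m <=? u else m <? u) then (if last then m <=? v else m <? v)
  else false.

Definition separates first last a b c p q f :=
  above first last (zmax3 (zdot f a) (zdot f b) (zdot f c)) (zdot f p) (zdot f q).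

Definition axes : seq pt :=
  [:: (1, 0, 0); (-1, 0, 0); (0, 1, 0); (0, -1, 0); (0, 0, 1); (0, 0, -1)].

(* The candidates suggested by the separating axis theorem. *)
Definition normals a b c p q : seq pt :=
  let e1 := zsub b a in let e2 := zsub c a in let e3 := zsub c b in
  let n := zcross e1 e2 in let d := zsub q p in
  [:: n; zcross d e1; zcross d e2; zcross d e3;
      zcross n e1; zcross n e2; zcross n e3].

(* Unlike [has], whose [||] evaluates both arguments in the virtual machine, this
   stops at the first success. *)
Fixpoint first_of (T : Type) (f : T -> bool) (l : seq T) : bool :=
  if l is x :: l' then if f x then true else first_of f l' else false.

Definition edge_clear first last a b c p q :=
  if first_of (separates first last a b c p q) axes then true
  else first_of (fun f => if separates first last a b c p q f then true
    else separates first last a b c p q (zopp f)) (normals a b c p q).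

Fixpoint chain_clear a b c first p s :=
  if s is q :: s' then
    if edge_clear first false a b c p q then chain_clear a b c false q s' else false
  else edge_clear first true a b c p a.

(* The direction in the plane of a b c, along which c is halfway between a and b;
   it vanishes when the triangle is degenerate. *)
Definition steering a b c :=
  let e1 := zsub b a in let e2 := zsub c a in
  zcross (zcross e1 e2) (zsub (zsub e1 e2) e2).

Definition monotone a b c f :=
  if zdot f a <? zdot f c then zdot f c <? zdot f b else false.

(** For a nondegenerate triangle [steering] always increases along a, c, b. For a degenerate one it
    is zero, and b - a increases exactly when c lies strictly between a and b. A nonempty s rules
    out an edge from b straight back to a. *)
Definition triangle_clear a b c s :=
  if (if monotone a b c (steering a b c) then true else monotone a b c (zsub b a))
  then (if s is _ :: _ then chain_clear a b c true b s else false) else false.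

(** Points of a half-open edge have a positive weight at p, so a strict inequality at p suffices and
    q may lie on the separating plane. Thus consecutive edges with q = p' are allowed to touch. *)
Definition below p q p' q' f :=
  let m := Z.max (zdot f p) (zdot f q) in
  if zdot f p <? Z.min (zdot f p') (zdot f q') then
    m <=? Z.min (zdot f p') (zdot f q') else false.

(** The common perpendicular d serves skew edges. The two [steering] directions increase through the
    common vertex of consecutive edges, q = p' or q' = p, and q - p replaces the first of them when
    the edges are collinear. *)
Definition edges_apart p q p' q' :=
  let apart f := if below p q p' q' f then true else below p' q' p q f in
  if first_of apart axes then true
  else let d := zcross (zsub q p) (zsub q' p') in
    first_of apart [:: d; zopp d; zsub q p; steering p q' q; steering p' q q'].

Fixpoint edges_simple (l : seq (pt * pt)) : bool :=
  if l is (p, q) :: l' then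
    (* This says that the squared length of the edge is positive, in the form of a functional that
       is injective on the edge. *)
    if (if zdot (zsub q p) p <? zdot (zsub q p) q then
          all (fun e => edges_apart p q e.1 e.2) l' else false)
    then edges_simple l' else false
  else true.

Definition zsimple P := (2 < size P)%N && edges_simple (zip P (rot 1 P)).

Inductive move := Ins of nat & Z & Z & Z | Del of nat.

(** The rotated list is not rotated back, so each r is relative to the outcome of the preceding
    move. *)
Definition apply_move P o : option (seq pt) :=
  match o with
  | Ins r x y z =>
      if rot r P is a :: b :: s then
        if triangle_clear a b (x, y, z) s then Some (a :: (x, y, z) :: b :: s)
        else None
      else None
  | Del r =>
      if rot r P is a :: c :: b :: s then
        if triangle_clear a b c s then Some (a :: b :: s) else None
      else None
  end.

Fixpoint apply_moves P l :=
  if l is o :: l' then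
    if apply_move P o is Some P' then apply_moves P' l' else None
  else Some P.

End Checker.

Definition zpoint (x y z : int) : pt := (Z_of_int x, Z_of_int y, Z_of_int z).

(** The integer counterpart of [strand_path], on which the virtual machine can compute; [embed_path]
    relates the two. *)
Fixpoint zpath (i p : nat) (w : seq int) : seq pt :=
  zpoint (2 * p)%N (2 * i)%N 0 ::
  match w with
  | [::] => [:: zpoint (2 * p)%N (2 * i + 2)%N (- 2);
                zpoint (2 * p)%N (- 2) (- 2)]
  | k :: w' =>
      (if p == `|k|%N then [:: zpoint (2 * p + 1)%N (2 * i + 1)%N (sgz k)]
       else [::]) ++ zpath i.+1 (cross k p) w'
  end.

(* The vertices of a closure are scaled so that the intermediate polygons may have
   integer coordinates. *)
Definition zscale (S : Z) (p : pt) : pt :=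
  let: (x, y, z) := p in (Z.mul S x, Z.mul S y, Z.mul S z).

Definition zclosure (S : Z) (n : nat) (w : seq int) : seq pt :=
  map (zscale S)
    (flatten [seq zpath 0 p w | p <- traject (end_pos w) 1%N n]).

(** * From integer certificates to real polygons *)

Section Soundness.
Variable R : realType.
Variable S : Z.
Hypothesis S_gt0 : Z.lt Z0 S.
Implicit Types (a b c p q f : pt) (s P : seq pt) (u v w : Z).

Definition toR u : R := (int_of_Z u)%:~R.

Lemma toRD u v : toR (Z.add u v) = toR u + toR v.
Proof. by rewrite /toR -intrD; congr (_%:~R); lia. Qed.
Lemma toRM u v : toR (Z.mul u v) = toR u * toR v.
Proof. by rewrite /toR -intrM; congr (_%:~R); apply: (rmorphM int_of_Z). Qed.
Lemma toR_le u v : Z.le u v -> toR u <= toR v.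
Proof. by move=> h; rewrite /toR ler_int; lia. Qed.
Lemma toR_lt u v : Z.lt u v -> toR u < toR v.
Proof. by move=> h; rewrite /toR ltr_int; lia. Qed.

Definition coords p : seq Z := let: (x, y, z) := p in [:: x; y; z].

(** Division by S undoes the scaling of [zclosure]. Functionals are left unscaled, because only
    comparisons of their values matter. *)
Definition emb p : 'rV[R]_3 := \row_j (toR (nth Z0 (coords p) j) / toR S).
Definition emb_dir f : 'rV[R]_3 := \row_j toR (nth Z0 (coords f) j).

Lemma dot_emb f p : dot (emb_dir f) (emb p) = toR (zdot f p) / toR S.
Proof.
case: f p => [[f1 f2] f3] [[x y] z]; rewrite /dot !big_ord_recl big_ord0 !mxE /=.
by rewrite !toRD !toRM; ring.
Qed.

Lemma toRS_gt0 : 0 < toR S.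
Proof. by rewrite -[0]/(toR Z0); apply: toR_lt. Qed.

Lemma dot_le f p v : Z.le (zdot f p) v -> dot (emb_dir f) (emb p) <= toR v / toR S.
Proof. by move=> h; rewrite dot_emb ler_pM2r ?invr_gt0 ?toRS_gt0 ?toR_le. Qed.
Lemma dot_ge f p v : Z.le v (zdot f p) -> toR v / toR S <= dot (emb_dir f) (emb p).
Proof. by move=> h; rewrite dot_emb ler_pM2r ?invr_gt0 ?toRS_gt0 ?toR_le. Qed.
Lemma dot_gt f p v : Z.lt v (zdot f p) -> toR v / toR S < dot (emb_dir f) (emb p).
Proof. by move=> h; rewrite dot_emb ltr_pM2r ?invr_gt0 ?toRS_gt0 ?toR_lt. Qed.
Lemma dot_lt f p v : Z.lt (zdot f p) v -> dot (emb_dir f) (emb p) < toR v / toR S.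
Proof. by move=> h; rewrite dot_emb ltr_pM2r ?invr_gt0 ?toRS_gt0 ?toR_lt. Qed.
Lemma dot_emb_lt f p q : Z.lt (zdot f p) (zdot f q) ->
  dot (emb_dir f) (emb p) < dot (emb_dir f) (emb q).
Proof. by move=> h; rewrite !dot_emb ltr_pM2r ?invr_gt0 ?toRS_gt0 ?toR_lt. Qed.

Lemma first_ofP (T : Type) (f : T -> bool) l : first_of f l -> exists x, f x.
Proof. by elim: l => //= x l IH; case: ifP => [fx _|_ /IH]; first by exists x. Qed.

Lemma separatesP fst lst a b c p q f : separates fst lst a b c p q f ->
  separated fst lst (emb a) (emb b) (emb c) (emb p) (emb q).
Proof.
rewrite /separates /above /zmax3; set m := Z.max _ _.
case: ifP => // hp hq; exists (emb_dir f), (toR m / toR S); split.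
- by split; apply: dot_le; rewrite /m; lia.
- by case: fst hp => hp; [apply: dot_ge|apply: dot_gt]; lia.
- by case: lst hq => hq; [apply: dot_ge|apply: dot_gt]; lia.
Qed.

Lemma edge_clearP fst lst a b c p q : edge_clear fst lst a b c p q ->
  separated fst lst (emb a) (emb b) (emb c) (emb p) (emb q).
Proof.
rewrite /edge_clear; case: ifP => [/first_ofP[f /separatesP]//|_].
case/first_ofP => f; case: ifP => [/separatesP//|_]; exact: separatesP.
Qed.

(** The edges whose initial points are [p :: s] have the final points [rcons s a]: the chain closes
    up at a. *)
Lemma chain_clearP a b c fst p s i : chain_clear a b c fst p s -> (i <= size s)%N ->
  separated (fst && (i == 0%N)) (i == size s) (emb a) (emb b) (emb c)
    (nth 0 (map emb (p :: s)) i) (nth 0 (map emb (rcons s a)) i).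
Proof.
elim: s fst p i => [|q s IH] fst p [|i] //=; rewrite ?andbT.
- by move/edge_clearP.
- by case: ifP => // /edge_clearP.
- by case: ifP => // _ /IH h hi; rewrite andbF; have := h i hi.
Qed.

Lemma monotoneP a b c f : monotone a b c f ->
  exists h, dot h (emb a) < dot h (emb c) < dot h (emb b).
Proof.
rewrite /monotone; case: ifP => // h1 h2; exists (emb_dir f).
by rewrite !dot_emb_lt //; lia.
Qed.

Lemma next_vertex_rcons (x y : 'rV[R]_3) l i : (i <= size l)%N ->
  next_vertex [:: x, y & l] i.+1 = nth 0 (rcons l x) i.
Proof.
rewrite /next_vertex nth_rcons /= leq_eqVlt => /orP[/eqP->|lt_i].
  by rewrite modnn ltnn eqxx.
by rewrite modn_small ?ltnS ?lt_i.
Qed.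

Lemma triangle_clearP a b c s : triangle_clear a b c s ->
  [/\ (0 < size (map emb s))%N,
      exists h, dot h (emb a) < dot h (emb c) < dot h (emb b)
    & clear_of_chain (emb a) (emb b) (emb c) (map emb s)].
Proof.
rewrite /triangle_clear; case: ifP => // hm; case: s => // x s hs; split=> //.
  by move: hm; case: ifP => [/monotoneP|_ /monotoneP].
move=> [|i] // hi P; rewrite size_map in hi.
have hi' : (i <= size (x :: s))%N by move: hi => /=; lia.
have := chain_clearP hs hi'; rewrite /P next_vertex_rcons; last by rewrite size_map.
by rewrite map_rcons size_map !eqSS.
Qed.
End Soundness.

Lemma nth_rot (T : Type) (x0 : T) k (s : seq T) i : (k < size s)%N -> (i < size s)%N ->
  nth x0 (rot k s) i = nth x0 s ((k + i) %% size s).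
Proof.
move=> hk hi; rewrite nth_cat size_drop; case: ltnP => h.
  by rewrite nth_drop modn_small //; lia.
rewrite nth_take; last by lia.
congr (nth _ _ _); have -> : (k + i = size s + (i - (size s - k)))%N by lia.
by rewrite modnDl modn_small //; lia.
Qed.

Section Soundness.
Variable R : realType.

Lemma simple_polygon_rot k (P : seq 'rV[R]_3) :
  simple_polygon P -> simple_polygon (rot k P).
Proof.
have [hk|hk] := ltnP k (size P); last by rewrite rot_oversize.
move=> [P_gt2 simple]; split; rewrite size_rot // => i j t u hi hj ht hu.
have n_gt0 : (0 < size P)%N by lia.
have rot_edge l v : (l < size P)%N ->
    edge_point (rot k P) l v = edge_point P ((k + l) %% size P) v.
  move=> hl; rewrite /edge_point size_rot !nth_rot ?ltn_pmod //.
  have e m n : ((m %% n).+1 = m.+1 %[mod n])%N by rewrite -addn1 modnDml addn1.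
  by rewrite modnDmr addnS e.
rewrite !rot_edge // => /simple[] //; rewrite ?ltn_pmod // => /eqP e ->; split=> //.
by move: e; rewrite eqn_modDl !modn_small // => /eqP.
Qed.

Variable S : Z.
Hypothesis S_gt0 : Z.lt Z0 S.
Implicit Types (a b c p q f : pt) (s P : seq pt).
Let embed := map (emb R S).

Lemma same_knot_rot k (P : seq 'rV[R]_3) : same_knot_type P (rot k P).
Proof. by apply: rst_step; apply: move_rot. Qed.

Lemma apply_moveP P o P' : apply_move P o = Some P' -> simple_polygon (embed P) ->
  simple_polygon (embed P') /\ same_knot_type (embed P) (embed P').
Proof.
have tri_ok a b c s : triangle_clear a b c s ->
  (simple_polygon (embed [:: a, b & s]) <-> simple_polygon (embed [:: a, c, b & s])) /\
  (simple_polygon (embed [:: a, b & s]) ->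
   same_knot_type (embed [:: a, b & s]) (embed [:: a, c, b & s])).
  move=> /(triangle_clearP R S_gt0)[s_gt0 [h mono] clear].
  have e : simple_polygon (embed [:: a, b & s]) <->
      simple_polygon (embed [:: a, c, b & s]).
    by split; [apply: (simple_insert s_gt0 mono clear)|
      apply: (simple_delete s_gt0 mono clear)].
  split=> // simple; apply: rst_step; apply: move_triangle => //; first exact/e.
  by move=> x; exact: (triangle_condition s_gt0 mono clear).
(* An insertion is a triangle move after a rotation. A deletion is the inverse of one, and the
   simplicity of the shorter polygon is derived first. *)
case: o => [r x y z|r] /=; case e : (rot r P) => [|a [|b s]] //.
  case: ifP => // /tri_ok[simpleE same] [<-] /(simple_polygon_rot r).
  rewrite /embed -map_rot e => h; split; first exact/simpleE.
  apply: (rst_trans _ _ _ (rot r (embed P))); first exact: same_knot_rot.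
  by rewrite /embed -map_rot e; apply: same.
case: s e => [|c s] // e; case: ifP => // /tri_ok[simpleE same] [<-] /(simple_polygon_rot r).
rewrite /embed -map_rot e => h; split; first exact/simpleE.
apply: (rst_trans _ _ _ (rot r (embed P))); first exact: same_knot_rot.
by rewrite /embed -map_rot e; apply: rst_sym; apply: same; apply/simpleE.
Qed.

Lemma apply_movesP P l P' : apply_moves P l = Some P' -> simple_polygon (embed P) ->
  same_knot_type (embed P) (embed P').
Proof.
elim: l P => [|o l IH] P /=; first by move=> [->] _; apply: rst_refl.
case e : (apply_move P o) => [Q|//] /IH h /(apply_moveP e)[/h hQ hP].
exact: rst_trans hP hQ.
Qed.

Lemma belowP p q p' q' f (t u : R) : below p q p' q' f ->
  0 <= t < 1 -> 0 <= u < 1 ->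
  (1 - t) *: emb R S p + t *: emb R S q <> (1 - u) *: emb R S p' + u *: emb R S q'.
Proof.
rewrite /below; set m' := Z.min _ _; case: ifP => // hp hq /andP[t0 t1] /andP[u0 u1].
have fp : dot (emb_dir R f) (emb R S p) < toR R m' / toR R S.
  by apply: dot_lt => //; lia.
have fq : dot (emb_dir R f) (emb R S q) <= toR R m' / toR R S.
  by apply: dot_le => //; lia.
have fp' : toR R m' / toR R S <= dot (emb_dir R f) (emb R S p').
  by apply: dot_ge => //; lia.
have fq' : toR R m' / toR R S <= dot (emb_dir R f) (emb R S q').
  by apply: dot_ge => //; lia.
move/(congr1 (dot (emb_dir R f))); rewrite !dot_lin.
have : 0 < (1 - t) * (toR R m' / toR R S - dot (emb_dir R f) (emb R S p)).
  by rewrite mulr_gt0 ?subr_gt0.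
have : 0 <= t * (toR R m' / toR R S - dot (emb_dir R f) (emb R S q)).
  by rewrite mulr_ge0 ?subr_ge0.
have : 0 <= (1 - u) * (dot (emb_dir R f) (emb R S p') - toR R m' / toR R S).
  by rewrite mulr_ge0 ?subr_ge0 // ltW.
have : 0 <= u * (dot (emb_dir R f) (emb R S q') - toR R m' / toR R S).
  by rewrite mulr_ge0 ?subr_ge0.
lra.
Qed.

Lemma edges_apartP p q p' q' (t u : R) : edges_apart p q p' q' ->
  0 <= t < 1 -> 0 <= u < 1 ->
  (1 - t) *: emb R S p + t *: emb R S q <> (1 - u) *: emb R S p' + u *: emb R S q'.
Proof.
move=> hap ht hu; have [f] : exists f, below p q p' q' f || below p' q' p q f.
  move: hap; rewrite /edges_apart; case: ifP => [/first_ofP[f hf] _|_ /first_ofP[f hf]];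
    by exists f; move: hf; case: ifP => // _ ->.
case/orP => [/belowP h|/belowP h]; first exact: h.
by move/esym; apply: h.
Qed.

Lemma edges_simpleP e0 (l : seq (pt * pt)) : edges_simple l ->
  (forall i, (i < size l)%N -> let: (p, q) := nth e0 l i in
     Z.lt (zdot (zsub q p) p) (zdot (zsub q p) q)) /\
  (forall i j, (i < j < size l)%N -> edges_apart (nth e0 l i).1 (nth e0 l i).2
     (nth e0 l j).1 (nth e0 l j).2).
Proof.
elim: l => [|[p q] l IH] //=; first by split=> // i j; rewrite ltn0 andbF.
case: ifP => //; case: ifP => // pq /all_nthP apart /IH[IH1 IH2]; split.
  by move=> [|i] hi; [move: pq => /=; lia|apply: IH1].
move=> [|i] [|j] //= hij; first exact: apart.
exact: IH2.
Qed.

Lemma zsimpleP P : zsimple P -> simple_polygon (embed P).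
Proof.
pose e0 : pt := (Z0, Z0, Z0); case/andP=> P_gt2 /(edges_simpleP (e0, e0)).
rewrite size_zip size_rot minnn => -[nondeg apart]; split; first by rewrite size_map.
rewrite size_map => i j t u hi hj ht hu.
have P_gt1 : (1 < size P)%N by lia.
have edgeE k : (k < size P)%N -> nth (e0, e0) (zip P (rot 1 P)) k =
    (nth e0 P k, nth e0 P (k.+1 %% size P)).
  by move=> hk; rewrite nth_zip ?size_rot // nth_rot.
have pointE k v : (k < size P)%N -> edge_point (embed P) k v =
    (1 - v) *: emb R S (nth e0 P k) + v *: emb R S (nth e0 P (k.+1 %% size P)).
  by move=> hk; rewrite /edge_point size_map !(nth_map e0) // ltn_pmod; lia.
rewrite !pointE //; case: (ltngtP i j) => ij.
- have /(_ _)/edges_apartP := apart i j; rewrite !edgeE // => h e.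
  by case: (h _ _ _ ht hu e); rewrite ij.
- have /(_ _)/edges_apartP := apart j i; rewrite !edgeE // => h e.
  by case: (h _ _ _ hu ht (esym e)); rewrite ij.
(* Two points of the same edge are told apart by the direction of the edge itself. *)
- subst j; set f := zsub (nth e0 P (i.+1 %% size P)) (nth e0 P i).
  move=> /(congr1 (dot (emb_dir R f))).
  rewrite !dot_lin => /conv_inj h; split=> //; apply: h.
  by apply: dot_emb_lt => //; have := nondeg i hi; rewrite edgeE.
Qed.

Lemma emb_point x y z : emb R S (zscale S (zpoint x y z)) =
  point R x y z.
Proof.
have S0 : toR R S != 0 by rewrite gt_eqF // toRS_gt0.
apply/rowP => j; rewrite !mxE.
by case: j => [[|[|[|//]]] hj] /=; rewrite toRM mulrC mulKf // /toR Z_of_intK.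
Qed.

Lemma embed_path (i p : nat) w :
  embed (map (zscale S) (zpath i p w)) = strand_path R i p w.
Proof.
elim: w i p => [|k w IH] i p; rewrite /embed [zpath _ _ _]/= ![map _ (_ :: _)]map_cons.
  by rewrite !emb_point.
rewrite !map_cat emb_point [map _ (map _ (zpath _ _ _))]IH [RHS]/=.
by case: ifP => _ //; rewrite /map emb_point.
Qed.

Lemma embed_closure B : embed (zclosure S (strands B) (word B)) = braid_closure R B.
Proof.
rewrite /embed /zclosure /braid_closure !map_flatten -!map_comp; congr flatten.
by apply: eq_map => p; exact: embed_path.
Qed.

Lemma same_knot_by_moves B B' l r P :
  zsimple (zclosure S (strands B) (word B)) ->
  apply_moves (zclosure S (strands B) (word B)) l = Some P ->
  rot r P = zclosure S (strands B') (word B') ->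
  same_knot_type (braid_closure R B') (braid_closure R B).
Proof.
move=> /zsimpleP simple moves rotP; apply: rst_sym.
rewrite -!embed_closure -rotP /embed map_rot.
by apply: rst_trans (same_knot_rot r _); exact: apply_movesP moves simple.
Qed.

End Soundness.

(** Only the initial polygon is tested for simplicity, as every move preserves it. The final
    rotation by r aligns the starting vertices of the two cyclic lists. *)
Definition isotopy_check B B' l r :=
  zsimple (zclosure 64 (strands B) (word B)) &&
  if apply_moves (zclosure 64 (strands B) (word B)) l is Some P
  then rot r P == zclosure 64 (strands B') (word B') else false.

Lemma nonsimple (R : realType) K B l r : isotopy_check K B l r ->
  self_linking K = self_linking B -> ~ transversely_isotopic K B ->
  transversely_nonsimple (braid_closure R K).
Proof.
move=> /andP[simple]; case e : (apply_moves _ l) => [P|//] /eqP rotP sl noniso.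
exists K, B; split=> //; first exact: rst_refl.
by apply: (@same_knot_by_moves R 64 _ K B l r P).
Qed.

(** * Certificates *)

(* The moves were found by a computer search for paths between arc presentations of
   the two closures; the augmentations and the search orders likewise. *)
Definition m7_2_moves : seq move := [::
  Ins 28 0 64 (-64); Ins 18 0 192 (-64); Ins 30 0 320 (-64); Del 59;
  Ins 17 0 448 (-64); Ins 2 0 576 (-64); Ins 2 0 704 (-64);
  Ins 32 0 832 (-64); Ins 51 0 960 (-64); Ins 17 0 1088 (-64); Del 64;
  Ins 51 0 1177 (-64); Ins 16 0 1203 (-64); Ins 34 0 1228 (-64);
  Ins 48 0 1254 (-64); Ins 40 0 (-25) (-64); Ins 17 0 (-51) (-64);
  Ins 36 0 (-76) (-64); Ins 51 0 (-102) (-64); Del 49; Ins 1 (-64) 960 (-58);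
  Del 71; Del 56; Ins 1 (-48) 1068 (-39); Del 70; Ins 17 (-19) 1145 (-42);
  Del 70; Del 32; Del 1; Del 0; Del 0; Del 0; Ins 0 (-43) 966 60; Del 65;
  Del 22; Del 0; Del 0; Del 0; Del 0; Del 0; Del 1; Ins 0 9 403 150; Del 58;
  Del 9; Del 0; Ins 1 38 134 20; Del 56; Ins 24 23 640 (-42); Del 56; Del 11;
  Del 0; Del 0; Del 1; Del 0; Del 0; Ins 0 178 576 8; Del 50;
  Ins 38 32 512 (-64); Del 50; Del 31; Del 1; Del 0; Del 0; Del 0; Del 0;
  Del 0; Del 6; Del 1; Del 11; Del 23; Del 13; Del 18; Del 28;
  Ins 1 (-299) 576 (-90); Del 36; Ins 9 (-280) 576 (-206); Del 36;
  Ins 20 (-215) 576 (-309); Del 36; Ins 26 2 (-19) (-105); Del 36; Del 13;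
  Ins 1 28 58 (-125); Del 35; Ins 21 (-112) 576 (-384); Del 35; Del 4;
  Ins 1 69 256 (-130); Del 34; Ins 29 217 787 (-151); Del 34; Del 3; Del 0;
  Del 3; Del 30; Del 1; Del 28; Ins 16 (-51) 960 (-103); Del 28; Del 23;
  Del 0; Del 5; Del 24; Del 0; Del 0; Ins 12 (-215) 576 181; Del 22; Del 21;
  Del 0; Ins 18 116 384 (-175); Del 20; Ins 11 9 404 150; Del 20;
  Ins 19 (-220) 468 47; Del 20; Ins 15 (-65) 314 120; Del 20;
  Ins 17 (-99) 659 (-345); Del 20; Ins 15 (-174) 390 (-199); Del 20;
  Ins 2 2 (-16) (-65); Del 20; Ins 1 0 19 (-64); Del 20; Ins 1 (-2) 73 (-63);
  Del 20; Ins 1 0 128 (-64); Del 20; Ins 1 (-2) 192 (-63); Del 20;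
  Ins 1 0 256 (-64); Del 20; Del 1; Del 18; Ins 8 (-29) 314 129;
  Ins 0 0 896 (-64); Ins 2 85 410 291; Del 20; Ins 1 140 410 134; Del 20;
  Ins 7 (-54) 468 301; Del 20; Del 1; Del 0; Ins 12 56 410 172;
  Ins 0 0 768 (-64); Ins 0 (-9) 832 (-77); Del 20; Ins 9 21 896 (-40); Del 20;
  Del 19; Del 0; Ins 0 148 512 (-4); Del 18; Ins 11 6 832 64; Del 18;
  Ins 0 0 576 (-64); Del 18; Ins 6 95 966 27; Del 18;
  Ins 11 (-112) 576 (-384); Del 18; Ins 6 0 1177 (-64); Del 18;
  Ins 16 69 256 (-130); Del 18; Ins 12 0 960 (-64); Del 18;
  Ins 13 0 704 (-64); Del 18; Ins 8 (-20) 1081 (-7); Del 18;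
  Ins 11 (-299) 576 (-90); Del 18; Ins 9 (-462) 576 25; Ins 0 0 1203 (-64);
  Ins 2 (-83) 134 (-22); Ins 0 0 (-51) (-64); Ins 21 (-280) 576 (-206); Del 1;
  Ins 14 135 576 233; Ins 0 0 1228 (-64); Ins 1 (-822) 576 466; Del 1;
  Ins 23 (-215) 576 (-309); Del 1; Ins 16 0 448 (-64); Ins 1 32 512 (-64);
  Ins 13 0 832 (-64); Ins 1 13 896 (-35); Ins 19 (-182) 339 (-48);
  Ins 0 0 (-25) (-64); Ins 22 2 (-19) (-105); Ins 0 0 (-102) (-64);
  Ins 8 0 1088 (-64); Ins 1 (-15) 1132 (-47); Ins 22 448 448 64; Del 1;
  Ins 5 512 384 0; Del 1; Ins 33 448 192 64; Ins 31 512 (-128) (-128); Del 1;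
  Ins 20 512 128 0; Del 1; Ins 34 448 64 64; Ins 17 512 0 0; Del 1;
  Ins 16 384 (-128) (-128); Del 1; Ins 10 256 (-128) (-128); Del 1;
  Ins 18 128 (-128) (-128); Del 1; Ins 35 128 1280 (-128);
  Ins 18 256 1280 (-128); Ins 27 384 1280 (-128); Ins 19 512 1280 (-128);
  Ins 24 384 0 0; Ins 23 512 256 0; Ins 41 384 128 0; Ins 37 512 1152 0;
  Ins 0 512 1024 0; Ins 0 512 896 0; Ins 0 512 768 0; Ins 0 512 640 0;
  Ins 0 512 512 0; Ins 48 384 384 0; Ins 19 384 512 0; Del 1;
  Ins 19 320 576 64; Del 1; Ins 0 384 768 0; Ins 0 384 640 0;
  Ins 51 256 512 0; Ins 0 256 384 0; Ins 0 384 256 0; Ins 46 320 832 64;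
  Del 1; Ins 0 384 1152 0; Ins 0 384 1024 0; Ins 0 384 896 0;
  Ins 57 256 768 0; Ins 20 256 896 0; Del 1; Ins 29 192 960 64; Del 1;
  Ins 0 256 1024 0; Ins 59 128 896 0; Ins 0 128 768 0; Ins 0 256 640 0;
  Ins 35 192 1088 64; Del 1; Ins 0 256 1152 0; Ins 63 128 1024 0;
  Ins 36 128 1152 0; Del 1; Ins 35 256 256 0; Del 1; Ins 64 256 128 0;
  Ins 0 256 0 0; Ins 36 128 640 0; Del 1; Ins 66 128 512 0; Ins 0 128 384 0;
  Ins 0 128 256 0; Ins 0 128 128 0; Ins 0 128 0 0; Del 51; Del 35; Del 19;
  Del 34; Del 46; Del 33; Del 18; Del 32; Del 62; Del 29; Del 60;
  Ins 43 192 704 (-64); Del 1; Del 45; Del 58; Ins 42 320 320 (-64); Del 1;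
  Del 42; Del 27].

Definition m7_2_augmentation := of_rows
  [:: [:: 1; 2; 2; 0]; [:: 1; 1; 0; 2]; [:: 0; 2; 1; 0]; [:: 2; 1; 0; 1]].

Definition m7_2_order : seq (nat * nat) := [::
  (2, 1); (3, 1); (1, 4); (4, 1); (1, 3); (2, 3); (3, 4); (2, 4); (4, 3);
  (3, 2); (1, 2); (4, 2)].

(** A negative flype: the final block [1 1 2 -1] becomes [-1 2 1 1], where the rest of the word
    avoids sigma_1. *)
Definition m7_2_partner : knot_braid :=
  @KnotBraid 4 [:: 3; 3; -2; 3; 2; -1; 2; 1; 1]%Z isT.

Lemma m7_2_nonsimple (R : realType) :
  transversely_nonsimple (braid_closure R m7_2).
Proof.
apply: (@nonsimple R m7_2 m7_2_partner m7_2_moves 14); first by vm_compute.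
  by rewrite /self_linking /writhe !big_cons !big_nil.
(* The partner has the augmentation, over F_3 with mu = ell = -1; the search refutes the given
   braid, its word being cut after six letters. *)
apply: not_isotopic_sym.
apply: (@not_isotopic 3 2 2 _ _ m7_2_augmentation 6 m7_2_order);
  [by []|by vm_compute..].
Qed.

Definition m7_6_moves : seq move := [::
  Ins 29 0 64 (-64); Ins 32 0 192 (-64); Del 58; Ins 46 0 320 (-64);
  Ins 46 0 448 (-64); Del 59; Ins 3 0 576 (-64); Del 59; Ins 45 0 704 (-64);
  Ins 18 0 832 (-64); Ins 32 0 960 (-64); Ins 34 0 1088 (-64);
  Ins 15 0 1177 (-64); Ins 32 0 1203 (-64); Ins 20 0 1228 (-64);
  Ins 33 0 1254 (-64); Ins 51 0 (-25) (-64); Ins 34 0 (-51) (-64);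
  Ins 21 0 (-76) (-64); Ins 35 0 (-102) (-64); Del 41; Del 0; Del 0; Del 0;
  Del 0; Del 0; Ins 1 (-213) 748 (-45); Del 65; Del 42; Del 0; Del 1;
  Ins 0 (-86) 256 (-21); Del 62; Del 25; Del 1; Ins 0 (-36) 83 (-23); Del 60;
  Ins 34 (-10) 6 (-37); Del 60; Del 18; Del 0; Ins 1 4 122 35; Del 58; Del 32;
  Del 0; Del 0; Ins 1 51 953 50; Del 55; Ins 19 25 1158 (-40); Del 55; Del 23;
  Del 1; Ins 0 68 1107 (-37); Del 53; Del 26; Del 1; Del 15; Del 0; Del 0;
  Del 0; Del 1; Del 0; Ins 24 23 512 (-86); Del 45; Del 29; Del 0; Del 0;
  Del 0; Del 0; Del 13; Ins 1 3 704 (-128); Del 39; Del 23; Del 21; Del 22;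
  Del 20; Ins 6 465 869 (-25); Del 35; Ins 31 67 576 (-164); Del 35;
  Ins 1 (-299) 576 (-90); Del 35; Ins 16 234 576 (-273); Del 35;
  Ins 11 76 960 (-55); Del 35; Ins 26 (-280) 576 (-206); Del 35;
  Ins 15 (-215) 576 (-309); Del 35; Ins 16 (-112) 576 (-384); Del 35;
  Ins 3 83 301 (-248); Del 35; Del 28; Ins 1 178 576 (-136); Del 34;
  Ins 21 64 960 (-64); Del 34; Del 9; Del 0; Del 19; Del 30;
  Ins 2 (-62) 704 (-46); Del 30; Del 19; Del 0; Del 8; Del 0;
  Ins 22 (-475) 576 748; Del 26; Del 1; Del 0; Ins 10 57 122 17; Del 24;
  Del 13; Del 0; Del 5; Del 20; Ins 2 (-398) 576 220; Del 20;
  Ins 1 162 576 219; Del 20; Del 1; Del 0; Ins 0 99 736 (-13); Del 18;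
  Ins 7 26 576 (-122); Del 18; Ins 5 (-21) 886 (-234); Del 18;
  Ins 11 (-69) 288 (-152); Del 18; Ins 13 (-86) 148 (-56); Del 18;
  Ins 3 69 768 (-130); Del 18; Ins 15 2 432 (-8); Del 18; Ins 0 0 544 (-64);
  Del 18; Ins 9 0 512 (-64); Del 18; Ins 5 0 448 (-64); Del 18;
  Ins 4 131 966 (-64); Del 18; Ins 8 0 576 (-64); Del 18;
  Ins 8 (-86) 256 (-21); Del 18; Ins 10 0 320 (-64); Del 18;
  Ins 13 0 704 (-64); Del 18; Ins 15 0 64 (-64); Del 18; Ins 15 0 960 (-64);
  Del 18; Ins 11 0 1228 (-64); Del 18; Ins 6 (-433) 276 60;
  Ins 0 0 (-25) (-64); Ins 1 87 276 59; Del 1; Ins 3 30 736 (-49); Del 1;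
  Ins 15 31 84 (-20); Del 1; Ins 1 46 704 (-108); Del 1;
  Ins 15 (-213) 748 (-45); Del 1; Ins 17 10 774 163; Del 1;
  Ins 9 (-139) 512 (-240); Del 1; Ins 7 (-823) 576 1343; Del 1; Del 0; Del 0;
  Ins 4 6 832 64; Ins 0 0 1088 (-64); Ins 1 (-128) 832 (-64); Del 1;
  Ins 19 2 1171 (-105); Del 1; Ins 3 (-60) 1082 (-76); Del 1; Del 0; Del 0;
  Ins 8 4 122 35; Ins 0 0 (-76) (-64); Ins 19 (-215) 576 (-309); Del 1;
  Ins 12 (-280) 576 (-206); Ins 0 0 1203 (-64); Ins 21 25 1081 (-9); Del 1;
  Ins 18 (-112) 576 (-384); Ins 0 0 1254 (-64); Ins 23 39 1171 (-79); Del 1;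
  Ins 22 162 640 91; Ins 0 0 192 (-64); Ins 25 (-36) 83 (-23); Del 1;
  Ins 12 (-23) 6 (-82); Ins 0 0 (-51) (-64); Ins 1 28 6 (-72); Del 1;
  Ins 27 (-10) 6 (-37); Del 1; Ins 12 (-299) 576 (-90); Ins 0 0 1177 (-64);
  Ins 10 7 237 (-233); Ins 0 0 (-102) (-64); Ins 4 0 832 (-64);
  Ins 1 30 896 (-52); Ins 12 448 832 64; Del 1; Ins 19 512 768 0; Del 1;
  Ins 33 448 704 64; Ins 29 512 1152 0; Del 1; Ins 18 512 640 0; Del 1;
  Ins 34 448 576 64; Ins 19 512 (-128) (-128); Del 1; Ins 1 512 512 0; Del 1;
  Ins 19 384 (-128) (-128); Del 1; Ins 24 256 (-128) (-128); Del 1;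
  Ins 16 128 (-128) (-128); Del 1; Ins 35 128 1280 (-128);
  Ins 20 256 1280 (-128); Ins 12 384 1280 (-128); Ins 16 512 1280 (-128);
  Ins 3 512 384 0; Ins 0 512 256 0; Ins 0 512 128 0; Ins 0 512 0 0;
  Ins 20 384 512 0; Ins 31 384 640 0; Ins 20 384 1152 0; Ins 0 512 1024 0;
  Ins 0 512 896 0; Ins 48 384 768 0; Ins 35 384 896 0; Del 1;
  Ins 32 320 960 64; Del 1; Ins 0 384 1024 0; Ins 50 256 896 0;
  Ins 0 256 768 0; Ins 0 256 640 0; Ins 0 256 512 0; Ins 0 384 384 0;
  Ins 0 384 256 0; Ins 26 256 1152 0; Del 1; Ins 56 256 1024 0;
  Ins 23 256 256 0; Del 1; Ins 57 384 128 0; Ins 0 384 0 0; Ins 43 256 0 0;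
  Del 1; Ins 25 192 64 64; Del 1; Ins 0 256 128 0; Ins 60 128 0 0;
  Ins 38 192 320 64; Del 1; Ins 0 256 384 0; Ins 62 128 256 0;
  Ins 0 128 128 0; Ins 22 128 1152 0; Del 1; Ins 64 128 1024 0;
  Ins 0 128 896 0; Ins 0 128 768 0; Ins 0 128 640 0; Ins 0 128 512 0;
  Ins 0 128 384 0; Del 28; Del 37; Del 49; Del 33; Del 14; Del 35; Del 46;
  Del 31; Ins 14 448 1088 (-64); Del 1; Del 14; Del 60; Del 15; Del 41;
  Ins 14 320 448 (-64); Del 1; Del 13; Ins 12 320 192 (-64); Del 1; Del 26].

Definition m7_6_augmentation := of_rows
  [:: [:: 1; 1; 0; 1]; [:: 2; 1; 2; 2]; [:: 2; 0; 1; 0]; [:: 2; 1; 0; 1]].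

Definition m7_6_order : seq (nat * nat) := [::
  (1, 4); (2, 4); (1, 2); (2, 1); (4, 2); (4, 1); (1, 3); (4, 3); (2, 3);
  (3, 1); (3, 2); (3, 4)].

(** A negative flype: the final block [-3 2 3 3 3] becomes [3 3 3 2 -3]. *)
Definition m7_6_partner : knot_braid :=
  @KnotBraid 4 [:: 1; -2; 1; -2; 3; 3; 3; 2; -3]%Z isT.

Lemma m7_6_nonsimple (R : realType) :
  transversely_nonsimple (braid_closure R m7_6).
Proof.
apply: (@nonsimple R m7_6 m7_6_partner m7_6_moves 28); first by vm_compute.
  by rewrite /self_linking /writhe !big_cons !big_nil.
(* Here the given braid has the augmentation and the partner is refuted. *)
apply: (@not_isotopic 3 2 2 _ _ m7_6_augmentation 8 m7_6_order);
  [by []|by vm_compute..].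
Qed.

Definition k9_44_moves : seq move := [::
  Ins 45 0 64 (-64); Del 57; Ins 29 0 192 (-64); Ins 17 0 320 (-64);
  Ins 32 0 448 (-64); Del 59; Ins 32 0 576 (-64); Del 59; Ins 31 0 704 (-64);
  Ins 46 0 832 (-64); Ins 33 0 960 (-64); Del 61; Ins 3 0 1088 (-64); Del 61;
  Ins 31 0 1177 (-64); Ins 17 0 1203 (-64); Ins 32 0 1228 (-64);
  Ins 49 0 1254 (-64); Ins 34 0 (-25) (-64); Ins 18 0 (-51) (-64);
  Ins 34 0 (-76) (-64); Ins 52 0 (-102) (-64); Del 27; Del 0;
  Ins 1 (-86) 1004 (-56); Del 67; Del 26; Del 0; Del 0; Del 0; Del 0; Del 1;
  Ins 0 (-171) 576 23; Del 61; Del 13; Ins 1 (-42) 448 (-16); Del 60; Del 26;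
  Del 0; Del 1; Del 0; Del 0; Ins 0 (-39) 211 48; Del 55; Del 13;
  Ins 1 3 70 (-3); Del 54; Ins 28 14 (-6) (-32); Del 54; Del 38; Del 0;
  Ins 1 76 109 9; Del 52; Del 16; Del 0; Del 0; Del 0; Del 0; Ins 1 178 448 8;
  Del 47; Del 12; Del 0; Del 0; Ins 10 30 1024 (-76); Del 44; Del 11; Del 1;
  Del 0; Del 0; Del 16; Ins 1 3 576 (-128); Del 39; Del 15; Del 9; Del 17;
  Del 27; Del 24; Ins 11 167 576 (-314); Del 34; Ins 9 234 576 (-273); Del 34;
  Ins 27 (-299) 576 (-90); Del 34; Ins 9 (-280) 576 (-206); Del 34;
  Ins 19 (-215) 576 (-309); Del 34; Ins 27 (-112) 576 (-384); Del 34;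
  Ins 33 17 1171 (-102); Del 34; Ins 9 118 902 (-177); Del 34;
  Ins 17 125 953 (-64); Del 34; Del 27; Del 0; Del 13; Del 30;
  Ins 4 (-506) 576 (-111); Del 30; Ins 1 (-170) 576 230; Del 30;
  Ins 1 196 576 213; Del 30; Del 1; Del 0; Ins 6 (-579) 576 235; Del 28;
  Ins 1 76 576 253; Del 28; Del 1; Del 0; Ins 12 (-230) 576 1487; Del 26;
  Del 1; Del 0; Ins 4 (-40) 1171 (-53); Del 24; Del 23; Del 0;
  Ins 18 51 954 (-178); Del 22; Del 21; Del 0; Ins 8 (-32) 448 (-95); Del 20;
  Ins 2 0 796 (-66); Del 20; Ins 1 0 1017 (-64); Del 20; Ins 2 22 1122 (-16);
  Del 20; Del 1; Del 0; Ins 14 116 787 139; Ins 0 0 924 (-64);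
  Ins 0 69 1089 (-109); Del 20; Ins 15 8 826 (-253); Del 20;
  Ins 17 (-213) 404 (-45); Del 20; Ins 9 (-237) 723 56; Del 20;
  Ins 7 (-126) 668 (-184); Del 20; Ins 19 75 622 67; Del 20;
  Ins 11 (-39) 212 48; Del 20; Ins 5 (-37) 698 186; Del 20; Ins 11 98 540 153;
  Del 20; Ins 17 (-36) 622 83; Del 20; Del 5; Del 0; Ins 12 41 1089 (-136);
  Ins 0 0 640 (-64); Ins 2 (-67) 782 (-88); Del 20; Ins 7 (-17) 924 (-107);
  Del 20; Del 19; Del 0; Ins 14 (-80) 544 (-60); Del 18;
  Ins 7 (-92) 768 (-38); Del 18; Ins 17 (-64) 448 (-63); Del 18;
  Ins 11 (-200) 640 37; Del 18; Ins 14 0 352 (-64); Del 18;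
  Ins 2 (-24) 400 (-65); Del 18; Ins 8 0 384 (-64); Del 18;
  Ins 0 (-173) 736 (-97); Del 18; Ins 8 0 576 (-64); Del 18;
  Ins 15 0 704 (-64); Del 18; Ins 11 0 896 (-64); Del 18; Ins 5 0 1088 (-64);
  Del 18; Ins 12 (-40) 164 72; Del 18; Ins 5 220 544 (-339); Del 18;
  Ins 9 92 512 (-36); Del 18; Ins 11 (-23) 640 (-157); Del 18;
  Ins 15 5 212 54; Del 18; Ins 13 9 301 (-265); Del 18; Ins 9 (-2) 672 (-65);
  Del 1; Ins 17 0 448 (-64); Del 1; Ins 13 (-245) 468 (-43);
  Ins 0 0 960 (-64); Ins 19 31 768 27; Del 1; Ins 19 89 768 (-100); Del 1;
  Ins 13 141 314 71; Del 1; Ins 3 (-21) 448 (-4); Del 1; Ins 7 (-6) 400 (-59);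
  Del 1; Ins 19 (-17) 212 53; Del 1; Del 18; Del 0; Ins 2 (-280) 576 (-206);
  Ins 0 0 1203 (-64); Ins 5 (-97) 506 (-339); Del 1; Ins 4 61 109 (-150);
  Ins 0 0 (-102) (-64); Ins 1 25 109 39; Del 1; Ins 16 2 154 (-65); Del 1;
  Ins 21 0 (-76) (-64); Del 1; Ins 15 (-14) 1018 (-156); Ins 0 0 832 (-64);
  Ins 23 (-63) 640 8; Del 1; Ins 1 67 1018 (-128); Del 1;
  Ins 2 (-40) 70 (-110); Ins 0 0 (-51) (-64); Ins 1 51 70 (-97); Del 1;
  Ins 25 25 70 (-9); Del 1; Ins 5 25 (-6) (-40); Del 1; Ins 15 67 1017 (-128);
  Del 1; Ins 7 (-12) 1158 (-97); Del 1; Ins 3 6 979 (-201); Del 1;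
  Ins 9 5 211 54; Del 1; Ins 23 (-54) 1068 (-59); Del 1; Ins 16 160 384 (-64);
  Ins 0 0 64 (-64); Ins 5 98 109 (-25); Del 1; Ins 20 (-215) 576 (-309);
  Ins 0 0 1228 (-64); Ins 29 14 1158 (-96); Del 1; Ins 8 (-112) 576 (-384);
  Ins 0 0 1254 (-64); Ins 10 (-299) 576 (-90); Ins 0 0 1177 (-64);
  Ins 21 384 640 0; Del 1; Ins 9 512 640 0; Del 1; Ins 0 256 896 0;
  Ins 26 512 1152 0; Del 1; Ins 18 384 1024 0; Del 1; Ins 0 256 1152 0;
  Ins 8 384 1152 0; Del 1; Ins 9 512 (-128) (-128); Del 1;
  Ins 27 384 (-128) (-128); Del 1; Ins 27 256 (-128) (-128); Del 1;
  Ins 22 384 768 0; Ins 5 128 (-128) (-128); Del 1; Ins 36 128 1280 (-128);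
  Ins 10 256 1280 (-128); Ins 9 384 1280 (-128); Ins 9 512 1280 (-128);
  Ins 39 512 1024 0; Ins 0 512 896 0; Ins 0 512 768 0; Ins 25 384 896 0;
  Ins 18 512 512 0; Ins 0 512 384 0; Ins 0 512 256 0; Ins 0 512 128 0;
  Ins 14 384 256 0; Del 1; Ins 48 384 128 0; Ins 0 512 0 0; Ins 35 384 0 0;
  Del 1; Ins 41 256 128 0; Del 1; Ins 50 256 0 0; Ins 41 192 192 64; Del 1;
  Ins 0 384 384 0; Ins 0 320 320 64; Ins 0 256 256 0; Ins 54 128 128 0;
  Ins 0 128 0 0; Ins 46 320 448 64; Del 1; Ins 0 384 512 0; Ins 57 256 384 0;
  Ins 20 256 768 0; Del 1; Ins 58 256 640 0; Ins 0 256 512 0;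
  Ins 14 192 960 64; Del 1; Ins 0 256 1024 0; Ins 61 128 896 0;
  Ins 0 128 768 0; Ins 0 128 640 0; Ins 0 128 512 0; Ins 0 128 384 0;
  Ins 0 128 256 0; Ins 42 128 1152 0; Del 1; Ins 67 128 1024 0; Del 56;
  Del 52; Del 50; Del 48; Del 45; Del 49; Del 47; Del 45;
  Ins 29 320 1088 (-64); Del 1; Del 28; Ins 14 320 832 (-64); Del 1;
  Ins 27 448 704 (-64); Del 1; Ins 13 448 576 (-64); Del 1; Del 13; Del 41;
  Del 28; Ins 13 448 64 (-64); Del 1].

Definition k9_44_augmentation := of_rows
  [:: [:: 1; 1; 0; 0]; [:: 2; 1; 0; 2]; [:: 1; 0; 1; 2]; [:: 0; 0; 1; 1]].

Definition k9_44_order : seq (nat * nat) := [::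
  (4, 1); (1, 3); (1, 4); (4, 2); (1, 2); (4, 3); (3, 4); (3, 1); (3, 2);
  (2, 4); (2, 3); (2, 1)].

Definition k9_44_partner : knot_braid :=
  @KnotBraid 4 [:: -3; 1; 2; 2; -3; -3; -2; 1; -2]%Z isT.

Lemma k9_44_nonsimple (R : realType) :
  transversely_nonsimple (braid_closure R k9_44).
Proof.
apply: (@nonsimple R k9_44 k9_44_partner k9_44_moves 27); first by vm_compute.
  by rewrite /self_linking /writhe !big_cons !big_nil.
apply: (@not_isotopic 3 2 2 _ _ k9_44_augmentation 5 k9_44_order);
  [by []|by vm_compute..].
Qed.

Definition k9_48_moves : seq move := [::
  Ins 51 0 64 (-64); Del 67; Ins 35 0 192 (-64); Ins 37 0 320 (-64);
  Ins 2 0 448 (-64); Ins 18 0 576 (-64); Del 70; Ins 37 0 704 (-64);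
  Ins 39 0 832 (-64); Del 71; Ins 18 0 960 (-64); Ins 2 0 1088 (-64);
  Ins 40 0 1216 (-64); Ins 39 0 1344 (-64); Del 74; Ins 39 0 1433 (-64);
  Ins 55 0 1459 (-64); Ins 59 0 1484 (-64); Ins 57 0 1510 (-64);
  Ins 63 0 (-25) (-64); Ins 58 0 (-51) (-64); Ins 62 0 (-76) (-64);
  Ins 60 0 (-102) (-64); Del 64; Del 0; Del 0; Del 0; Ins 1 (-150) 275 (-51);
  Del 78; Ins 57 (-26) 6 (-52); Del 78; Del 16; Ins 1 (-39) 1324 (-26);
  Del 77; Del 33; Del 1; Ins 0 (-29) 1216 (-7); Del 75; Del 34; Del 0; Del 0;
  Del 0; Del 0; Del 1; Ins 0 (-24) 832 126; Del 69; Ins 34 7 1024 (-33);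
  Del 69; Del 17; Del 0; Del 1; Del 0; Del 0; Del 0; Ins 0 99 1081 97; Del 63;
  Ins 51 27 1414 (-42); Del 63; Del 35; Del 1; Ins 0 60 704 (-43); Del 61;
  Del 31; Del 0; Del 0; Del 0; Del 1; Ins 14 30 384 (-75); Del 56; Del 25;
  Del 1; Del 0; Del 0; Del 0; Del 38; Del 0; Del 0; Del 0; Del 30; Del 21;
  Del 42; Del 13; Del 7; Del 13; Ins 1 (-363) 704 (-96); Del 41;
  Ins 29 (-344) 704 (-220); Del 41; Ins 35 (-281) 704 (-334); Del 41;
  Ins 29 (-181) 704 (-424); Del 41; Ins 3 (-9) 45 (-137); Del 41;
  Ins 38 89 1171 (-208); Del 41; Del 26; Ins 1 14 192 (-127); Del 40;
  Ins 33 290 477 (-32); Del 40; Del 29; Ins 0 149 576 (-185); Del 39; Del 10;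
  Ins 1 195 314 (-64); Del 38; Del 30; Del 36; Del 32; Del 0; Del 19; Del 32;
  Del 6; Del 0; Del 21; Del 28; Del 6; Del 0; Ins 14 (-1409) 704 1284; Del 26;
  Ins 1 258 704 229; Del 26; Del 25; Del 0; Ins 16 (-21) 1171 (-232); Del 24;
  Del 1; Del 0; Ins 0 (-158) 512 (-37); Del 22; Del 13; Del 0;
  Ins 14 324 634 82; Del 20; Ins 1 350 634 (-4); Del 20; Del 1; Del 0;
  Ins 4 (-32) 954 (-315); Ins 0 0 960 (-64); Ins 0 (-111) 1210 (-8); Del 20;
  Ins 17 158 1024 (-37); Del 20; Ins 3 99 1082 97; Del 20;
  Ins 15 174 640 (-205); Del 20; Ins 15 (-115) 896 47; Del 20;
  Ins 17 (-16) 704 (-191); Del 20; Ins 11 (-270) 640 (-264); Del 20; Del 19;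
  Del 0; Ins 8 (-102) 1210 8; Ins 0 0 640 (-64); Ins 2 (-12) 800 (-26);
  Del 20; Ins 11 (-11) 960 (-49); Del 20; Del 1; Del 0; Ins 11 0 (-76) (-64);
  Del 18; Ins 5 0 (-51) (-64); Del 18; Ins 6 (-6) 1235 (-201); Del 18;
  Ins 5 (-79) 1260 (-28); Del 18; Ins 5 (-128) 960 (-53); Del 18;
  Ins 16 0 (-25) (-64); Del 18; Ins 10 11 6 (-91); Del 18;
  Ins 7 174 640 (-205); Del 18; Ins 9 227 378 (-64); Del 18; Ins 15 96 339 91;
  Del 18; Ins 11 20 768 30; Del 18; Ins 4 0 192 (-64); Del 18;
  Ins 15 0 576 (-64); Del 18; Ins 11 0 704 (-64); Del 18; Ins 5 0 832 (-64);
  Del 18; Ins 2 (-70) 1145 76; Del 18; Ins 6 0 960 (-64); Del 18;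
  Ins 5 0 1088 (-64); Del 18; Ins 16 (-181) 704 (-424); Ins 0 0 1510 (-64);
  Ins 19 72 1235 (-181); Del 1; Ins 10 (-281) 704 (-334); Ins 0 0 1484 (-64);
  Ins 0 0 1344 (-64); Ins 1 (-4) 1414 (-29); Ins 19 (-353) 704 29;
  Ins 0 0 1433 (-64); Ins 1 (-363) 704 (-96); Del 1; Ins 12 (-544) 704 459;
  Ins 0 0 1459 (-64); Ins 1 (-344) 704 (-220); Del 1; Ins 2 14 192 (-127);
  Ins 0 0 64 (-64); Ins 29 22 6 (-46); Del 1; Ins 18 0 1216 (-64);
  Ins 1 (-23) 1280 (-42); Ins 15 0 448 (-64); Ins 1 30 512 (-53);
  Ins 33 0 320 (-64); Ins 1 30 384 (-75); Ins 9 (-9) 45 (-137);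
  Ins 0 0 (-102) (-64); Ins 19 320 448 64; Del 1; Ins 21 448 320 64; Del 1;
  Ins 23 512 256 0; Del 1; Ins 37 448 192 64; Ins 13 512 128 0; Del 1;
  Ins 34 512 1408 0; Del 1; Ins 1 512 (-128) (-128); Del 1;
  Ins 17 384 (-128) (-128); Del 1; Ins 5 256 (-128) (-128); Del 1;
  Ins 22 128 (-128) (-128); Del 1; Ins 38 128 1536 (-128);
  Ins 17 256 1536 (-128); Ins 35 384 1536 (-128); Ins 23 512 1536 (-128);
  Ins 3 512 0 0; Ins 30 384 128 0; Ins 10 512 1280 0; Ins 0 512 1152 0;
  Ins 0 512 1024 0; Ins 12 384 1024 0; Ins 0 512 896 0; Ins 0 512 768 0;
  Ins 0 512 640 0; Ins 0 512 512 0; Ins 0 512 384 0; Ins 53 384 256 0;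
  Ins 38 384 384 0; Del 1; Ins 42 384 768 0; Ins 0 384 640 0; Ins 0 384 512 0;
  Ins 57 256 384 0; Ins 0 256 256 0; Ins 0 256 128 0; Ins 0 384 0 0;
  Ins 22 256 512 0; Del 1; Ins 53 256 0 0; Del 1; Ins 36 192 576 64; Del 1;
  Ins 0 256 640 0; Ins 62 128 512 0; Ins 0 128 384 0; Ins 0 128 256 0;
  Ins 0 128 128 0; Ins 0 128 0 0; Ins 41 192 704 64; Del 1; Ins 0 384 896 0;
  Ins 0 320 832 64; Ins 0 256 768 0; Ins 70 128 640 0; Ins 43 384 1408 0;
  Del 1; Ins 13 320 1088 64; Del 1; Ins 0 256 1408 0; Ins 0 384 1280 0;
  Ins 0 384 1152 0; Ins 74 256 1024 0; Ins 0 256 896 0; Ins 61 256 1280 0;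
  Del 1; Ins 61 128 1408 0; Del 1; Ins 76 128 1280 0; Ins 0 256 1152 0;
  Ins 15 128 1152 0; Del 1; Ins 78 128 1024 0; Ins 0 128 896 0;
  Ins 0 128 768 0; Del 54; Del 38; Del 18; Del 41; Del 57; Del 36; Del 17;
  Del 39; Ins 16 320 1344 (-64); Del 1; Ins 71 192 1216 (-64); Del 1; Del 55;
  Ins 55 448 960 (-64); Del 1; Del 48; Del 53; Del 35; Del 68; Del 67; Del 16;
  Ins 47 320 64 (-64); Del 1].

Definition k9_48_augmentation := of_rows
  [:: [:: 1; 2; 1; 1]; [:: 0; 1; 1; 2]; [:: 1; 1; 1; 1]; [:: 1; 2; 0; 1]].

Definition k9_48_order : seq (nat * nat) := [::
  (1, 3); (4, 3); (4, 1); (3, 1); (3, 4); (1, 4); (1, 2); (4, 2); (3, 2);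
  (2, 4); (2, 1); (2, 3)].

(** A negative flype: the letter [-1] and the block [1 1] exchange their places around [2 -3 2]. *)
Definition k9_48_partner : knot_braid :=
  @KnotBraid 4 [:: -2; 3; 3; 2; 1; 1; 2; -3; 2; -1; -2]%Z isT.

Lemma k9_48_nonsimple (R : realType) :
  transversely_nonsimple (braid_closure R k9_48).
Proof.
apply: (@nonsimple R k9_48 k9_48_partner k9_48_moves 33); first by vm_compute.
  by rewrite /self_linking /writhe !big_cons !big_nil.
apply: (@not_isotopic 3 2 2 _ _ k9_48_augmentation 5 k9_48_order);
  [by []|by vm_compute..].
Qed.

Definition m10_132_moves : seq move := [::
  Ins 50 0 64 (-64); Ins 53 0 192 (-64); Del 68; Ins 20 0 320 (-64); Del 68;
  Ins 35 0 448 (-64); Ins 38 0 576 (-64); Ins 2 0 704 (-64);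
  Ins 54 0 832 (-64); Del 71; Ins 37 0 960 (-64); Del 71; Ins 20 0 1088 (-64);
  Ins 2 0 1216 (-64); Ins 40 0 1344 (-64); Ins 2 0 1433 (-64);
  Ins 37 0 1459 (-64); Ins 56 0 1484 (-64); Ins 39 0 1510 (-64);
  Ins 25 0 (-25) (-64); Ins 39 0 (-51) (-64); Ins 59 0 (-76) (-64);
  Ins 41 0 (-102) (-64); Del 24; Del 0; Del 0; Del 0; Del 0; Del 0; Del 0;
  Ins 1 (-245) 467 (-43); Del 75; Del 33; Ins 1 (-55) 70 (-39); Del 74;
  Del 20; Ins 1 (-46) 192 (-20); Del 73; Ins 16 (-10) 1388 (-44); Del 73;
  Del 31; Del 1; Ins 0 (-8) 1337 (-4); Del 71; Del 33; Del 0; Del 0; Del 0;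
  Del 1; Ins 0 34 1024 92; Del 66; Ins 32 17 1152 (-37); Del 66; Del 44;
  Del 1; Del 0; Del 0; Ins 0 102 1222 18; Del 62; Del 27; Del 0; Del 0; Del 0;
  Del 1; Ins 0 151 512 (-11); Del 57; Ins 20 32 640 (-64); Del 57; Del 22;
  Del 1; Del 0; Del 0; Del 0; Del 12; Del 0; Del 0; Del 0; Del 9; Del 19;
  Del 1; Del 0; Del 17; Del 22; Del 11; Del 23; Ins 1 (-363) 704 (-96);
  Del 40; Ins 18 (-344) 704 (-220); Del 40; Ins 30 (-281) 704 (-334); Del 40;
  Ins 20 (-181) 704 (-424); Del 40; Ins 3 (-5) (-19) (-105); Del 40;
  Ins 37 132 1171 (-170); Del 40; Del 25; Ins 1 28 186 (-192); Del 39; Del 22;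
  Ins 1 34 448 (-118); Del 38; Ins 19 151 768 (-117); Del 38; Del 29; Del 0;
  Del 29; Del 34; Del 3; Del 32; Del 24; Del 0; Del 17; Del 28;
  Ins 20 (-70) 1196 (-159); Del 28; Del 13; Del 0; Ins 8 56 192 (-33); Del 26;
  Del 17; Del 0; Ins 18 (-304) 704 181; Del 24; Ins 1 307 704 434; Del 24;
  Del 23; Del 0; Ins 10 (-21) 1171 (-232); Del 22; Del 1; Del 0;
  Ins 10 233 442 49; Del 20; Ins 1 252 442 (-6); Del 20; Ins 1 259 442 (-64);
  Del 20; Ins 2 2 90 (-65); Del 20; Ins 1 0 256 (-64); Del 20;
  Ins 2 (-14) 352 (-61); Del 20; Ins 1 9 352 (-52); Del 20;
  Ins 15 39 1068 114; Del 20; Ins 7 29 352 (-25); Del 20; Ins 5 (-32) 704 190;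
  Del 20; Ins 5 (-24) 448 (-254); Del 20; Ins 15 181 832 (-128); Del 20;
  Ins 11 50 512 (-146); Del 20; Ins 6 176 608 (-64); Del 1;
  Ins 14 (-93) 512 (-88); Del 20; Ins 1 4 512 32; Del 20; Del 1; Del 0;
  Ins 9 0 1401 (-64); Del 18; Ins 13 0 1318 (-64); Del 18;
  Ins 0 (-30) 1401 (-35); Del 18; Ins 0 0 1484 (-64); Del 18;
  Ins 13 0 1152 (-64); Del 18; Ins 16 (-92) 736 86; Del 18;
  Ins 9 (-57) 1094 123; Del 18; Ins 15 (-526) 608 74; Del 18;
  Ins 12 0 896 (-64); Del 18; Ins 11 0 704 (-64); Del 18;
  Ins 10 (-292) 596 (-168); Del 18; Ins 16 0 448 (-64); Del 18;
  Ins 0 (-187) 966 (-244); Del 18; Ins 8 0 384 (-64); Del 18;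
  Ins 2 (-30) 672 (-302); Del 18; Ins 4 0 320 (-64); Del 18;
  Ins 2 50 512 (-146); Del 18; Ins 9 181 832 (-128); Del 18;
  Ins 3 (-910) 688 (-626); Ins 0 0 (-25) (-64); Ins 1 322 688 (-218); Del 1;
  Ins 19 (-35) 532 212; Del 1; Ins 0 (-1) 1244 (-62); Del 1;
  Ins 19 0 1088 (-64); Del 1; Ins 0 (-284) 518 (-40); Del 1; Del 9; Del 0;
  Ins 9 (-2) 288 (-65); Del 1; Ins 17 0 192 (-64); Del 1;
  Ins 0 126 672 (-268); Del 1; Ins 17 339 672 (-184); Del 1;
  Ins 17 151 512 (-11); Del 1; Ins 10 0 1056 (-66); Del 1;
  Ins 17 0 1216 (-64); Del 1; Ins 0 (-309) 596 (-90); Del 1;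
  Ins 17 (-1529) 596 200; Del 1; Ins 17 (-282) 596 64; Del 1;
  Ins 8 (-60) 192 (-43); Ins 0 0 64 (-64); Ins 1 34 192 (-10); Del 1;
  Ins 17 (-186) 448 (-113); Del 1; Ins 18 1 992 (-66); Del 1;
  Ins 19 0 832 (-64); Del 1; Ins 17 0 128 (-64); Ins 1 13 70 (-5);
  Ins 21 (-1) 73 (-62); Del 1; Ins 21 0 19 (-64); Del 1; Ins 21 1 (-16) (-66);
  Del 1; Ins 21 0 (-51) (-64); Del 1; Ins 10 (-19) 832 (-3); Del 1;
  Ins 19 34 448 (-118); Del 1; Ins 3 (-281) 704 (-334); Del 1;
  Ins 5 (-35) 531 212; Del 1; Ins 19 (-49) 1324 (-42); Del 1;
  Ins 3 (-275) 518 (-136); Del 1; Ins 21 (-77) 1274 (-116); Del 1;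
  Ins 12 (-59) 1222 53; Ins 0 0 960 (-64); Ins 23 50 832 (-24); Del 1;
  Ins 12 (-344) 704 (-220); Ins 0 0 1459 (-64); Ins 25 50 1216 (-104); Del 1;
  Ins 0 0 1344 (-64); Ins 1 (-21) 1401 (-44); Ins 23 (-363) 704 (-96);
  Ins 0 0 1433 (-64); Ins 5 (-64) 1216 (-58); Del 1; Ins 20 28 186 (-192);
  Ins 0 0 (-76) (-64); Ins 21 (-21) 1171 (-232); Del 1;
  Ins 0 (-181) 704 (-424); Ins 0 0 1510 (-64); Ins 33 132 1171 (-170); Del 1;
  Ins 2 (-5) (-19) (-105); Ins 0 0 (-102) (-64); Ins 6 0 576 (-64);
  Ins 1 32 640 (-64); Ins 10 448 576 64; Del 1; Ins 25 512 512 0; Del 1;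
  Ins 37 448 448 64; Ins 11 512 384 0; Del 1; Ins 38 448 64 64;
  Ins 21 512 1408 0; Del 1; Ins 3 512 0 0; Del 1; Ins 37 512 (-128) (-128);
  Del 1; Ins 14 384 (-128) (-128); Del 1; Ins 16 256 (-128) (-128); Del 1;
  Ins 31 128 (-128) (-128); Del 1; Ins 39 128 1536 (-128);
  Ins 9 256 1536 (-128); Ins 24 384 1536 (-128); Ins 28 512 1536 (-128);
  Ins 20 512 256 0; Ins 0 512 128 0; Ins 45 384 0 0; Ins 35 384 384 0;
  Ins 39 512 1280 0; Ins 0 512 1152 0; Ins 0 512 1024 0; Ins 0 512 896 0;
  Ins 33 384 1152 0; Ins 0 384 1024 0; Ins 0 384 896 0; Ins 0 512 768 0;
  Ins 0 512 640 0; Ins 56 384 512 0; Ins 43 384 640 0; Del 1;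
  Ins 38 320 704 64; Del 1; Ins 0 384 768 0; Ins 58 256 640 0;
  Ins 0 256 512 0; Ins 0 256 384 0; Ins 0 384 256 0; Ins 26 256 896 0; Del 1;
  Ins 62 256 768 0; Ins 56 256 256 0; Del 1; Ins 63 384 128 0;
  Ins 45 256 128 0; Del 1; Ins 64 256 0 0; Ins 57 192 960 64; Del 1;
  Ins 0 256 1024 0; Ins 66 128 896 0; Ins 0 128 768 0; Ins 0 128 640 0;
  Ins 0 128 512 0; Ins 0 128 384 0; Ins 0 128 256 0; Ins 0 128 128 0;
  Ins 0 128 0 0; Ins 51 192 1088 64; Del 1; Ins 0 384 1408 0;
  Ins 0 384 1280 0; Ins 0 320 1216 64; Ins 0 256 1152 0; Ins 78 128 1024 0;
  Ins 42 256 1408 0; Del 1; Ins 61 128 1408 0; Del 1; Ins 79 256 1280 0;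
  Ins 17 128 1280 0; Del 1; Ins 80 128 1152 0; Del 26; Del 23; Del 38; Del 60;
  Del 33; Del 22; Del 36; Del 57; Ins 15 192 1344 (-64); Del 1; Del 55;
  Del 14; Del 36; Ins 50 448 832 (-64); Del 1; Del 17; Del 68; Del 16;
  Ins 48 320 320 (-64); Del 1; Ins 48 320 192 (-64); Del 1; Del 15].

Definition m10_132_augmentation := of_rows
  [:: [:: 1; 1; 1; 0]; [:: 2; 1; 1; 1]; [:: 2; 0; 1; 1]; [:: 0; 2; 2; 1]].

Definition m10_132_order : seq (nat * nat) := [::
  (1, 3); (1, 4); (2, 3); (2, 4); (3, 4); (3, 2); (4, 2); (4, 3); (3, 1);
  (1, 2); (4, 1); (2, 1)].

(** A negative flype: the final block [-1 2 1 1] becomes [1 1 2 -1]. *)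
Definition m10_132_partner : knot_braid :=
  @KnotBraid 4 [:: 3; -2; -2; 3; 3; 2; -3; 1; 1; 2; -1]%Z isT.

Lemma m10_132_nonsimple (R : realType) :
  transversely_nonsimple (braid_closure R m10_132).
Proof.
apply: (@nonsimple R m10_132 m10_132_partner m10_132_moves 34); first by vm_compute.
  by rewrite /self_linking /writhe !big_cons !big_nil.
apply: not_isotopic_sym.
apply: (@not_isotopic 3 2 1 _ _ m10_132_augmentation 0 m10_132_order);
  [by []|by vm_compute..].
Qed.

Definition k10_136_moves : seq move := [::
  Ins 1 0 64 (-64); Del 67; Ins 19 0 192 (-64); Ins 35 0 320 (-64); Del 68;
  Ins 20 0 448 (-64); Ins 36 0 576 (-64); Ins 20 0 704 (-64);
  Ins 20 0 832 (-64); Del 71; Ins 55 0 960 (-64); Ins 38 0 1088 (-64); Del 72;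
  Ins 3 0 1216 (-64); Del 72; Ins 18 0 1344 (-64); Ins 21 0 1433 (-64);
  Ins 55 0 1459 (-64); Ins 40 0 1484 (-64); Ins 19 0 1510 (-64);
  Ins 41 0 (-25) (-64); Ins 58 0 (-51) (-64); Ins 42 0 (-76) (-64);
  Ins 20 0 (-102) (-64); Ins 42 (-22) 19 (-62); Del 81; Del 60; Del 0;
  Ins 1 (-84) 134 (-26); Del 79; Del 11; Del 0; Del 0; Ins 1 (-85) 1196 18;
  Del 76; Del 29; Del 0; Del 0; Del 0; Del 0; Del 0; Del 1;
  Ins 0 (-101) 640 136; Del 69; Del 52; Del 0; Ins 1 (-12) 640 31; Del 67;
  Del 52; Ins 1 14 832 (-1); Del 66; Ins 54 15 1401 (-40); Del 66; Del 29;
  Del 0; Del 0; Del 0; Del 1; Ins 0 127 1158 38; Del 61; Ins 11 30 1152 (-53);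
  Del 61; Del 14; Del 1; Del 0; Del 0; Del 0; Del 0; Del 42; Del 20; Del 1;
  Del 0; Del 11; Del 1; Del 9; Del 11; Del 0; Del 0; Del 0; Del 41; Del 32;
  Del 18; Del 11; Ins 1 (-363) 704 (-96); Del 40; Ins 30 (-344) 704 (-220);
  Del 40; Ins 23 (-281) 704 (-334); Del 40; Ins 11 (-181) 704 (-424); Del 40;
  Ins 39 69 1363 (-88); Del 40; Ins 5 (-21) 237 (-232); Del 40;
  Ins 31 14 58 (-129); Del 40; Del 31; Ins 1 50 256 (-146); Del 39; Del 28;
  Ins 1 75 512 (-124); Del 38; Ins 31 192 960 (-64); Del 38; Del 35; Del 0;
  Del 31; Del 34; Del 21; Del 32; Ins 24 (-55) 134 11; Del 32; Del 7; Del 0;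
  Del 19; Del 28; Ins 26 154 1043 (-239); Del 28; Del 21; Del 0;
  Ins 10 (-249) 704 220; Del 26; Del 1; Del 0; Ins 18 53 1363 (-115); Del 24;
  Del 1; Del 0; Ins 14 (-12) 640 (-159); Del 22; Del 21; Del 0;
  Ins 16 (-44) 832 (-18); Del 20; Del 1; Del 0; Ins 6 (-41) 838 (-384);
  Ins 0 0 768 (-64); Ins 0 (-121) 1126 68; Del 20; Ins 7 116 896 (-175);
  Del 20; Ins 3 221 1018 (-64); Del 20; Ins 17 (-115) 704 165; Del 20;
  Ins 13 101 448 (-227); Del 20; Ins 15 (-188) 890 150; Del 20;
  Ins 13 (-18) 480 (-207); Del 20; Ins 13 (-111) 384 52; Del 20;
  Ins 3 (-547) 448 (-244); Del 20; Del 19; Del 0; Ins 12 208 1018 (-137);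
  Ins 0 0 736 (-64); Ins 0 (-27) 656 (-35); Del 20; Ins 7 (-54) 512 16;
  Del 20; Del 19; Del 0; Ins 16 264 1107 83; Del 18; Ins 6 0 1088 (-64);
  Del 18; Ins 10 67 1350 (-64); Del 18; Ins 12 0 1574 (-64); Del 18;
  Ins 0 67 1260 (-10); Del 18; Ins 6 0 (-51) (-64); Del 18;
  Ins 9 0 1510 (-64); Del 18; Ins 2 (-77) 1043 24; Del 18;
  Ins 9 91 1152 (-96); Del 18; Ins 3 (-27) 70 (-10); Del 18;
  Ins 16 0 960 (-64); Del 18; Ins 7 0 64 (-64); Del 18; Ins 7 0 576 (-64);
  Del 18; Ins 2 14 704 (-127); Del 18; Ins 14 0 704 (-64); Del 18;
  Ins 0 (-20) 384 (-223); Del 18; Ins 11 (-302) 704 141; Del 18;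
  Ins 1 (-128) 704 (-53); Ins 0 0 448 (-64); Ins 13 (-770) 704 174; Del 1;
  Ins 4 0 1503 (-62); Del 1; Ins 19 0 1433 (-64); Del 1; Ins 5 499 704 (-630);
  Ins 0 0 1459 (-64); Ins 1 (-344) 704 (-220); Del 1; Ins 20 28 1402 (-69);
  Ins 0 0 1344 (-64); Ins 1 27 1401 (-54); Del 1; Ins 6 34 (-6) (-58);
  Ins 0 0 (-76) (-64); Ins 1 29 (-6) (-44); Del 1; Ins 6 (-92) 109 (-12);
  Ins 0 0 (-102) (-64); Ins 27 (-181) 704 (-424); Del 1;
  Ins 20 1922 704 (-393); Ins 0 0 1484 (-64); Ins 1 (-281) 704 (-334); Del 1;
  Ins 26 134 704 154; Ins 0 0 192 (-64); Ins 7 (-4) (-6) (-29); Del 1;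
  Ins 8 (-58) 448 (-38); Ins 0 0 320 (-64); Ins 33 22 109 39; Del 1;
  Ins 4 50 960 (-104); Ins 0 0 832 (-64); Ins 27 106 1107 (-236); Del 1;
  Ins 14 (-85) 211 18; Ins 0 0 (-25) (-64); Ins 37 (-363) 704 (-96); Del 1;
  Ins 17 (-74) 704 (-286); Del 1; Ins 37 (-46) 75 (-293); Del 1;
  Ins 37 (-11) 1085 (-301); Del 1; Ins 7 (-50) 30 (-217); Del 1;
  Ins 37 (-47) 1410 (-545); Del 1; Ins 35 97 1107 (-136); Del 1;
  Ins 37 224 1000 (-80); Del 1; Ins 1 441 (-54) (-152); Del 1;
  Ins 35 278 967 (-96); Del 1; Ins 1 512 (-128) (-128); Del 1;
  Ins 29 19 1127 (-297); Del 1; Ins 25 54 1055 (-83); Del 1;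
  Ins 3 (-59) 704 (-437); Del 1; Ins 7 384 (-128) (-128); Del 1;
  Ins 25 93 1090 (-87); Del 1; Ins 3 256 (-128) (-128); Del 1;
  Ins 33 95 1029 (-78); Del 1; Ins 37 96 1152 (-73); Del 1;
  Ins 17 293 952 (-77); Del 1; Ins 7 16 704 (-139); Del 1;
  Ins 37 222 713 (-26); Ins 29 49 384 (-105); Del 1; Ins 16 243 807 (-428);
  Del 1; Ins 21 337 556 (-74); Del 1; Ins 10 (-7) 740 (-105); Del 1;
  Ins 5 128 (-128) (-128); Del 1; Ins 15 261 1363 53; Del 1;
  Ins 15 448 704 64; Del 1; Ins 30 374 883 11; Del 1; Ins 36 372 570 (-63);
  Del 1; Ins 32 320 1344 64; Del 1; Ins 28 115 1152 (-68); Del 1;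
  Ins 15 512 640 0; Del 1; Ins 1 405 865 40; Del 1; Ins 8 512 768 0; Del 1;
  Ins 29 448 832 64; Del 1; Ins 20 384 1280 0; Del 1; Ins 18 512 1408 0;
  Ins 21 320 1088 64; Ins 35 128 1536 (-128); Ins 12 256 1536 (-128);
  Ins 9 384 1536 (-128); Ins 10 512 1536 (-128); Ins 40 512 512 0;
  Ins 0 512 384 0; Ins 0 512 256 0; Ins 0 512 128 0; Ins 16 384 640 0;
  Ins 41 512 1280 0; Ins 0 512 1152 0; Ins 0 512 1024 0; Ins 0 512 896 0;
  Ins 53 384 768 0; Ins 19 384 1024 0; Del 1; Ins 54 384 896 0;
  Ins 13 384 1152 0; Ins 56 256 1024 0; Ins 15 384 1408 0; Ins 58 256 1280 0;
  Ins 51 256 1408 0; Del 1; Ins 45 128 1408 0; Del 1; Ins 59 128 1280 0;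
  Ins 0 256 1152 0; Ins 23 128 1152 0; Del 1; Ins 61 128 1024 0;
  Ins 0 256 896 0; Ins 0 256 768 0; Ins 0 256 640 0; Ins 0 384 512 0;
  Ins 0 384 384 0; Ins 0 384 256 0; Ins 35 256 256 0; Del 1; Ins 68 384 128 0;
  Ins 0 512 0 0; Ins 52 384 0 0; Del 1; Ins 52 256 128 0; Del 1;
  Ins 70 256 0 0; Ins 58 192 320 64; Del 1; Ins 0 256 384 0; Ins 72 128 256 0;
  Ins 0 128 128 0; Ins 0 128 0 0; Ins 60 192 448 64; Del 1; Ins 0 256 512 0;
  Ins 76 128 384 0; Ins 24 128 896 0; Del 1; Ins 77 128 768 0;
  Ins 0 128 640 0; Ins 0 128 512 0; Del 52; Del 61; Del 60; Del 57; Del 53;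
  Del 58; Del 57; Del 54; Del 17; Ins 14 192 1216 (-64); Del 1; Del 36;
  Ins 15 192 960 (-64); Del 1; Del 52; Del 49; Ins 16 320 576 (-64); Del 1;
  Del 15; Del 48; Ins 33 320 192 (-64); Del 1; Ins 15 448 64 (-64); Del 1].

Definition k10_136_augmentation := of_rows
  [:: [:: 1; 0; 2; 0]; [:: 2; 1; 2; 1]; [:: 1; 0; 1; 2]; [:: 1; 2; 2; 1]].

Definition k10_136_order : seq (nat * nat) := [::
  (1, 3); (1, 2); (2, 3); (2, 1); (3, 1); (4, 1); (4, 3); (2, 4); (4, 2);
  (1, 4); (3, 4); (3, 2)].

Definition k10_136_partner : knot_braid :=
  @KnotBraid 4 [:: -3; -2; 1; 1; -2; 3; 3; -1; 2; -1; 2]%Z isT.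

Lemma k10_136_nonsimple (R : realType) :
  transversely_nonsimple (braid_closure R k10_136).
Proof.
apply: (@nonsimple R k10_136 k10_136_partner k10_136_moves 32); first by vm_compute.
  by rewrite /self_linking /writhe !big_cons !big_nil.
apply: (@not_isotopic 3 2 2 _ _ k10_136_augmentation 9 k10_136_order);
  [by []|by vm_compute..].
Qed.

Definition m10_140_moves : seq move := [::
  Ins 33 0 64 (-64); Ins 37 0 192 (-64); Ins 37 0 320 (-64); Del 69;
  Ins 19 0 448 (-64); Ins 54 0 576 (-64); Ins 21 0 704 (-64); Del 71;
  Ins 55 0 832 (-64); Del 71; Ins 39 0 960 (-64); Del 71; Ins 17 0 1088 (-64);
  Ins 58 0 1216 (-64); Ins 39 0 1344 (-64); Ins 18 0 1433 (-64);
  Ins 37 0 1459 (-64); Ins 23 0 1484 (-64); Ins 39 0 1510 (-64);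
  Ins 59 0 (-25) (-64); Ins 39 0 (-51) (-64); Ins 24 0 (-76) (-64);
  Ins 41 0 (-102) (-64); Del 47; Ins 1 (-64) 576 (-58); Del 81; Del 61;
  Ins 1 (-58) 704 (-38); Del 80; Del 21; Del 0; Del 0; Del 0; Del 0;
  Ins 1 (-131) 1068 62; Del 75; Del 38; Del 0; Ins 1 (-42) 1273 19; Del 73;
  Ins 24 (-4) 1414 (-29); Del 73; Del 33; Del 1; Ins 0 16 1363 8; Del 71;
  Del 31; Del 0; Del 1; Del 0; Del 0; Ins 0 67 1088 45; Del 66; Del 23; Del 0;
  Del 1; Del 0; Del 0; Del 0; Del 0; Ins 0 149 576 57; Del 59; Del 27; Del 1;
  Ins 0 60 192 (-43); Del 57; Del 26; Ins 29 27 6 (-74); Del 56; Del 16;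
  Del 0; Del 42; Ins 1 34 448 (-118); Del 53; Del 34; Del 0; Del 0; Del 0;
  Del 0; Del 0; Del 0; Del 38; Ins 1 (-8) 1088 (-127); Del 45; Del 4; Del 22;
  Del 28; Del 23; Del 2; Ins 1 54 83 (-64); Del 40; Del 31; Del 18;
  Ins 27 (-95) 1412 (-261); Del 38; Ins 33 240 365 (-21); Del 38;
  Ins 7 (-363) 704 (-96); Del 38; Ins 17 75 1017 (-278); Del 38;
  Ins 1 (-344) 704 (-220); Del 38; Ins 15 (-281) 704 (-334); Del 38;
  Ins 19 (-181) 704 (-424); Del 38; Ins 3 63 493 (-355); Del 38;
  Ins 21 102 186 (-146); Del 38; Ins 7 (-302) 704 141; Del 38; Del 37; Del 0;
  Ins 6 (-62) 1088 (-48); Del 36; Del 5; Del 0; Ins 4 (-336) 704 392; Del 34;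
  Del 33; Del 0; Del 11; Del 30; Ins 16 (-69) 1363 (-39); Del 30; Del 29;
  Del 0; Ins 2 92 1299 (-115); Del 28; Ins 9 (-60) 448 (-85); Del 28; Del 7;
  Del 0; Ins 16 (-13) 6 (-90); Del 26; Ins 1 (-24) 6 (-48); Del 26;
  Ins 11 (-187) 966 (-244); Del 26; Ins 11 (-133) 1235 (-29); Del 26;
  Ins 15 86 1158 75; Del 26; Ins 9 54 84 (-64); Del 26; Ins 25 (-131) 340 62;
  Del 26; Ins 11 (-128) 518 190; Del 26; Ins 17 8 340 118; Del 26; Del 11;
  Del 0; Ins 16 (-5) 84 (-118); Del 24; Ins 1 (-53) 84 (-55); Del 24;
  Ins 11 (-54) 192 (-98); Del 24; Del 1; Del 0; Ins 2 (-13) 704 (-1); Del 22;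
  Ins 9 120 340 73; Del 22; Del 15; Del 0; Ins 9 (-1) 352 (-62); Del 20;
  Ins 1 0 512 (-64); Del 20; Ins 2 69 736 (-152); Del 20;
  Ins 1 (-89) 736 (-133); Del 20; Ins 3 (-113) 1235 (-142); Del 20; Del 19;
  Del 0; Ins 11 0 128 (-64); Del 18; Ins 11 0 1216 (-64); Del 18;
  Ins 12 39 340 114; Del 18; Ins 7 199 704 97; Del 18; Ins 8 0 1344 (-64);
  Del 18; Ins 11 0 1408 (-64); Del 18; Ins 10 61 1152 (-36); Del 18;
  Ins 8 0 192 (-64); Del 18; Ins 2 211 640 11; Del 18; Ins 7 64 192 (-64);
  Del 18; Ins 7 (-34) 288 (-136); Del 18; Ins 5 (-38) 84 (-103); Del 18;
  Ins 7 (-60) 1338 (-74); Del 18; Ins 5 (-58) 704 (-38); Del 18;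
  Ins 3 182 544 37; Ins 0 0 960 (-64); Ins 19 (-5) 1427 (-105); Del 1;
  Ins 1 69 1222 47; Del 1; Del 8; Del 0; Ins 12 (-36) 576 (-117);
  Ins 0 0 448 (-64); Ins 1 (-52) 576 (-101); Del 1; Ins 19 (-19) 576 (-69);
  Del 1; Ins 19 (-64) 576 (-58); Del 1; Ins 17 (-1) 288 (-144); Del 1;
  Ins 19 33 288 (-137); Del 1; Ins 19 61 288 (-116); Del 1;
  Ins 19 23 288 (-70); Del 1; Ins 19 129 186 (-42); Del 1; Ins 18 2 26 (-63);
  Del 1; Ins 19 0 (-76) (-64); Del 1; Ins 13 14 448 (-127); Ins 0 0 320 (-64);
  Ins 9 69 186 (-175); Del 1; Ins 5 51 83 (-82); Del 1; Ins 10 (-16) 1088 63;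
  Ins 0 0 832 (-64); Ins 11 (-131) 1068 62; Del 1; Ins 6 (-344) 704 (-220);
  Ins 0 0 1459 (-64); Ins 25 (-27) 1337 (-10); Del 1; Ins 20 (-302) 704 141;
  Ins 0 0 1433 (-64); Ins 1 (-363) 704 (-96); Del 1; Ins 20 83 704 317;
  Ins 0 0 1484 (-64); Ins 1 (-681) 704 316; Del 1; Ins 29 (-281) 704 (-334);
  Del 1; Ins 16 (-24) 6 (-80); Ins 0 0 (-51) (-64); Ins 1 22 6 (-82); Del 1;
  Ins 10 (-181) 704 (-424); Ins 0 0 1510 (-64); Ins 33 32 1427 (-38); Del 1;
  Ins 18 0 1088 (-64); Ins 1 7 1152 (-33); Ins 19 (-33) 429 (-327);
  Ins 0 0 (-102) (-64); Ins 27 77 192 (-60); Del 1; Ins 37 192 192 64;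
  Ins 27 256 128 0; Del 1; Ins 38 192 64 64; Ins 11 256 0 0; Del 1;
  Ins 20 384 256 0; Del 1; Ins 33 512 896 0; Del 1; Ins 37 512 (-128) (-128);
  Del 1; Ins 5 384 (-128) (-128); Del 1; Ins 18 256 (-128) (-128); Del 1;
  Ins 28 (-189) 704 (-458); Del 1; Ins 39 128 (-128) (-128); Del 1;
  Ins 15 256 256 0; Del 1; Ins 18 256 384 0; Ins 6 128 1536 (-128);
  Ins 12 256 1536 (-128); Ins 22 384 1536 (-128); Ins 38 512 1536 (-128);
  Ins 3 512 768 0; Ins 0 512 640 0; Ins 0 512 512 0; Ins 0 512 384 0;
  Ins 0 512 256 0; Ins 0 512 128 0; Ins 0 512 0 0; Ins 41 384 512 0; Del 1;
  Ins 51 384 384 0; Ins 26 384 128 0; Ins 0 384 0 0; Ins 12 128 0 0;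
  Ins 15 128 128 0; Ins 46 192 448 64; Del 1; Ins 0 512 1024 0;
  Ins 0 448 960 64; Ins 0 384 896 0; Ins 0 384 768 0; Ins 0 384 640 0;
  Ins 0 320 576 64; Ins 0 256 512 0; Ins 63 128 384 0; Ins 0 128 256 0;
  Ins 31 512 1408 0; Del 1; Ins 13 448 1088 64; Del 1; Ins 0 384 1408 0;
  Ins 0 512 1280 0; Ins 0 512 1152 0; Ins 68 384 1024 0; Ins 36 384 1152 0;
  Del 1; Ins 17 320 1216 64; Del 1; Ins 0 384 1280 0; Ins 70 256 1152 0;
  Ins 0 256 1024 0; Ins 0 256 896 0; Ins 58 256 1408 0; Del 1;
  Ins 73 256 1280 0; Ins 53 128 1408 0; Del 1; Ins 74 128 1280 0;
  Ins 0 128 1152 0; Ins 0 128 1024 0; Ins 0 128 896 0; Ins 0 256 768 0;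
  Ins 42 128 768 0; Del 1; Ins 79 256 640 0; Ins 37 128 640 0; Del 1;
  Ins 80 128 512 0; Del 58; Del 17; Del 40; Del 56; Del 41; Del 16; Del 38;
  Del 53; Ins 40 448 1344 (-64); Del 1; Del 51; Del 71; Del 34;
  Ins 53 192 832 (-64); Del 1; Ins 31 192 704 (-64); Del 1; Del 35; Del 31;
  Ins 35 320 320 (-64); Del 1; Del 47; Del 16].

Definition m10_140_augmentation := of_rows
  [:: [:: 1; 3; 3; 4]; [:: 4; 1; 0; 2]; [:: 0; 3; 1; 2]; [:: 3; 0; 1; 1]].

Definition m10_140_order : seq (nat * nat) := [::
  (2, 4); (1, 3); (4, 2); (2, 3); (3, 2); (4, 3); (3, 1); (2, 1); (4, 1);
  (1, 2); (1, 4); (3, 4)].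

(** A negative flype: the final block [-3 2 3 3] becomes [3 3 2 -3]. *)
Definition m10_140_partner : knot_braid :=
  @KnotBraid 4 [:: 1; 1; -2; 1; 2; -1; -1; 3; 3; 2; -3]%Z isT.

Lemma m10_140_nonsimple (R : realType) :
  transversely_nonsimple (braid_closure R m10_140).
Proof.
apply: (@nonsimple R m10_140 m10_140_partner m10_140_moves 49); first by vm_compute.
  by rewrite /self_linking /writhe !big_cons !big_nil.
apply: not_isotopic_sym.
(* This is the one pair that is separated over F_5. *)
apply: (@not_isotopic 5 2 1 _ _ m10_140_augmentation 8 m10_140_order);
  [by []|by vm_compute..].
Qed.

Definition m10_145_moves : seq move := [::
  Ins 69 0 64 (-64); Del 87; Ins 54 0 192 (-64); Ins 38 0 320 (-64);
  Ins 2 0 448 (-64); Ins 20 0 576 (-64); Del 90; Ins 54 0 704 (-64);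
  Ins 2 0 832 (-64); Ins 75 0 960 (-64); Ins 2 0 1088 (-64);
  Ins 43 0 1216 (-64); Ins 2 0 1344 (-64); Ins 21 0 1472 (-64); Del 96;
  Ins 79 0 1557 (-64); Ins 74 0 1578 (-64); Ins 79 0 1600 (-64);
  Ins 79 0 1621 (-64); Ins 85 0 1642 (-64); Ins 84 0 (-21) (-64);
  Ins 78 0 (-42) (-64); Ins 83 0 (-64) (-64); Ins 83 0 (-85) (-64);
  Ins 89 0 (-106) (-64); Del 86; Del 0; Del 0; Del 0; Ins 1 (-149) 277 (-51);
  Del 102; Ins 78 (-25) 11 (-54); Del 102; Del 19; Ins 1 (-42) 1450 (-31);
  Del 101; Del 71; Del 0; Del 0; Del 0; Del 1; Del 0; Ins 0 (-107) 1205 89;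
  Del 95; Ins 23 (-10) 1280 (-34); Del 95; Del 54; Del 1; Del 0; Del 0;
  Ins 0 (-4) 1344 64; Del 91; Del 28; Del 0; Del 0; Del 1; Del 0; Del 0;
  Del 0; Ins 0 50 832 121; Del 84; Ins 70 17 768 (-37); Del 84;
  Ins 70 24 1024 (-43); Del 84; Del 41; Del 1; Del 0; Del 0; Del 0; Del 0;
  Del 0; Del 0; Ins 0 203 1024 31; Del 76; Del 42; Del 0; Del 0; Del 0; Del 1;
  Del 0; Ins 15 32 384 (-69); Del 70; Del 40; Del 1; Del 0; Del 0; Del 0;
  Del 0; Del 19; Del 40; Del 45; Del 0; Del 0; Del 0; Del 0; Del 0; Del 0;
  Del 0; Del 0; Del 0; Del 0; Del 48; Del 5; Del 10; Del 8; Del 15;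
  Ins 1 (-393) 768 (-98); Del 46; Ins 32 (-376) 768 (-214); Del 46;
  Ins 39 (-326) 768 (-322); Del 46; Ins 37 (-245) 768 (-413); Del 46;
  Ins 42 (-137) 768 (-479); Del 46; Ins 45 (-1) 1557 (-106); Del 46; Del 5;
  Ins 0 112 757 (-481); Del 45; Ins 5 36 53 (-123); Del 45; Del 20;
  Ins 1 48 192 (-107); Del 44; Ins 27 174 576 (-145); Del 44;
  Ins 9 190 320 (-36); Del 44; Del 12; Del 42; Del 25; Del 40; Del 19; Del 38;
  Del 4; Del 0; Del 27; Del 34; Del 29; Del 32; Del 10; Del 0; Del 4; Del 0;
  Del 0; Del 0; Del 0; Del 0; Del 0; Del 0; Ins 12 (-260) 821 211; Del 22;
  Del 21; Del 0; Ins 16 538 768 (-2073); Del 20; Ins 1 412 768 (-124); Del 20;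
  Del 1; Del 0; Ins 3 0 (-64) (-64); Del 18; Ins 2 50 256 (-299); Del 18;
  Ins 5 (-260) 779 253; Del 18; Ins 6 0 (-53) (-64); Del 18;
  Ins 2 143 614 (-365); Del 18; Ins 17 (-3) 198 (-189); Del 18;
  Ins 12 0 (-48) (-64); Del 18; Ins 14 264 816 (-231); Del 18;
  Ins 11 105 203 (-128); Del 18; Ins 0 0 (-42) (-64); Del 18;
  Ins 11 0 192 (-64); Del 18; Ins 15 0 320 (-64); Del 18;
  Ins 10 530 776 (-381); Del 18; Ins 2 0 384 (-64); Del 18;
  Ins 14 55 64 (-96); Del 18; Ins 10 0 448 (-64); Del 18;
  Ins 6 321 1066 (-254); Del 18; Ins 2 0 1440 (-64); Del 18;
  Ins 0 0 1813 (-64); Ins 1 (-93) 1626 (-72); Ins 9 1 992 (-62); Del 1;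
  Ins 19 0 1600 (-64); Del 1; Ins 7 198 800 (-199); Ins 0 0 1280 (-64);
  Ins 3 294 1066 166; Del 1; Ins 9 202 1088 (-222); Del 1; Ins 20 1 264 (-66);
  Del 1; Ins 21 0 576 (-64); Del 1; Ins 20 (-159) 256 (-43); Del 1;
  Ins 11 128 1589 (-151); Del 1; Ins 19 89 864 (-252); Del 1;
  Ins 19 (-5) 864 (-272); Del 1; Del 0; Del 0; Ins 2 956 1109 (-762);
  Ins 0 0 1898 (-64); Ins 1 (-349) 1109 (-248); Del 1; Ins 1 151 704 54;
  Del 1; Ins 11 (-37) 1717 (-19); Del 1; Ins 17 (-32) 0 (-60); Del 1;
  Ins 17 110 1701 (-134); Del 1; Ins 5 126 896 (-163); Del 1;
  Ins 13 (-457) 896 (-104); Del 1; Ins 13 (-8) 619 (-394); Del 1;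
  Ins 10 370 1077 (-307); Ins 0 0 1962 (-64); Ins 1 305 1077 (-1356); Del 1;
  Ins 23 (-222) 1077 (-447); Del 1; Ins 23 (-424) 1077 (-189); Del 1;
  Ins 9 112 331 (-213); Del 1; Ins 13 (-311) 896 (-443); Del 1; Del 10; Del 0;
  Ins 9 227 1418 (-34); Del 1; Ins 20 0 1200 (-62); Del 1; Ins 21 0 960 (-64);
  Del 1; Ins 16 (-205) 896 (-521); Del 1; Ins 16 45 779 344;
  Ins 0 0 (-128) (-64); Ins 14 (-1) 1919 (-62); Del 1; Ins 23 0 1877 (-64);
  Del 1; Del 9; Del 0; Ins 3 275 1301 (-180); Del 1; Ins 20 2 992 (-65);
  Del 1; Ins 21 0 704 (-64); Del 1; Ins 12 7 64 0; Del 1;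
  Ins 2 (-90) 256 (-31); Ins 0 0 64 (-64); Ins 23 12 0 (-94); Del 1;
  Ins 6 (-573) 896 344; Ins 0 0 1834 (-64); Ins 1 (-440) 896 (-226); Del 1;
  Ins 15 (-52) 64 (-27); Del 1; Ins 24 (-36) 54 (-123); Ins 0 0 (-85) (-64);
  Ins 1 8 53 (-133); Del 1; Ins 20 (-65) 1408 82; Ins 0 0 1088 (-64);
  Ins 11 46 1024 349; Del 1; Ins 0 (-74) 896 410; Ins 0 0 1856 (-64);
  Ins 1 (-664) 896 215; Del 1; Ins 31 (-391) 896 (-342); Del 1;
  Ins 4 0 448 (-64); Ins 1 19 512 (-38); Ins 19 0 832 (-64);
  Ins 1 12 896 (-34); Ins 35 (-212) 405 (-45); Ins 0 0 (-21) (-64);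
  Ins 36 0 1728 (-64); Ins 1 (-17) 1770 (-52); Ins 25 0 1216 (-64);
  Ins 1 32 1280 (-68); Ins 1 0 1344 (-64); Ins 1 29 1408 (-52);
  Ins 1 0 1472 (-64); Ins 1 (-5) 1536 (-32); Ins 11 (-17) 107 (-169);
  Ins 0 0 (-106) (-64); Ins 45 576 1216 64; Del 1; Ins 33 640 1152 0; Del 1;
  Ins 47 576 704 64; Ins 13 640 640 0; Del 1; Ins 48 320 64 64;
  Ins 31 384 0 0; Del 1; Ins 43 512 128 0; Del 1; Ins 31 640 256 0; Del 1;
  Ins 47 640 (-128) (-128); Del 1; Ins 17 512 (-128) (-128); Del 1;
  Ins 5 384 (-128) (-128); Del 1; Ins 18 256 (-128) (-128); Del 1;
  Ins 16 128 (-128) (-128); Del 1; Ins 49 128 1920 (-128);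
  Ins 34 256 1920 (-128); Ins 33 384 1920 (-128); Ins 47 512 1920 (-128);
  Ins 35 640 1920 (-128); Ins 3 640 128 0; Ins 0 640 0 0; Ins 22 512 0 0;
  Ins 29 640 512 0; Ins 0 640 384 0; Ins 0 576 320 64; Ins 0 512 256 0;
  Ins 0 448 192 64; Ins 0 384 128 0; Ins 63 256 0 0; Ins 52 640 1024 0;
  Ins 0 640 896 0; Ins 0 640 768 0; Ins 67 512 640 0; Ins 29 640 1792 0;
  Ins 0 640 1664 0; Ins 0 640 1536 0; Ins 0 640 1408 0; Ins 0 640 1280 0;
  Ins 73 512 1152 0; Ins 0 512 1024 0; Ins 0 512 896 0; Ins 0 512 768 0;
  Ins 57 512 1280 0; Del 1; Ins 51 448 1344 64; Del 1; Ins 0 512 1792 0;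
  Ins 0 512 1664 0; Ins 0 512 1536 0; Ins 0 512 1408 0; Ins 81 384 1280 0;
  Ins 0 384 1152 0; Ins 0 384 1024 0; Ins 35 384 1408 0; Del 1;
  Ins 36 256 1024 0; Del 1; Ins 84 384 896 0; Ins 0 384 768 0;
  Ins 0 384 640 0; Ins 0 512 512 0; Ins 0 512 384 0; Ins 42 384 512 0; Del 1;
  Ins 63 256 896 0; Del 1; Ins 16 192 1088 64; Del 1; Ins 0 384 1792 0;
  Ins 0 384 1664 0; Ins 0 384 1536 0; Ins 0 320 1472 64; Ins 0 256 1408 0;
  Ins 0 256 1280 0; Ins 0 256 1152 0; Ins 96 128 1024 0; Ins 0 128 896 0;
  Ins 0 256 768 0; Ins 0 256 640 0; Ins 0 256 512 0; Ins 0 384 384 0;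
  Ins 0 384 256 0; Ins 36 256 1536 0; Del 1; Ins 41 192 1600 64; Del 1;
  Ins 0 256 1664 0; Ins 104 128 1536 0; Ins 0 128 1408 0; Ins 0 128 1280 0;
  Ins 0 128 1152 0; Ins 69 192 1728 64; Del 1; Ins 0 256 1792 0;
  Ins 109 128 1664 0; Ins 49 128 1792 0; Del 1; Ins 44 256 384 0; Del 1;
  Ins 110 256 256 0; Ins 0 256 128 0; Ins 73 128 768 0; Del 1;
  Ins 112 128 640 0; Ins 0 128 512 0; Ins 0 128 384 0; Ins 0 128 256 0;
  Ins 0 128 128 0; Ins 0 128 0 0; Del 95; Del 44; Del 21; Del 27; Del 45;
  Del 89; Del 42; Del 20; Del 26; Del 43; Del 107; Del 63; Del 105; Del 104;
  Del 103; Del 40; Ins 18 320 960 (-64); Del 1; Ins 100 192 832 (-64); Del 1;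
  Del 63; Ins 78 448 576 (-64); Del 1; Ins 99 320 448 (-64); Del 1; Del 40;
  Del 37; Del 18].

Definition m10_145_augmentation := of_rows
  [:: [:: 1; 1; 0; 1; 0]; [:: 2; 1; 1; 1; 2]; [:: 0; 2; 1; 1; 1];
      [:: 1; 2; 1; 1; 1]; [:: 0; 1; 0; 1; 1]].

(** No branching occurs: the given word is a word in B_4 followed by [-4], and the row equation at
    (4, 4) reads 0 = 1 - mu whatever the unknown entries are. *)
Definition m10_145_order : seq (nat * nat) := [::].

Definition m10_145_partner : knot_braid :=
  @KnotBraid 5 [:: 2; 3; 4; -2; -3; 4; -1; -2; 1; 4; 3; 2; 1; 1]%Z isT.

Lemma m10_145_nonsimple (R : realType) :
  transversely_nonsimple (braid_closure R m10_145).
Proof.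
apply: (@nonsimple R m10_145 m10_145_partner m10_145_moves 60); first by vm_compute.
  by rewrite /self_linking /writhe !big_cons !big_nil.
apply: not_isotopic_sym.
apply: (@not_isotopic 3 2 1 _ _ m10_145_augmentation 0 m10_145_order);
  [by []|by vm_compute..].
Qed.

Definition m10_161_moves : seq move := [::
  Ins 1 0 64 (-64); Del 67; Ins 52 0 192 (-64); Ins 2 0 320 (-64);
  Ins 36 0 448 (-64); Ins 38 0 576 (-64); Ins 19 0 704 (-64);
  Ins 21 0 832 (-64); Ins 2 0 960 (-64); Ins 38 0 1088 (-64);
  Ins 20 0 1216 (-64); Ins 25 0 1344 (-64); Del 76; Ins 36 0 1433 (-64);
  Ins 20 0 1459 (-64); Ins 38 0 1484 (-64); Ins 65 0 1510 (-64);
  Ins 39 0 (-25) (-64); Ins 21 0 (-51) (-64); Ins 40 0 (-76) (-64);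
  Ins 68 0 (-102) (-64); Ins 40 (-22) 19 (-62); Del 84; Del 77; Del 0;
  Ins 1 (-79) 1260 (-28); Del 82; Del 20; Ins 1 (-44) 1337 (-22); Del 81;
  Del 19; Del 1; Del 0; Del 0; Ins 0 (-43) 1152 22; Del 77; Del 32; Del 0;
  Del 0; Del 1; Ins 0 (-16) 832 63; Del 73; Ins 40 7 896 (-33); Del 73;
  Del 50; Del 1; Del 0; Del 0; Ins 0 67 960 45; Del 69; Del 13; Del 1; Del 0;
  Del 0; Ins 0 75 640 (-4); Del 65; Del 32; Del 1; Ins 0 60 448 (-43); Del 63;
  Del 25; Del 0; Del 0; Ins 34 30 256 (-75); Del 60; Del 13; Del 1; Del 0;
  Del 0; Del 39; Del 39; Del 0; Del 0; Del 0; Del 0; Del 0; Del 0; Del 0;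
  Del 0; Del 0; Del 42; Del 5; Del 24; Del 30; Ins 1 (-363) 704 (-96); Del 41;
  Ins 12 (-344) 704 (-220); Del 41; Ins 19 (-281) 704 (-334); Del 41;
  Ins 37 (-181) 704 (-424); Del 41; Ins 40 (-5) 1427 (-105); Del 41; Del 5;
  Ins 0 84 691 (-452); Del 40; Ins 5 35 58 (-121); Del 40; Del 14;
  Ins 1 125 384 (-164); Del 39; Del 8; Ins 1 125 198 (-64); Del 38; Del 4;
  Del 36; Del 23; Del 34; Del 16; Del 0; Del 7; Del 30; Del 6; Del 0; Del 16;
  Del 0; Del 0; Del 0; Del 0; Del 0; Ins 14 (-312) 704 148; Del 22; Del 21;
  Del 0; Ins 9 0 192 (-64); Del 20; Ins 0 (-201) 892 (-351); Del 20;
  Ins 8 0 70 (-64); Del 20; Ins 0 (-141) 384 (-238); Del 20;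
  Ins 14 0 1593 (-64); Del 20; Ins 12 165 988 150; Del 20; Ins 7 79 512 (-9);
  Del 20; Ins 17 (-367) 739 (-211); Del 20; Ins 17 4 288 (-240); Del 20;
  Ins 2 0 640 (-64); Del 20; Ins 7 0 320 (-64); Del 20; Ins 0 56 134 (-138);
  Del 20; Ins 9 79 384 (-119); Del 20; Ins 17 (-194) 314 (-47); Del 20;
  Ins 14 0 1529 (-64); Del 20; Ins 7 0 704 (-64); Del 20; Ins 9 0 832 (-64);
  Del 20; Ins 0 (-59) 704 (-40); Del 20; Ins 3 (-1) 3 (-66); Del 1;
  Ins 19 0 (-64) (-64); Del 1; Ins 0 126 288 (-187); Del 1;
  Ins 19 128 192 (-64); Del 1; Ins 0 2 544 (-63); Del 1; Ins 19 0 448 (-64);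
  Del 1; Ins 9 (-2026) 758 432; Ins 0 0 (-76) (-64); Ins 1 (-214) 758 (-422);
  Del 1; Ins 17 210 832 83; Del 1; Ins 3 (-133) 442 (-286); Del 1;
  Ins 11 76 1466 35; Del 1; Ins 19 1600 576 (-64); Del 1;
  Ins 13 (-38) 58 (-119); Del 1; Del 20; Del 0; Ins 16 35 1024 (-31);
  Ins 0 0 1344 (-64); Ins 1 (-41) 1024 91; Del 1; Ins 12 2 832 (-63); Del 1;
  Ins 21 0 1216 (-64); Del 1; Ins 13 (-21) 576 (-255); Ins 0 0 960 (-64);
  Ins 9 (-123) 576 (-359); Del 1; Ins 2 0 1715 (-64); Ins 1 (-31) 1622 (-29);
  Ins 12 (-167) 442 (-262); Del 1; Ins 23 (-191) 1088 (-47); Del 1;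
  Ins 17 (-410) 832 (-228); Del 1; Ins 11 (-22) 1363 (-264); Del 1;
  Ins 9 58 1408 12; Del 1; Ins 9 (-22) 1516 19; Del 1;
  Ins 13 (-37) 1024 (-153); Del 1; Ins 15 (-23) (-6) (-91); Del 1;
  Ins 7 (-60) 1024 (-139); Del 1; Ins 21 52 320 (-101); Del 1;
  Ins 4 (-1) (-102) (-66); Del 1; Ins 25 0 (-140) (-64); Del 1; Del 25; Del 0;
  Del 3; Del 0; Ins 11 (-148) 512 (-232); Ins 0 0 64 (-64);
  Ins 23 12 (-6) (-97); Del 1; Ins 13 (-265) 832 (-417); Del 1;
  Ins 14 (-251) 832 (-458); Ins 0 0 1766 (-64); Ins 25 202 1363 (-64); Del 1;
  Ins 7 61 960 (-83); Del 1; Ins 12 (-348) 832 (-356); Ins 0 0 1740 (-64);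
  Ins 19 (-408) 832 (-233); Del 1; Ins 18 3 45 (-137); Ins 0 0 (-102) (-64);
  Ins 25 (-58) 512 (-280); Del 1; Ins 24 (-65) 1606 (-48); Ins 0 0 1472 (-64);
  Ins 1 23 1606 (-1); Del 1; Ins 20 0 1600 (-64); Ins 1 1 1657 (-35);
  Ins 9 (-366) 832 158; Ins 0 0 1689 (-64); Ins 2 (-140) 339 53;
  Ins 0 0 (-25) (-64); Ins 37 (-427) 832 (-101); Del 1; Ins 24 0 1088 (-64);
  Ins 1 31 1152 (-54); Ins 35 0 448 (-64); Ins 1 (-17) 512 (-37);
  Ins 34 448 1088 64; Del 1; Ins 5 320 320 64; Del 1; Ins 5 512 1024 0; Del 1;
  Ins 41 448 960 64; Ins 11 384 256 0; Del 1; Ins 42 320 192 64;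
  Ins 25 384 128 0; Del 1; Ins 37 512 896 0; Del 1; Ins 3 512 (-128) (-128);
  Del 1; Ins 1 512 0 0; Ins 37 384 0 0; Del 1; Ins 42 384 (-128) (-128);
  Del 1; Ins 27 256 (-128) (-128); Del 1; Ins 8 128 (-128) (-128); Del 1;
  Ins 44 128 1792 (-128); Ins 37 256 1792 (-128); Ins 19 384 1792 (-128);
  Ins 9 512 1792 (-128); Ins 45 512 768 0; Ins 0 512 640 0; Ins 0 512 512 0;
  Ins 0 512 384 0; Ins 0 512 256 0; Ins 0 512 128 0; Ins 34 256 128 0;
  Ins 0 256 0 0; Ins 40 384 384 0; Ins 57 256 256 0; Ins 8 384 896 0;
  Ins 45 512 1664 0; Ins 0 512 1536 0; Ins 0 512 1408 0; Ins 0 512 1280 0;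
  Ins 0 512 1152 0; Ins 64 384 1024 0; Ins 26 384 1152 0; Del 1;
  Ins 13 320 448 64; Del 1; Ins 0 384 1280 0; Ins 0 320 1216 64;
  Ins 0 256 1152 0; Ins 0 256 1024 0; Ins 0 256 896 0; Ins 0 384 768 0;
  Ins 0 384 640 0; Ins 0 384 512 0; Ins 73 256 384 0; Ins 63 320 1344 64;
  Del 1; Ins 0 384 1536 0; Ins 0 384 1408 0; Ins 76 256 1280 0;
  Ins 35 320 1600 64; Del 1; Ins 0 384 1664 0; Ins 78 256 1536 0;
  Ins 50 256 1664 0; Del 1; Ins 20 128 1664 0; Del 1; Ins 79 128 1536 0;
  Ins 0 256 1408 0; Ins 46 256 512 0; Del 1; Ins 42 192 576 64; Del 1;
  Ins 0 256 640 0; Ins 82 128 512 0; Ins 0 128 384 0; Ins 0 128 256 0;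
  Ins 0 128 128 0; Ins 0 128 0 0; Ins 47 192 704 64; Del 1; Ins 0 256 768 0;
  Ins 88 128 640 0; Ins 51 128 1408 0; Del 1; Ins 89 128 1280 0;
  Ins 0 128 1152 0; Ins 0 128 1024 0; Ins 0 128 896 0; Ins 0 128 768 0;
  Del 34; Del 73; Del 48; Del 22; Del 38; Del 70; Del 46; Del 21; Del 64;
  Ins 38 192 1472 (-64); Del 1; Del 65; Del 62; Del 82; Del 57;
  Ins 21 320 832 (-64); Del 1; Del 38; Del 38; Del 78; Del 20; Del 54;
  Ins 58 448 64 (-64); Del 1].

Definition m10_161_augmentation := of_rows
  [:: [:: 1; 1; 1; 2]; [:: 1; 1; 1; 2]; [:: 0; 2; 1; 1]; [:: 2; 0; 2; 1]].

(** The given word is a word in B_3 followed by [-3], a negative stabilization, so the row equation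
    at (3, 3) already fails. *)
Definition m10_161_order : seq (nat * nat) := [::].

Definition m10_161_partner : knot_braid :=
  @KnotBraid 4 [:: -3; 2; 2; 2; 1; 1; -2; 3; 3; 2; 2; -1; 2]%Z isT.

Lemma m10_161_nonsimple (R : realType) :
  transversely_nonsimple (braid_closure R m10_161).
Proof.
apply: (@nonsimple R m10_161 m10_161_partner m10_161_moves 57); first by vm_compute.
  by rewrite /self_linking /writhe !big_cons !big_nil.
apply: not_isotopic_sym.
apply: (@not_isotopic 3 2 1 _ _ m10_161_augmentation 0 m10_161_order);
  [by []|by vm_compute..].
Qed.

Definition k12n_591_moves : seq move := [::
  Ins 38 0 64 (-64); Ins 2 0 192 (-64); Ins 44 0 320 (-64); Ins 2 0 448 (-64);
  Ins 22 0 576 (-64); Del 103; Ins 63 0 704 (-64); Ins 2 0 832 (-64);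
  Ins 2 0 960 (-64); Ins 85 0 1088 (-64); Ins 2 0 1216 (-64);
  Ins 2 0 1344 (-64); Ins 49 0 1472 (-64); Ins 2 0 1600 (-64);
  Ins 23 0 1728 (-64); Del 111; Ins 92 0 1813 (-64); Ins 64 0 1834 (-64);
  Ins 25 0 1856 (-64); Ins 64 0 1877 (-64); Ins 98 0 1898 (-64);
  Ins 97 0 (-21) (-64); Ins 67 0 (-42) (-64); Ins 26 0 (-64) (-64);
  Ins 67 0 (-85) (-64); Ins 102 0 (-106) (-64); Del 99; Del 0; Del 0; Del 0;
  Ins 1 (-149) 277 (-51); Del 117; Del 111; Ins 1 (-50) 1706 (-46); Del 116;
  Del 61; Del 0; Del 1; Del 0; Ins 0 (-100) 1589 7; Del 112;
  Ins 50 (-20) 1536 (-39); Del 112; Del 81; Del 0; Del 0; Del 1; Del 0; Del 0;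
  Del 0; Del 0; Ins 0 (-92) 1408 140; Del 104; Ins 85 (-5) 1280 (-32);
  Del 104; Del 32; Del 0; Del 0; Del 0; Del 1; Del 0; Del 0; Del 0; Del 0;
  Ins 0 28 960 190; Del 95; Ins 82 12 896 (-34); Del 95; Ins 76 19 1152 (-38);
  Del 95; Del 45; Del 0; Del 1; Del 0; Del 0; Del 0; Del 0; Del 0; Del 0;
  Del 0; Ins 0 227 1152 113; Del 85; Ins 59 29 768 (-52); Del 85; Del 57;
  Del 0; Del 1; Del 0; Del 0; Del 0; Del 0; Del 0; Ins 34 32 384 (-68);
  Del 77; Del 54; Del 0; Del 1; Del 0; Del 0; Del 0; Ins 58 25 128 (-84);
  Del 71; Del 25; Del 1; Del 0; Del 21; Del 0; Del 0; Del 0; Del 0; Del 0;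
  Del 0; Del 0; Del 0; Del 0; Del 0; Del 0; Del 0; Del 52; Del 5; Del 26;
  Del 40; Del 23; Ins 1 (-457) 896 (-104); Del 50; Ins 28 (-440) 896 (-226);
  Del 50; Ins 12 (-391) 896 (-342); Del 50; Ins 26 (-311) 896 (-443); Del 50;
  Ins 46 (-205) 896 (-521); Del 50; Ins 49 (-7) 1813 (-106); Del 50; Del 5;
  Ins 0 54 885 (-557); Del 49; Ins 5 14 (-11) (-99); Del 49;
  Ins 26 57 128 (-141); Del 49; Del 38; Ins 1 172 331 (-136); Del 48;
  Ins 39 222 640 (-34); Del 48; Del 31; Del 0; Del 37; Del 44; Del 21; Del 42;
  Del 28; Del 0; Del 15; Del 38; Del 28; Del 0; Del 17; Del 34; Del 18; Del 0;
  Del 0; Del 0; Del 13; Del 28; Del 21; Del 26; Del 15; Del 24; Del 6; Del 0;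
  Ins 18 202 1088 (-222); Del 22; Del 9; Del 0; Ins 16 (-384) 960 (-64);
  Del 20; Del 11; Del 0; Ins 13 0 (-85) (-64); Del 18;
  Ins 6 (-111) 2005 (-234); Del 18; Ins 10 0 (-64) (-64); Del 18;
  Ins 0 (-522) 1152 (-376); Del 18; Ins 9 (-21) 2069 105; Del 18;
  Ins 2 0 2410 (-64); Del 18; Ins 8 1403 1408 259; Del 18;
  Ins 5 382 704 (-107); Del 18; Ins 3 (-283) 950 369; Del 18;
  Ins 11 (-214) 1461 (-523); Del 18; Ins 17 184 2037 53; Del 18;
  Ins 13 171 566 (-341); Del 18; Ins 12 0 2368 (-64); Del 18;
  Ins 15 0 2176 (-64); Del 18; Ins 9 0 1984 (-64); Del 18; Ins 5 0 1728 (-64);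
  Del 18; Ins 9 0 1664 (-64); Del 18; Ins 15 0 1600 (-64); Del 18;
  Ins 4 1 1056 (-66); Del 1; Ins 17 0 448 (-64); Del 1; Ins 0 154 1408 391;
  Del 1; Ins 14 2 2325 (-65); Del 1; Ins 17 0 2474 (-64); Del 1;
  Ins 11 (-37) 1472 (-186); Ins 0 0 1216 (-64); Ins 16 108 1728 (-133);
  Ins 0 0 1472 (-64); Ins 15 149 1461 (-548); Del 1; Ins 13 (-92) 587 (-365);
  Del 1; Ins 7 85 1024 (-339); Del 1; Ins 7 58 726 (-433); Del 1;
  Ins 11 123 1024 (-325); Del 1; Del 0; Del 0; Ins 8 161 982 (-539);
  Ins 0 0 (-21) (-64); Ins 8 (-6) 843 (-506); Ins 0 0 (-42) (-64);
  Ins 23 (-299) 587 33; Del 1; Ins 15 (-296) 726 (-291); Del 1;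
  Ins 15 (-84) 1024 (-339); Del 1; Ins 17 (-2) 331 (-250); Del 1;
  Ins 15 79 470 (-296); Del 1; Ins 11 (-344) 1152 (-591); Del 1;
  Ins 3 133 1280 330; Del 1; Ins 21 (-143) 1429 (-533); Del 1;
  Ins 11 (-55) 2186 21; Del 1; Ins 1 154 501 (-314); Del 1;
  Ins 15 350 640 (-104); Del 1; Ins 9 (-269) 1781 23; Del 1; Del 6; Del 0;
  Ins 10 22 1408 (-287); Ins 0 0 960 (-64); Ins 23 112 405 118; Del 1;
  Ins 4 (-1474) 1152 1063; Ins 0 0 2389 (-64); Ins 1 (-446) 1152 (-493);
  Del 1; Ins 12 0 2240 (-64); Ins 1 (-23) 2304 (-42);
  Ins 19 (-568) 1152 (-248); Ins 0 0 2346 (-64); Ins 17 (-212) 1898 (-45);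
  Del 1; Ins 16 (-28) 1152 (-286); Ins 0 0 704 (-64); Ins 31 130 267 19;
  Del 1; Ins 18 0 832 (-64); Ins 1 30 896 (-75); Ins 31 (-584) 1152 (-115);
  Ins 0 0 2325 (-64); Ins 8 0 1856 (-64); Ins 1 3 1920 (-32);
  Ins 27 0 1344 (-64); Ins 1 (-27) 1408 (-48); Ins 31 (-15) (-21) (-104);
  Ins 0 0 (-106) (-64); Ins 30 0 1088 (-64); Ins 1 32 1152 (-60);
  Ins 15 0 64 (-64); Ins 1 22 128 (-87); Ins 1 0 320 (-64);
  Ins 1 22 384 (-41); Ins 47 0 192 (-64); Ins 1 30 256 (-53);
  Ins 39 0 576 (-64); Ins 1 27 640 (-81); Ins 17 0 2112 (-64);
  Ins 1 (-11) 2176 (-34); Ins 39 0 1600 (-64); Ins 1 10 1664 (-94);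
  Ins 22 448 192 64; Del 1; Ins 19 576 64 64; Del 1; Ins 19 640 0 0; Del 1;
  Ins 27 512 1536 0; Del 1; Ins 19 640 1536 0; Del 1; Ins 5 640 (-128) (-128);
  Del 1; Ins 35 512 (-128) (-128); Del 1; Ins 35 384 (-128) (-128); Del 1;
  Ins 27 256 (-128) (-128); Del 1; Ins 35 195 1152 (-357); Del 1;
  Ins 55 128 (-128) (-128); Del 1; Ins 55 128 2432 (-128);
  Ins 21 256 2432 (-128); Ins 29 384 2432 (-128); Ins 22 512 2432 (-128);
  Ins 22 640 2432 (-128); Ins 55 640 1408 0; Ins 0 640 1280 0;
  Ins 0 640 1152 0; Ins 0 640 1024 0; Ins 0 640 896 0; Ins 0 640 768 0;
  Ins 46 640 1792 0; Ins 0 640 1664 0; Ins 0 576 1600 64; Ins 69 512 1408 0;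
  Ins 0 512 1280 0; Ins 0 512 1152 0; Ins 0 512 1024 0; Ins 37 512 1664 0;
  Del 1; Ins 53 384 1024 0; Ins 0 512 896 0; Ins 0 512 768 0; Ins 0 640 640 0;
  Ins 0 640 512 0; Ins 0 640 384 0; Ins 0 640 256 0; Ins 0 640 128 0;
  Ins 81 512 0 0; Ins 39 512 128 0; Del 1; Ins 63 512 640 0; Del 1;
  Ins 44 384 896 0; Del 1; Ins 72 384 1280 0; Ins 0 384 1152 0;
  Ins 0 320 1088 64; Ins 0 256 1024 0; Ins 0 256 896 0; Ins 0 384 768 0;
  Ins 0 384 640 0; Ins 0 512 512 0; Ins 0 512 384 0; Ins 0 512 256 0;
  Ins 92 384 128 0; Ins 0 384 0 0; Ins 52 256 1152 0; Del 1; Ins 29 384 256 0;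
  Del 1; Ins 71 320 320 64; Del 1; Ins 0 384 512 0; Ins 0 384 384 0;
  Ins 96 256 256 0; Ins 0 256 128 0; Ins 0 256 0 0; Ins 30 256 384 0; Del 1;
  Ins 31 192 448 64; Del 1; Ins 0 256 768 0; Ins 0 256 640 0; Ins 0 256 512 0;
  Ins 102 128 384 0; Ins 0 128 256 0; Ins 0 128 128 0; Ins 0 128 0 0;
  Ins 77 192 1216 64; Del 1; Ins 0 640 2048 0; Ins 0 640 1920 0;
  Ins 0 576 1856 64; Ins 0 512 1792 0; Ins 0 448 1728 64; Ins 0 384 1664 0;
  Ins 0 384 1536 0; Ins 0 384 1408 0; Ins 0 320 1344 64; Ins 0 256 1280 0;
  Ins 116 128 1152 0; Ins 0 128 1024 0; Ins 0 128 896 0; Ins 0 128 768 0;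
  Ins 0 128 640 0; Ins 0 128 512 0; Ins 66 512 1920 0; Del 1;
  Ins 43 448 1984 64; Del 1; Ins 0 640 2304 0; Ins 0 640 2176 0;
  Ins 0 576 2112 64; Ins 0 512 2048 0; Ins 126 384 1920 0; Ins 0 384 1792 0;
  Ins 37 512 2176 0; Del 1; Ins 49 448 2240 64; Del 1; Ins 0 512 2304 0;
  Ins 129 384 2176 0; Ins 0 384 2048 0; Ins 84 384 2304 0; Del 1;
  Ins 18 256 1408 0; Del 1; Ins 49 192 1472 64; Del 1; Ins 0 256 2304 0;
  Ins 0 256 2176 0; Ins 0 256 2048 0; Ins 0 256 1920 0; Ins 0 256 1792 0;
  Ins 0 256 1664 0; Ins 0 256 1536 0; Ins 138 128 1408 0; Ins 0 128 1280 0;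
  Ins 93 128 2304 0; Del 1; Ins 140 128 2176 0; Ins 0 128 2048 0;
  Ins 0 128 1920 0; Ins 0 128 1792 0; Ins 0 128 1664 0; Ins 0 128 1536 0;
  Del 97; Del 89; Del 88; Del 82; Del 87; Del 81; Del 86; Del 85; Del 79;
  Del 84; Del 110; Del 134; Del 50; Del 132; Del 50; Del 130; Del 54; Del 128;
  Del 48; Del 126; Ins 101 448 960 (-64); Del 1; Ins 124 320 832 (-64); Del 1;
  Ins 48 576 704 (-64); Del 1; Ins 124 448 576 (-64); Del 1; Del 26; Del 124;
  Del 123; Del 122].

Definition k12n_591_augmentation := of_rows
  [:: [:: 1; 1; 2; 1; 1]; [:: 1; 1; 2; 0; 1]; [:: 2; 0; 1; 1; 2];
      [:: 2; 2; 1; 1; 1]; [:: 1; 0; 1; 1; 1]].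

(** Again a negative stabilization: only the last letter [-4] of the given word involves the fifth
    strand. *)
Definition k12n_591_order : seq (nat * nat) := [::].

Definition k12n_591_partner : knot_braid :=
  @KnotBraid 5 [:: 4; 3; 2; 1; -3; -4; -2; -3; 2; 1; 2; 1; 4; 3; 4; 3; 4; 3]%Z isT.

Lemma k12n_591_nonsimple (R : realType) :
  transversely_nonsimple (braid_closure R k12n_591).
Proof.
apply: (@nonsimple R k12n_591 k12n_591_partner k12n_591_moves 48); first by vm_compute.
  by rewrite /self_linking /writhe !big_cons !big_nil.
apply: not_isotopic_sym.
apply: (@not_isotopic 3 2 1 _ _ k12n_591_augmentation 0 k12n_591_order);
  [by []|by vm_compute..].
Qed.

Theorem proposition1p5 (R : realType) :
  transversely_nonsimple (braid_closure R m7_2) /\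
  transversely_nonsimple (braid_closure R m7_6) /\
  transversely_nonsimple (braid_closure R k9_44) /\
  transversely_nonsimple (braid_closure R k9_48) /\
  transversely_nonsimple (braid_closure R m10_132) /\
  transversely_nonsimple (braid_closure R k10_136) /\
  transversely_nonsimple (braid_closure R m10_140) /\
  transversely_nonsimple (braid_closure R m10_145) /\
  transversely_nonsimple (braid_closure R m10_161) /\
  transversely_nonsimple (braid_closure R k12n_591).
Proof.
by do !split; [exact: m7_2_nonsimple | exact: m7_6_nonsimple
  | exact: k9_44_nonsimple | exact: k9_48_nonsimple | exact: m10_132_nonsimple
  | exact: k10_136_nonsimple | exact: m10_140_nonsimple
  | exact: m10_145_nonsimple | exact: m10_161_nonsimple
  | exact: k12n_591_nonsimple].
Qed.
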